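(* Let $b:\mathbb{R}^d\times\mathcal{P}(\mathbb{R}^d)\to\mathbb{R}^d$, $\sigma:\mathbb{R}^d\times\mathcal{P}(\mathbb{R}^d)\to\mathbb{R}^{d\times m_1}$, $\overline\sigma:\mathbb{R}^d\times\mathcal{P}(\mathbb{R}^d)\to\mathbb{R}^{d\times m_2}$ and $\sigma_0,\sigma_1\in\mathbb{R}$. Suppose: (i) $b(\cdot,\delta_0)$ is locally Lipschitz continuous and there are constants $\lambda_1>0$, $l_0\ge 1$ and an increasing continuous function $\phi:[0,\infty)\to[0,\infty)$ with $\phi(0)=0$ such that for all $x,y\in\mathbb{R}^d$, $\mu\in\mathcal{P}_1(\mathbb{R}^d)$, $$\langle x-y,b(x,\mu)-b(y,\mu)\rangle\le |x-y|\phi(|x-y|)\mathbf{1}_{\{|x-y|\le l_0\}}-\lambda_1|x-y|^2\mathbf{1}_{\{|x-y|>l_0\}};$$ moreover there is $\lambda_2>0$ such that $|b(x,\mu)-b(x,\nu)|\le\lambda_2\mathbb{W}_1(\mu,\nu)$ for all $x\in\mathbb{R}^d$, $\mu,\nu\in\mathcal{P}_1(\mathbb{R}^d)$; (ii) there are $l\ge0$, $K>0$ such that $|b(x,\mu)-b(y,\mu)|\le K(1+|x|^l+|y|^l)|x-y|$ for all $x,y\in\mathbb{R}^d$, $\mu\in\mathcal{P}_1(\mathbb{R}^d)$; (iii) there is $\hat L>0$ such that $|\sigma(x,\mu)|\vee|\overline\sigma(x,\mu)|\le\hat L$ for all $x\in\mathbb{R}^d$, $\mu\in\mathcal{P}_1(\mathbb{R}^d)$;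 (iv) $\lambda_1>2\lambda_2$. Let $\widetilde X^{i,N}$ be the continuous-time adaptive Euler–Maruyama approximation with parameter $\delta$ defined in the context. Then for any $p>0$, $i\in\mathbb{S}_N$ and $\delta\in(0,1)$ with $\delta<\frac1{2(\lambda_1-2\lambda_2)}$, there is a constant $C>0$ such that $$\mathbb{E}|\widetilde X_t^{i,N}|^p\le\mathbb{E}|\widetilde X_0^{i,N}|^p+C,\qquad t\ge0,$$ in case $\mathbb{E}|\widetilde X_0^{i,N}|^p<\infty$.
   Context: Notation. $|\cdot|$ is the Euclidean norm of vectors and the Hilbert–Schmidt norm of matrices; $a\vee b=\max\{a,b\}$; $\delta_x$ is the Dirac mass at $x$ (the symbol $\delta$ without subscript is the scheme parameter); $\mathbb{S}_N=\{1,\dots,N\}$. $\mathcal{P}(\mathbb{R}^d)$ is the set of Borel probability measures on $\mathbb{R}^d$, $\mathcal{P}_1(\mathbb{R}^d)$ those with finite first moment, and $\mathbb{W}_1(\mu,\nu)=\inf_{\pi}\int|x-y|\,\pi(\mathrm{d}x,\mathrm{d}y)$, the infimum over couplings $\pi$ of $\mu$ and $\nu$. Probability spaces. $(\Omega^B,\mathcal{F}^B,(\mathcal{F}^B_t)_{t\ge0},\mathbb{P}^B)$ and $(\Omega^W,\mathcal{F}^W,(\mathcal{F}^W_t)_{t\ge0},\mathbb{P}^W)$ are complete filtered probability spaces satisfying the usual conditions; $\Omega=\Omega^B\times\Omega^W$, $\mathbb{P}=\mathbb{P}^B\times\mathbb{P}^W$, with expectation $\mathbb{E}$. On $\Omega^B$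 there are Brownian motions $B^i$ (dimension $d$) and $\overline B^i$ (dimension $m_1$), $i\in\mathbb{S}_N$; on $\Omega^W$ there are Brownian motions $W$ (dimension $d$) and $\overline W$ (dimension $m_2$); all are mutually independent. Adaptive Euler–Maruyama method. Let $\delta\in(0,1)$ and $h(x,\mu)=\frac1{1+|b(x,\mu)|^2}$. Starting from $t_0=0$, set $t_{n+1}=t_n+h_n$ with $h_n=\delta\min_{1\le i\le N}h(\widetilde X_{t_n}^{i,N},\widetilde\mu_{t_n}^{\widetilde X,N})$, where $\widetilde\mu_t^{\widetilde X,N}=\frac1N\sum_{j=1}^N\delta_{\widetilde X_t^{j,N}}$, and, with $\underline t=\max\{t_n:t_n\le t\}$, $$\mathrm{d}\widetilde X_t^{i,N}=b(\widetilde X_{\underline t}^{i,N},\widetilde\mu_{\underline t}^{\widetilde X,N})\mathrm{d}t+\sigma_0\mathrm{d}B_t^i+\sigma(\widetilde X_{\underline t}^{i,N},\widetilde\mu_{\underline t}^{\widetilde X,N})\mathrm{d}\overline B_t^i+\sigma_1\mathrm{d}W_t+\overline\sigma(\widetilde X_{\underline t}^{i,N},\widetilde\mu_{\underline t}^{\widetilde X,N})\mathrm{d}\overline W_t.$$ The initial data $(\widetilde X_0^{i,N})_{i\in\mathbb{S}_N}$ are i.i.d. and $\mathcal{F}_0^B$-measurable. *)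

(* Defs.v *)
From HB Require Import structures.
From mathcomp Require Import all_boot all_order all_algebra.
From mathcomp Require Import all_classical all_reals all_analysis.

Set Implicit Arguments.
Unset Strict Implicit.
Unset Printing Implicit Defensive.

Import Order.TTheory GRing.Theory Num.Theory.
Import numFieldNormedType.Exports.

Local Open Scope classical_set_scope.
Local Open Scope ring_scope.

(* Euclidean norm of a column vector, Hilbert-Schmidt norm of a matrix (the
   library norm `|A| of a matrix is the sup norm). *)
Definition hsnorm (R : realType) (m n : nat) (A : 'M[R]_(m, n)) : R :=
  Num.sqrt (\sum_(i < m) \sum_(j < n) A i j ^+ 2).

Definition inner (R : realType) (d : nat) (x y : 'cV[R]_d) : R :=
  \sum_(i < d) x i 0 * y i 0.

(* R^d with its Borel sigma-algebra; convertible to 'cV[R]_d. *)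
Notation Rd R d := (g_sigma_algebraType (@open 'cV[R]_d)).

Notation PRd R d := (probability (Rd R d) R).

Definition delta0 (R : realType) (d : nat) : PRd R d :=
  dirac ((0 : 'cV[R]_d) : Rd R d).

(* Membership in P_1(R^d). *)
Definition finite_first_moment (R : realType) (d : nat) (mu : PRd R d) : Prop :=
  (\int[mu]_x (hsnorm (x : 'cV[R]_d))%:E < +oo)%E.

Definition is_coupling (R : realType) (d : nat) (mu nu : PRd R d)
    (gam : probability (Rd R d * Rd R d)%type R) : Prop :=
  forall A : set (Rd R d), measurable A ->
    gam (fst @^-1` A) = mu A /\ gam (snd @^-1` A) = nu A.

Definition W1 (R : realType) (d : nat) (mu nu : PRd R d) : \bar R :=
  ereal_inf [set (\int[gam]_z
    (hsnorm ((z.1 : 'cV[R]_d) - (z.2 : 'cV[R]_d)))%:E)%E | gam in is_coupling mu nu].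

(* The empirical measure (1/N) \sum_j \d_(x j). It is written as the normalized
   sum of Dirac masses only so that it is a probability by construction; the
   default value delta0 is used for N = 0 alone, see empiricalE. *)
Definition empirical (R : realType) (d N : nat) (x : 'I_N -> 'cV[R]_d) : PRd R d :=
  mnormalize (msum (fun k => dirac (nth 0 (codom x) k : Rd R d)) N) (delta0 R d).

Lemma empiricalE (R : realType) (d N : nat) (x : 'I_N -> 'cV[R]_d)
    (A : set (Rd R d)) : (0 < N)%N ->
  empirical x A = ((N%:R^-1)%:E * \sum_(j < N) dirac (x j : Rd R d) A)%E.
Proof.
move=> N0; have sumE (C : set (Rd R d)) :
    msum (fun k => dirac (nth 0 (codom x) k : Rd R d)) N C =
    (\sum_(j < N) dirac (x j : Rd R d) C)%E :> \bar R.
  rewrite /msum; apply: eq_bigr => j _.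
  suff -> : nth 0 (codom x) j = x j by [].
  by rewrite (nth_map j) ?size_enum_ord// nth_ord_enum.
have sumT : (\sum_(j < N) dirac (x j : Rd R d) [set: Rd R d])%E = N%:R%:E :> \bar R.
  under eq_bigr do rewrite diracT.
  by rewrite sumEFin sumr_const card_ord.
rewrite /empirical/= /mnormalize/= !sumE sumT /= eqe pnatr_eq0 eqn0Ngt N0/= muleC; congr (_ * _)%E.
exact: sumE.
Qed.

Definition locally_lipschitz (R : realType) (d m : nat)
    (f : 'cV[R]_d -> 'cV[R]_m) : Prop :=
  forall z, exists r L : R, 0 < r /\
    forall x y, hsnorm (x - z) < r -> hsnorm (y - z) < r ->
      hsnorm (f x - f y) <= L * hsnorm (x - y).

Definition measurable_wrt (T : Type) (U : topologicalType) (G : set (set T))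
    (f : T -> U) : Prop :=
  forall D, <<s @open U >> D -> G (f @^-1` D).

(* Time is the half-line [0, +oo[ of R; values at negative times are ignored. *)
Definition is_filtration (R : realType) (dT : measure_display)
    (T : measurableType dT) (F : R -> set (set T)) : Prop :=
  [/\ forall t : R, 0 <= t -> sigma_algebra setT (F t),
      forall t : R, 0 <= t -> F t `<=` measurable &
      forall s t : R, 0 <= s -> s <= t -> F s `<=` F t].

(* Completeness of P is included, since F 0 consists of measurable sets. *)
Definition usual_conditions (R : realType) (dT : measure_display)
    (T : measurableType dT) (P : probability T R) (F : R -> set (set T)) : Prop :=
  P.-negligible `<=` F 0 /\
  forall t : R, 0 <= t -> F t = \bigcap_(s in [set s : R | t < s]) F s.

Definition adapted (R : realType) (T : Type) (U : topologicalType)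
    (F : R -> set (set T)) (X : R -> T -> U) : Prop :=
  forall t : R, 0 <= t -> measurable_wrt (F t) (X t).

(* The sigma-algebra F_tau of events prior to a random time tau. *)
Definition stopped_sigma (R : realType) (T : Type) (F : R -> set (set T))
    (tau : T -> R) : set (set T) :=
  [set A | forall t : R, 0 <= t -> F t (A `&` [set w | tau w <= t])].

(* The (w k) are mutually independent standard real Brownian motions relative to
   F: F_s and the increments w k t - w k s, k : K, are mutually independent and
   each increment is N(0, t - s). Applied to the coordinates of vector-valued
   processes, this says that they are mutually independent Brownian motions. *)
Definition brownian_family (R : realType) (dT : measure_display)
    (T : measurableType dT) (P : probability T R) (F : R -> set (set T))
    (K : finType) (w : K -> R -> T -> R) : Prop :=
  [/\ forall k om, {within `[0, +oo[, continuous (fun t => w k t om)},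
      forall k, {ae P, forall om, w k 0 om = 0},
      forall k, adapted F (w k) &
      forall s t : R, 0 <= s -> s < t ->
      forall (A : set T) (D : K -> set R), F s A -> (forall k, measurable (D k)) ->
        P (A `&` [set om | forall k, D k (w k t om - w k s om)]) =
        (P A * \prod_(k : K) normal_prob 0 (Num.sqrt (t - s)) (D k))%E].

Definition iid (R : realType) (dT : measure_display) (T : measurableType dT)
    (P : probability T R) (d N : nat) (X0 : 'I_N -> T -> 'cV[R]_d) : Prop :=
  (forall D : 'I_N -> set 'cV[R]_d, (forall i, <<s open >> (D i)) ->
     P [set om | forall i, D i (X0 i om)] = (\prod_(i < N) P (X0 i @^-1` D i))%E) /\
  (forall i j (D : set 'cV[R]_d), <<s open >> D ->
     P (X0 i @^-1` D) = P (X0 j @^-1` D)).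

Definition prod_filtration (R : realType) (TB TW : Type)
    (FB : R -> set (set TB)) (FW : R -> set (set TW)) (t : R) : set (set (TB * TW)) :=
  <<s [set A `*` C | A in FB t & C in FW t] >>.

(* delta * min_i h(x_i, mu_x), with h(x, mu) = 1 / (1 + |b(x, mu)|^2); as h <= 1,
   the neutral value 1 of the iterated minimum is harmless. *)
Definition em_step (R : realType) (d N : nat) (b : 'cV[R]_d -> PRd R d -> 'cV[R]_d)
    (delta : R) (x : 'I_N -> 'cV[R]_d) : R :=
  delta * \big[Num.min/1]_(i < N) (1 + hsnorm (b (x i) (empirical x)) ^+ 2)^-1.

Fixpoint em_grid (R : realType) (d N : nat) (b : 'cV[R]_d -> PRd R d -> 'cV[R]_d)
    (delta : R) (T : Type) (X : 'I_N -> R -> T -> 'cV[R]_d) (n : nat) (om : T) : R :=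
  if n is m.+1 then
    em_grid b delta X m om
      + em_step b delta (fun j => X j (em_grid b delta X m om) om)
  else 0.

Definition em_state (R : realType) (d N : nat) (b : 'cV[R]_d -> PRd R d -> 'cV[R]_d)
    (delta : R) (T : Type) (X : 'I_N -> R -> T -> 'cV[R]_d) (n : nat) (om : T) :
    'I_N -> 'cV[R]_d :=
  fun j => X j (em_grid b delta X n om) om.

(* The coefficients are frozen on [t_n, t_(n+1)], so the stochastic integrals are
   those of simple processes: the integrands are F_(t_n)-measurable and the
   integrals are products with Brownian increments. The values of X at times not
   reached by the grid (t >= sup_n t_n) are constrained only by adaptedness. *)
Definition is_adaptive_EM (R : realType) (d m1 m2 N : nat) (TB TW : Type)
    (F : R -> set (set (TB * TW)))
    (b : 'cV[R]_d -> PRd R d -> 'cV[R]_d)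
    (sigma : 'cV[R]_d -> PRd R d -> 'M[R]_(d, m1))
    (sigmabar : 'cV[R]_d -> PRd R d -> 'M[R]_(d, m2))
    (sigma0 sigma1 delta : R)
    (X0 : 'I_N -> TB -> 'cV[R]_d)
    (B : 'I_N -> R -> TB -> 'cV[R]_d) (Bbar : 'I_N -> R -> TB -> 'cV[R]_m1)
    (W : R -> TW -> 'cV[R]_d) (Wbar : R -> TW -> 'cV[R]_m2)
    (X : 'I_N -> R -> TB * TW -> 'cV[R]_d) : Prop :=
  let tn := em_grid b delta X in
  let xn := em_state b delta X in
  [/\ forall i, adapted F (X i),
      forall i n, measurable_wrt (stopped_sigma F (tn n))
        (fun om => sigma (xn n om i) (empirical (xn n om))),
      forall i n, measurable_wrt (stopped_sigma F (tn n))
        (fun om => sigmabar (xn n om i) (empirical (xn n om))),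
      forall i om, X i 0 om = X0 i om.1 &
      forall i n t om, tn n om <= t <= tn n.+1 om ->
        let s := tn n om in
        let x := xn n om in
        let mu := empirical x in
        X i t om = x i + (t - s) *: b (x i) mu
          + sigma0 *: (B i t om.1 - B i s om.1)
          + sigma (x i) mu *m (Bbar i t om.1 - Bbar i s om.1)
          + sigma1 *: (W t om.2 - W s om.2)
          + sigmabar (x i) mu *m (Wbar t om.2 - Wbar s om.2)].

(* Main.v *)
Require Import Defs.
From HB Require Import structures.
From mathcomp Require Import all_boot all_order all_algebra.
From mathcomp Require Import all_classical all_reals all_analysis.
From mathcomp Require Import measurable_realfun.
From mathcomp Require Import lra ring.
Import Order.TTheory GRing.Theory Num.Theory.
Import numFieldNormedType.Exports.
Local Open Scope classical_set_scope.
Local Open Scope ring_scope.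

(* The constant may depend on N, on delta and on the law of the initial data, so
   it suffices to bound E|X_t|^p uniformly in t. Let q = 2 (j + 1) >= p be an even
   integer and S(x) = \sum_i |x_i|^q. Since h_n |b|^2 <= delta, a second-order
   expansion of S over one step and the dissipativity of b (whose rate lambda1
   beats the mean-field constant lambda2) give, for a small a > 0,
     E[Y S(X_(t_(n+1)))] <= E[Y (1 - a h_n) S(X_(t_n))] + C E[Y h_n]
   for every bounded F_(t_n)-measurable weight Y >= 0, also for grids stopped at a
   fixed time t. Random times are handled by rounding them up to dyadic numbers,
   where the increments of the noise are independent of the past, and by Fatou's
   lemma. With Y = Z e^(a t_n) these inequalities telescope. If the grid never
   passes t, its steps tend to 0, which forces S(X_(t_n)) to infinity, so Fatou's
   lemma again bounds E[Z S(X_t)] by E[Z S(X_0)] + C. As S(X_0) itself need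
   not be integrable, Z is the weight (1 + S(X_0))^(p/q - 1) and
   |X_t|^p <= (1 + S(X_0))^(p/q) + Z S(X_t) by concavity of y^(p/q). *)

Set Implicit Arguments.
Unset Strict Implicit.
Unset Printing Implicit Defensive.

(** * Deterministic inequalities *)

(** The exponent q is even so that |x|^q is a polynomial in |x|^2: one step of the scheme is then an
    algebraic expansion, and finitely many Gaussian moments take the place of stochastic calculus.
    Summing over all particles lets the mean-field constant enter with factor 1: by Chebyshev's sum
    inequality, the mean of the |x_k| times the sum of the |x_i|^(q-1) is at most the sum of the
    |x_i|^q. Equality of the initial laws carries the moment assumption on one particle over to all
    of them. The main obstacle is that the noise of one step runs between two random times. The way
    out is that t_(n+1) is already F_(t_n)-measurable: prescribing the dyadic roundings of both
    times is an event known at the earlier rounded time, so on this event the increment is one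
    between two fixed times, independent of the weight. Its linear contribution then has mean zero
    by symmetry of the Gaussian law, and its even powers are of the order of the step. *)

Section Euclid.
Context {R : realType}.
Implicit Types d : nat.

Lemma inner_ge0 d (x : 'cV[R]_d) : 0 <= inner x x.
Proof. by apply: sumr_ge0 => i _; rewrite -expr2 sqr_ge0. Qed.

Lemma hsnorm_ge0 m n (A : 'M[R]_(m, n)) : 0 <= hsnorm A.
Proof. exact: sqrtr_ge0. Qed.

Lemma hsnorm_sqr m n (A : 'M[R]_(m, n)) :
  hsnorm A ^+ 2 = \sum_(i < m) \sum_(j < n) A i j ^+ 2.
Proof.
by rewrite sqr_sqrtr//; do 2![apply: sumr_ge0 => ? _]; exact: sqr_ge0.
Qed.

Lemma hsnorm_sqr_cV d (x : 'cV[R]_d) : hsnorm x ^+ 2 = inner x x.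
Proof.
by rewrite hsnorm_sqr; apply: eq_bigr => i _; rewrite big_ord1 expr2.
Qed.

Lemma innerDr d (x y z : 'cV[R]_d) : inner x (y + z) = inner x y + inner x z.
Proof. by rewrite -big_split; apply: eq_bigr => i _; rewrite mxE mulrDr. Qed.

Lemma innerC d (x y : 'cV[R]_d) : inner x y = inner y x.
Proof. by apply: eq_bigr => i _; rewrite mulrC. Qed.

Lemma innerZr d a (x y : 'cV[R]_d) : inner x (a *: y) = a * inner x y.
Proof.
by rewrite /inner big_distrr/=; apply: eq_bigr => i _; rewrite mxE mulrCA.
Qed.

Lemma inner_sumr d (I : finType) (x : 'cV[R]_d) (y : I -> 'cV[R]_d) :
  inner x (\sum_c y c) = \sum_c inner x (y c).
Proof.
rewrite [RHS]exchange_big/=; apply: eq_bigr => i _.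
by rewrite summxE mulr_sumr.
Qed.

Lemma hsnormN d (x : 'cV[R]_d) : hsnorm (- x) = hsnorm x.
Proof.
congr (Num.sqrt _); apply: eq_bigr => i _; apply: eq_bigr => j _.
by rewrite mxE sqrrN.
Qed.

Lemma hsnorm0 d : hsnorm (0 : 'cV[R]_d) = 0.
Proof.
rewrite /hsnorm big1 ?sqrtr0// => i _; rewrite big1// => j _.
by rewrite mxE expr0n.
Qed.

(** Cauchy-Schwarz, from the nonnegativity of |B x - c y|^2 = B (A B - c^2) with A = |x|^2, B =
    |y|^2 and c the inner product. If B = 0 this says nothing, but then y vanishes coordinate by
    coordinate. *)
Lemma ler_norm_inner d (x y : 'cV[R]_d) : `|inner x y| <= hsnorm x * hsnorm y.
Proof.
have xy0 := mulr_ge0 (hsnorm_ge0 x) (hsnorm_ge0 y).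
rewrite -(@ler_pXn2r _ 2)// ?nnegrE ?normr_ge0//.
rewrite real_normK ?num_real// exprMn !hsnorm_sqr_cV.
set A := inner x x; set B := inner y y; set c := inner x y.
have [B0|B0] := eqVneq B 0.
  suff -> : c = 0 by rewrite expr0n B0 mulr0.
  apply: big1 => i _; move/eqP: B0; rewrite psumr_eq0; last first.
    by move=> j _; rewrite -expr2 sqr_ge0.
  by move=> /allP/(_ i (mem_index_enum i)); rewrite /= mulf_eq0 orbb => /eqP->; rewrite mulr0.
have Bgt0 : 0 < B by rewrite lt_neqAle eq_sym B0 inner_ge0.
have := inner_ge0 (B *: x + (- c) *: y).
rewrite innerDr !innerZr ![inner (_ + _) _]innerC !innerDr !innerZr.
rewrite [inner y x]innerC -/A -/B -/c => H.
have {}H : 0 <= B * (A * B - c ^+ 2) by move: H; congr (_ <= _); ring.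
by move: H; rewrite pmulr_rge0// subr_ge0.
Qed.

Lemma hsnormD_sqr d (x y : 'cV[R]_d) :
  hsnorm (x + y) ^+ 2 = hsnorm x ^+ 2 + 2 * inner x y + hsnorm y ^+ 2.
Proof.
rewrite !hsnorm_sqr_cV innerDr ![inner (_ + _) _]innerC !innerDr.
by rewrite [inner y x]innerC; ring.
Qed.

Lemma ler_hsnormD d (x y : 'cV[R]_d) : hsnorm (x + y) <= hsnorm x + hsnorm y.
Proof.
have xy0 := addr_ge0 (hsnorm_ge0 x) (hsnorm_ge0 y).
rewrite -(@ler_pXn2r _ 2)// ?nnegrE ?hsnorm_ge0// hsnormD_sqr.
have := le_trans (ler_norm _) (ler_norm_inner x y); nra.
Qed.

Lemma hsnormZ d a (x : 'cV[R]_d) : hsnorm (a *: x) = `|a| * hsnorm x.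
Proof.
apply/eqP; rewrite -(@eqrXn2 _ 2)// ?mulr_ge0 ?hsnorm_ge0//.
rewrite exprMn real_normK ?num_real// !hsnorm_sqr_cV innerZr innerC innerZr.
by rewrite mulrA expr2.
Qed.

Lemma ler_hsnorm_sum d (I : finType) (x : I -> 'cV[R]_d) :
  hsnorm (\sum_c x c) <= \sum_c hsnorm (x c).
Proof.
elim/big_ind2 : _ => [|u a v c ua vc|//]; first by rewrite hsnorm0.
by rewrite (le_trans (ler_hsnormD _ _))// lerD.
Qed.

Lemma ler_hsnormB d (x y : 'cV[R]_d) : hsnorm x <= hsnorm (x - y) + hsnorm y.
Proof. by have := ler_hsnormD (x - y) y; rewrite subrK. Qed.

End Euclid.

Section RealInequalities.
Context {R : realType}.

(* Second-order Taylor bound for [v |-> v ^ (j + 1)] at [r ^ 2]. *)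
Lemma taylor_sqr_pow (j : nat) : exists C : R, 0 <= C /\
  forall r s c : R, 0 <= r -> 0 <= s -> `|c| <= r * s ->
  (r ^+ 2 + 2 * c + s ^+ 2) ^+ j.+1 <=
  (r ^+ 2) ^+ j.+1 + (2 * j.+1)%:R * (r ^+ 2) ^+ j * c
  + C * (((r + s) ^+ 2) ^+ j * s ^+ 2).
Proof.
elim: j => [|j [C [C0 IH]]].
  exists 1; split=> // r s c r0 s0 crs.
  by rewrite !expr0 !expr1 !mulr1 !mul1r.
(* Multiplying the bound for j by P leaves, besides the terms to keep, A^(j+1) s^2, 4 (j+1) A^j c^2
   and 2 (j+1) A^j c s^2. Up to its coefficient each is at most T^(j+1) s^2, hence 1 + 6 (j+1); the
   old remainder C T^j s^2 P costs another C, as P <= T. *)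
exists (C + 1 + (6 * j.+1)%:R); split; first by rewrite !addr_ge0.
move=> r s c r0 s0 crs; have {}IH := IH r s c r0 s0 crs.
have /andP[c1 c2] : - (r * s) <= c <= r * s by rewrite -ler_norml.
have c2rs : c ^+ 2 <= r ^+ 2 * s ^+ 2.
  by rewrite -exprMn -[c ^+ 2]real_normK ?num_real// lerXn2r// nnegrE// mulr_ge0.
set A := r ^+ 2 in IH c2rs *; set T := (r + s) ^+ 2 in IH *.
set P := A + 2 * c + s ^+ 2 in IH *.
have A0 : 0 <= A by rewrite sqr_ge0.
have P0 : 0 <= P.
  have := sqr_ge0 (r - s); rewrite sqrrB /P /A => h; nra.
have PT : P <= T by rewrite /P /A /T sqrrD; nra.
have AT : A <= T by rewrite /T /A; nra.
have cT : c <= T by rewrite /T; nra.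
have T0 : 0 <= T by rewrite sqr_ge0.
rewrite exprSr; apply: (le_trans (ler_wpM2r P0 IH)).
have ATj : A ^+ j <= T ^+ j by rewrite lerXn2r// ?nnegrE.
have Aj0 : 0 <= A ^+ j by rewrite exprn_ge0.
have S0 : 0 <= s ^+ 2 by rewrite sqr_ge0.
have h1 : A ^+ j * A * s ^+ 2 <= T ^+ j * T * s ^+ 2 by rewrite ler_wpM2r// ler_pM.
have h2 : A ^+ j * c ^+ 2 <= T ^+ j * T * s ^+ 2.
  by apply: le_trans h1; rewrite -mulrA ler_wpM2l.
have h3 : A ^+ j * c * s ^+ 2 <= T ^+ j * T * s ^+ 2.
  rewrite ler_wpM2r//; apply: (le_trans (ler_wpM2l Aj0 cT)).
  by rewrite ler_wpM2r.
have h4 : C * (T ^+ j * s ^+ 2 * P) <= C * (T ^+ j * T * s ^+ 2).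
  rewrite ler_wpM2l// mulrAC ler_wpM2r// ler_wpM2l// exprn_ge0//.
have k0 : 0 <= j.+1%:R :> R by [].
rewrite !natrM [j.+2%:R]mulrS !exprSr.
set k := j.+1%:R in k0 *.
have g2 := ler_wpM2l k0 h2; have g3 := ler_wpM2l k0 h3.
rewrite /P in h4 *.
move: h1 g2 g3 h4; set a := A ^+ j; set t := T ^+ j => h1 g2 g3 h4; lra.
Qed.

(** Every term is bounded by the largest one, whose power is among the summands. The positive
    exponent makes the case of an empty [I] true. *)
Lemma sum_expr_le (I : finType) (a : I -> R) n : (forall i, 0 <= a i) ->
  (\sum_i a i) ^+ n.+1 <= #|I|%:R ^+ n.+1 * \sum_i a i ^+ n.+1.
Proof.
move=> a0; case: (pickP I) => [i0 _|I0]; last first.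
  by rewrite !big_pred0// exprS mul0r mulr0.
have [i _ imax] := arg_maxP a (isT : xpredT i0).
have h : \sum_j a j <= #|I|%:R * a i.
  rewrite mulr_natl -sumr_const; apply: ler_sum => j _; exact: imax.
apply: (@le_trans _ _ ((#|I|%:R * a i) ^+ n.+1)).
  rewrite lerXn2r// nnegrE ?sumr_ge0// mulr_ge0//.
rewrite exprMn ler_wpM2l ?exprn_ge0// (bigD1 i)//= lerDl.
by apply: sumr_ge0 => j _; rewrite exprn_ge0.
Qed.

Lemma exprD_le (a b : R) n : 0 <= a -> 0 <= b ->
  (a + b) ^+ n <= 2 ^+ n * (a ^+ n + b ^+ n).
Proof.
move=> a0 b0; case: n => [|n]; first by rewrite !expr0; lra.
have := @sum_expr_le bool (fun t => if t then a else b) n.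
by rewrite card_bool !big_bool/=; apply; case.
Qed.

(** The threshold is r = 1 + C / e: below it the left side is bounded by a constant, above it r >= 1
    and C <= e r, so that C r^m <= e r^(m+1) <= e r^n. *)
Lemma lower_order_absorb (C e : R) (m n : nat) : 0 <= C -> 0 < e -> (m < n)%N ->
  exists K : R, 0 <= K /\ forall r : R, 0 <= r -> C * r ^+ m <= e * r ^+ n + K.
Proof.
move=> C0 e0 mn; have Ce0 : 0 <= C / e by rewrite divr_ge0// ltW.
have B0 : 0 <= 1 + C / e by rewrite addr_ge0.
exists (C * (1 + C / e) ^+ m); split; first by rewrite mulr_ge0// exprn_ge0.
move=> r r0; have [rB|rB] := leP r (1 + C / e).
  rewrite -[leLHS]add0r lerD//; first by rewrite mulr_ge0 ?exprn_ge0// ltW.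
  by rewrite ler_wpM2l// lerXn2r// ?nnegrE.
have r1 : 1 <= r by lra.
rewrite -[leLHS]addr0 lerD//; last by rewrite mulr_ge0// exprn_ge0.
have : C <= e * r by rewrite -ler_pdivrMl// mulrC; lra.
move=> /(ler_wpM2r (exprn_ge0 m r0)) /le_trans; apply.
by rewrite -mulrA -exprS ler_pM2l// ler_weXn2l.
Qed.

(** Chebyshev's sum inequality: (r_i - r_j) (r_i^n - r_j^n) >= 0, summed over all pairs. It bounds
    the mean-field interaction without a combinatorial factor. *)
Lemma mean_mul_sum_le (N : nat) (r : 'I_N -> R) n : (forall i, 0 <= r i) ->
  (N%:R^-1 * \sum_j r j) * \sum_i r i ^+ n <= \sum_i r i ^+ n.+1.
Proof.
move=> r0; case: (posnP N) => [N0|N0].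
  by rewrite !(big1 _ xpredT) ?mulr0// => i _; have := ltn_ord i; rewrite {2}N0.
rewrite -mulrA ler_pdivrMl ?ltr0n//.
have pair i j : r j * r i ^+ n + r i * r j ^+ n <= r i ^+ n.+1 + r j ^+ n.+1.
  rewrite !exprS.
  have [ij|/ltW ij] := leP (r i) (r j).
    by have := @lerXn2r _ n (r i) (r j); rewrite !nnegrE !r0 => /(_ isT isT ij); nra.
  by have := @lerXn2r _ n (r j) (r i); rewrite !nnegrE !r0 => /(_ isT isT ij); nra.
have dbl : \sum_i \sum_j (r j * r i ^+ n + r i * r j ^+ n) <=
   \sum_i \sum_j (r i ^+ n.+1 + r j ^+ n.+1).
  by do 2![apply: ler_sum => ? _].
have E1 : \sum_i \sum_j (r j * r i ^+ n + r i * r j ^+ n) =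
    2 * ((\sum_j r j) * \sum_i r i ^+ n).
  under eq_bigr => i _ do rewrite big_split/= -mulr_suml -mulr_sumr.
  rewrite big_split/= -mulr_suml -mulr_sumr; ring.
have E2 : \sum_i \sum_j (r i ^+ n.+1 + r j ^+ n.+1) = 2 * (N%:R * \sum_i r i ^+ n.+1).
  under eq_bigr => i _ do
    rewrite big_split/= sumr_const card_ord -[r i ^+ n.+1 *+ N]mulr_natl.
  by rewrite big_split/= sumr_const card_ord -mulr_sumr -[_ *+ N]mulr_natl; ring.
by move: dbl; rewrite E1 E2 ler_pM2l.
Qed.

(** To be read with r_i = |x_i| and g_i = <x_i, b(x_i, mu_x)>: the derivative of the power sum along
    the drift, plus a multiple [C4] of the terms of order 2 j left by the noise and by the step
    error. The mean-field term uses up [l2] of the rate [l1]. *)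
Lemma mean_field_drift (N j : nat) (l1 l2 C0 C4 : R) :
  l2 < l1 -> 0 <= l2 -> 0 <= C0 -> 0 <= C4 ->
  exists a C : R, [/\ 0 < a, a <= 1, 0 <= C &
  forall r g : 'I_N -> R, (forall i, 0 <= r i) ->
   (forall i, g i <= - l1 * r i ^+ 2 + l2 * r i * (N%:R^-1 * \sum_k r k) + C0 * (1 + r i)) ->
   (2 * j.+1)%:R * (\sum_i (r i ^+ 2) ^+ j * g i) + C4 * \sum_i (1 + (r i ^+ 2) ^+ j)
   <= - a * \sum_i (r i ^+ 2) ^+ j.+1 + C].
Proof.
move=> l12 l20 C00 C40; set q := (2 * j.+1)%:R.
have q0 : 0 < q :> R by rewrite ltr0n.
pose k := l1 - l2; have k0 : 0 < k by rewrite subr_gt0.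
(* Half of the remaining rate q (l1 - l2). It is shared in thirds among the lower-order terms q C0
   r^(2j), q C0 r^(2j+1) and C4 r^(2j). *)
pose e := q * k / 2; have e0 : 0 < e by rewrite divr_gt0// mulr_gt0.
have e3 : 0 < e / 3 by rewrite divr_gt0.
have qC0 : 0 <= q * C0 by rewrite mulr_ge0// ltW.
have [K1 [K10 H1]] := @lower_order_absorb (q * C0) (e / 3) (2 * j) (2 * j.+1) qC0 e3 ltac:(by rewrite ltn_pmul2l).
have [K2 [K20 H2]] := @lower_order_absorb (q * C0) (e / 3) (2 * j).+1 (2 * j.+1) qC0 e3 ltac:(by rewrite mulnS).
have [K3 [K30 H3]] := @lower_order_absorb C4 (e / 3) (2 * j) (2 * j.+1) C40 e3 ltac:(by rewrite ltn_pmul2l).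
(* The minimum with 1 keeps 1 - a h nonnegative for every step h <= 1. *)
exists (Num.min 1 e), (N%:R * (K1 + K2 + K3 + C4)); split.
- by rewrite lt_min ltr01.
- by rewrite ge_min lexx.
- by rewrite mulr_ge0// !addr_ge0.
move=> r g r0 gr; set m := N%:R^-1 * \sum_k r k.
have S0 : 0 <= \sum_i (r i ^+ 2) ^+ j.+1.
  by apply: sumr_ge0 => i _; rewrite exprn_ge0// sqr_ge0.
have step1 : q * (\sum_i (r i ^+ 2) ^+ j * g i) + C4 * \sum_i (1 + (r i ^+ 2) ^+ j)
  <= \sum_i (- q * l1 * (r i ^+ 2) ^+ j.+1 + q * l2 * (m * r i ^+ (2 * j).+1)
      + e * (r i ^+ 2) ^+ j.+1 + (K1 + K2 + K3 + C4)).
  rewrite !mulr_sumr -big_split/=; apply: ler_sum => i _.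
  have rj0 : 0 <= (r i ^+ 2) ^+ j by rewrite exprn_ge0// sqr_ge0.
  have := ler_wpM2l (mulr_ge0 (ltW q0) rj0) (gr i).
  have := H1 _ (r0 i); have := H2 _ (r0 i); have := H3 _ (r0 i).
  rewrite -/m [r i ^+ (2 * j).+1]exprSr !exprM [(r i ^+ 2) ^+ j.+1]exprSr.
  set u := (r i ^+ 2) ^+ j; move=> h3 h2 h1 h0.
  apply: (@le_trans _ _ (q * u * (- l1 * r i ^+ 2 + l2 * r i * m + C0 * (1 + r i)) + C4 * (1 + u))).
    by rewrite mulrA lerD2r.
  lra.
apply: (le_trans step1); rewrite !big_split/= -!mulr_sumr !sumr_const card_ord.
rewrite -!mulrnDl -[(_ + C4) *+ N]mulr_natl lerD2r.
have := mean_mul_sum_le (2 * j).+1 r0; rewrite -/m.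
have -> : \sum_i r i ^+ (2 * j).+2 = \sum_i (r i ^+ 2) ^+ j.+1.
  by apply: eq_bigr => i _; rewrite -exprM mulnS.
move=> /(ler_wpM2l (mulr_ge0 (ltW q0) l20)).
have : Num.min 1 e * \sum_i (r i ^+ 2) ^+ j.+1 <= e * \sum_i (r i ^+ 2) ^+ j.+1.
  by rewrite ler_wpM2r// ge_min lexx orbT.
rewrite /e /k; set S := \sum_i _; lra.
Qed.

(** The Taylor bound for one particle moved by eta = [D *: be] plus noise. Adaptivity enters through
    D |be|^2 <= 1: it gives |D be|^2 <= D, so the quadratic error of the drift is linear in the step
    however large [be] is. The linear term is kept exact; the noise otherwise occurs only through
    its powers 2 and 2 (j+1). *)
Lemma perturb_pow (K : finType) (j : nat) (L : R) : 0 <= L ->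
  exists C : R, 0 <= C /\
  forall d (x be : 'cV[R]_d) (D : R) (G : K -> 'cV[R]_d) (w : K -> R),
  0 <= D -> D <= 1 -> D * hsnorm be ^+ 2 <= 1 -> (forall c, hsnorm (G c) <= L) ->
  (hsnorm (x + D *: be + \sum_c w c *: G c) ^+ 2) ^+ j.+1 <=
   (hsnorm x ^+ 2) ^+ j.+1
   + (2 * j.+1)%:R * (hsnorm x ^+ 2) ^+ j * (D * inner x be + \sum_c w c * inner x (G c))
   + C * ((1 + (hsnorm x ^+ 2) ^+ j) * (D + \sum_c (w c ^+ 2 + (w c ^+ 2) ^+ j.+1))).
Proof.
move=> L0; have [C1 [C10 HC1]] := taylor_sqr_pow j.
(* [D0] is chosen for |eta|^2 <= D0 (D + sum of w_c^2), by |u + v|^2 <= 2 |u|^2 + 2 |v|^2; the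
   second summand of [D1] does the same for |eta|^(2 (j+1)). *)
pose D0 : R := 2 + 2 * (L ^+ 2 * #|K|%:R ^+ 2).
have D00 : 0 <= D0 by rewrite addr_ge0// !mulr_ge0// ?exprn_ge0.
pose D1 : R := D0 + D0 ^+ j.+1 * 2 ^+ j.+1 * (1 + #|K|%:R ^+ j.+1).
have D10 : 0 <= D1.
  by rewrite addr_ge0// mulr_ge0// ?addr_ge0// ?mulr_ge0// exprn_ge0.
exists (C1 * (2 ^+ j * 2 ^+ j * D1)); split.
  by rewrite mulr_ge0// mulr_ge0// mulr_ge0// exprn_ge0.
move=> d x be D G w Dge0 D1le Dbe GL.
set eta := D *: be + \sum_c w c *: G c.
rewrite -addrA -/eta hsnormD_sqr.
apply: (le_trans (HC1 _ _ _ (hsnorm_ge0 _) (hsnorm_ge0 _) (ler_norm_inner _ _))).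
have -> : inner x eta = D * inner x be + \sum_c w c * inner x (G c).
  by rewrite /eta innerDr innerZr inner_sumr; under eq_bigr do rewrite innerZr.
rewrite lerD2l -mulrA ler_wpM2l//.
set r := hsnorm x; set s := hsnorm eta.
set A := (r ^+ 2) ^+ j.
have A0 : 0 <= A by rewrite exprn_ge0// sqr_ge0.
set W := \sum_c w c ^+ 2; have W0 : 0 <= W by apply: sumr_ge0 => c _; rewrite sqr_ge0.
set Wq := \sum_c (w c ^+ 2) ^+ j.+1.
have Wq0 : 0 <= Wq by apply: sumr_ge0 => c _; rewrite exprn_ge0// sqr_ge0.
have xi2 : hsnorm (\sum_c w c *: G c) ^+ 2 <= L ^+ 2 * #|K|%:R ^+ 2 * W.
  apply: (@le_trans _ _ ((\sum_c L * `|w c|) ^+ 2)).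
    rewrite lerXn2r ?nnegrE ?hsnorm_ge0//.
      by apply: sumr_ge0 => c _; rewrite mulr_ge0.
    apply: (le_trans (ler_hsnorm_sum _)); apply: ler_sum => c _.
    by rewrite hsnormZ mulrC ler_wpM2r.
  rewrite -mulr_sumr exprMn -mulrA ler_wpM2l ?sqr_ge0//.
  have := @sum_expr_le _ (fun c => `|w c|) 1 (fun c => normr_ge0 _).
  by under [X in _ <= _ * X]eq_bigr do rewrite real_normK ?num_real//.
have s2 : s ^+ 2 <= D0 * (D + W).
  have h : s ^+ 2 <= (D * hsnorm be + hsnorm (\sum_c w c *: G c)) ^+ 2.
    rewrite lerXn2r ?nnegrE ?hsnorm_ge0// ?addr_ge0 ?mulr_ge0 ?hsnorm_ge0//.
    by rewrite (le_trans (ler_hsnormD _ _))// hsnormZ (ger0_norm Dge0).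
  apply: (le_trans h).
  have := sqr_ge0 (D * hsnorm be - hsnorm (\sum_c w c *: G c)).
  have DD : D ^+ 2 * hsnorm be ^+ 2 <= D.
    rewrite expr2 -mulrA -[leRHS]mulr1 ler_wpM2l//.
  have : 0 <= L ^+ 2 * #|K|%:R ^+ 2 * D by rewrite !mulr_ge0 ?sqr_ge0.
  rewrite /D0; move: xi2 DD; set y := hsnorm (\sum_c _); set b := hsnorm be.
  set k := L ^+ 2 * _; nra.
have s20 : 0 <= s ^+ 2 by rewrite sqr_ge0.
have T1 : (r + s) ^+ 2 <= 2 * (r ^+ 2 + s ^+ 2) by have := sqr_ge0 (r - s); nra.
have T2 : ((r + s) ^+ 2) ^+ j <= 2 ^+ j * 2 ^+ j * (A + (s ^+ 2) ^+ j).
  apply: (@le_trans _ _ ((2 * (r ^+ 2 + s ^+ 2)) ^+ j)).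
    by rewrite lerXn2r ?nnegrE ?sqr_ge0// mulr_ge0// addr_ge0 ?sqr_ge0.
  by rewrite exprMn -mulrA ler_wpM2l ?exprn_ge0// exprD_le ?sqr_ge0.
have DW0 : 0 <= D + W by rewrite addr_ge0.
have Dj : D ^+ j.+1 <= D.
  by rewrite exprS -[leRHS]mulr1 ler_wpM2l// exprn_ile1.
have sj : (s ^+ 2) ^+ j.+1 <= D0 ^+ j.+1 * 2 ^+ j.+1 * (1 + #|K|%:R ^+ j.+1) * (D + Wq).
  apply: (@le_trans _ _ ((D0 * (D + W)) ^+ j.+1)).
    by rewrite lerXn2r ?nnegrE// mulr_ge0.
  rewrite exprMn -!mulrA ler_wpM2l ?exprn_ge0//.
  apply: (le_trans (exprD_le _ _ _)) => //; rewrite ler_wpM2l ?exprn_ge0//.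
  apply: (@le_trans _ _ (D + #|K|%:R ^+ j.+1 * Wq)).
    by rewrite lerD// sum_expr_le// => c; rewrite sqr_ge0.
  have : 0 <= #|K|%:R ^+ j.+1 :> R by rewrite exprn_ge0.
  nra.
rewrite big_split/= -/W -/Wq.
apply: (@le_trans _ _ (2 ^+ j * 2 ^+ j * (A + (s ^+ 2) ^+ j) * s ^+ 2)).
  by rewrite ler_wpM2r.
rewrite -!mulrA ler_wpM2l ?exprn_ge0// ler_wpM2l ?exprn_ge0//.
rewrite mulrDl -exprSr /D1; move: sj.
set E := D0 ^+ j.+1 * _ * _ => sj.
have E0 : 0 <= E by rewrite !mulr_ge0 ?exprn_ge0// addr_ge0 ?exprn_ge0.
have h1 : A * s ^+ 2 <= A * (D0 * (D + W)) by rewrite ler_wpM2l.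
have h2 : 0 <= D0 * (D + W) by rewrite mulr_ge0.
have h3 : 0 <= D0 * Wq by rewrite mulr_ge0.
have h4 : 0 <= E * (D + Wq) by rewrite mulr_ge0// addr_ge0.
have h5 : 0 <= E * W by rewrite mulr_ge0.
nra.
Qed.

End RealInequalities.

(** * Gaussian integrals *)

Section Density.
Local Open Scope ereal_scope.
Context d (T : measurableType d) (R : realType).
Variables (mu nu : {measure set T -> \bar R}) (p : T -> R).
Hypothesis mp : measurable_fun setT p.
Hypothesis p0 : forall x, (0 <= p x)%R.
Hypothesis nuE : forall A, measurable A -> nu A = \int[mu]_(x in A) (p x)%:E.

Import HBNNSimple.

(** The hypothesis [nuE] gives the case of indicators; simple functions follow by linearity, and
    nonnegative functions by monotone convergence on both sides. *)
Lemma ge0_integral_density (f : T -> \bar R) : measurable_fun setT f ->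
  (forall x, 0 <= f x) -> \int[nu]_x f x = \int[mu]_x (f x * (p x)%:E).
Proof.
move=> mf f0; pose h := nnsfun_approx measurableT mf.
have simple (g : {nnsfun T >-> R}) :
    \int[nu]_x (g x)%:E = \int[mu]_x ((g x)%:E * (p x)%:E).
  rewrite integralT_nnsfun sintegralE.
  under [RHS]eq_integral => x _.
    rewrite fimfunE -fsumEFin// ge0_mule_fsuml; last first.
      by move=> r; rewrite EFinM nnfun_muleindic_ge0.
    over.
  rewrite ge0_integral_fsum//; last 2 first.
  - move=> r; apply: emeasurable_funM; last exact/measurable_EFinP.
    exact/measurable_EFinP/measurable_funM.
  - by move=> r x _; rewrite mule_ge0 ?lee_fin// -lee_fin EFinM nnfun_muleindic_ge0.
  apply: eq_fsbigr => r /[!inE] -[x _ <-].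
  have mA : measurable (g @^-1` [set g x]) by [].
  rewrite nuE//.
  under [RHS]eq_integral do rewrite EFinM -muleA.
  rewrite ge0_integralZl//; last 3 first.
  - by apply: emeasurable_funM; exact/measurable_EFinP.
  - by move=> y _; rewrite mule_ge0// lee_fin.
  - by rewrite lee_fin.
  congr (_ * _); rewrite integral_mkcond epatch_indic.
  by apply: eq_integral => y _ /=; rewrite muleC.
have fE x : f x = limn (fun n => (h n x)%:E).
  by apply/esym/cvg_lim => //; exact: cvg_nnsfun_approx.
transitivity (limn (fun n => \int[nu]_x (h n x)%:E)).
  under eq_integral do rewrite fE.
  apply: monotone_convergence => //.
  - by move=> n; exact/measurable_EFinP.
  - by move=> n x _; rewrite lee_fin.
  - by move=> x _ a b ab; rewrite lee_fin; exact/lefP/nd_nnsfun_approx.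
transitivity (limn (fun n => \int[mu]_x ((h n x)%:E * (p x)%:E))).
  by congr (limn _); apply/funext => n; exact: simple.
rewrite -monotone_convergence//.
- apply: eq_integral => x _; apply/cvg_lim => //.
  by apply: cvgeZr => //; exact: cvg_nnsfun_approx.
- by move=> n; apply: emeasurable_funM; exact/measurable_EFinP.
- by move=> n x _; rewrite mule_ge0// lee_fin.
- move=> x _ a b ab; rewrite lee_wpmul2r ?lee_fin//.
  exact/lefP/nd_nnsfun_approx.
Qed.

End Density.

Section Gaussian.
Context {R : realType}.
Local Notation mu := (@lebesgue_measure R).

Lemma ge0_integral_normal (s : R) (f : R -> \bar R) : measurable_fun setT f ->
  (forall x, (0 <= f x)%E) ->
  (\int[normal_prob 0 s]_x f x = \int[mu]_x (f x * (normal_pdf 0 s x)%:E))%E.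
Proof.
move=> mf f0; apply: ge0_integral_density => //; first exact: measurable_normal_pdf.
by move=> x; exact: normal_pdf_ge0.
Qed.

(** Lebesgue measure and the density are both even. This symmetry is what makes Gaussian means
    vanish in [integral_gaussian_mul]. *)
Lemma normal_probN (s : R) (D : set R) : s != 0 -> measurable D ->
  normal_prob 0 s (-%R @^-1` D) = normal_prob 0 s D.
Proof.
move=> s0 mD; rewrite [RHS]/normal_prob.
transitivity (\int[pushforward mu (-%R : _ -> measurableTypeR R)]_(x in D)
    (normal_pdf 0 s x)%:E)%E; last first.
  by apply: eq_measure_integral => A mA _; exact: lebesgue_measureN.
rewrite ge0_integral_pushforward//; last first.
- by move=> x _; rewrite lee_fin normal_pdf_ge0.
- by apply/measurable_funTS/measurable_EFinP; exact: measurable_normal_pdf.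
apply: eq_integral => x _; rewrite /= !normal_pdfE//; congr (_ * _)%:E.
by rewrite /normal_fun !subr0 sqrrN.
Qed.

(** Since x^2 / (4 s^2) - x^2 / (2 s^2) = - x^2 / (4 s^2), the factor doubles the variance; the
    normalizing constant changes by the square root of 2. *)
Lemma normal_pdf_sqrt2 (s x : R) : 0 < s ->
  expR (x ^+ 2 / (4 * s ^+ 2)) * normal_pdf 0 s x =
  Num.sqrt 2 * normal_pdf 0 (Num.sqrt 2 * s) x.
Proof.
move=> s0; have s2 : Num.sqrt 2 != 0 :> R by rewrite gt_eqF// sqrtr_gt0.
rewrite !normal_pdfE ?mulf_neq0 ?gt_eqF//.
rewrite mulrCA [RHS]mulrA; congr (_ * _); last first.
  rewrite /normal_fun -expRD; congr expR; rewrite subr0 exprMn sqr_sqrtr//.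
  by rewrite -[(s ^+ 2) *+ 2]mulr_natl -[(2 * s ^+ 2) *+ 2]mulr_natl; field; rewrite gt_eqF.
rewrite /normal_peak exprMn sqr_sqrtr//.
have -> : 2 * s ^+ 2 * pi *+ 2 = 2 * (s ^+ 2 * pi *+ 2) by rewrite -mulrA mulrnAr.
by rewrite [Num.sqrt (2 * _)]sqrtrM// invfM mulrA divff// mul1r.
Qed.

(** With y = x^2 / (4 s^2), y^j <= j! e^y bounds x^(2j) by (4 s^2)^j j! e^y, and e^y times the
    density is the square root of 2 times another normal density. This yields the constant and the
    scaling in [s] at once. *)
Lemma normal_moment_le (j : nat) : exists M : R, 0 <= M /\
  forall s : R, 0 < s ->
  (\int[normal_prob 0 s]_x ((x ^+ 2) ^+ j)%:E <= (M * (s ^+ 2) ^+ j)%:E)%E.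
Proof.
have M0 : 0 <= 4 ^+ j * j`!%:R * Num.sqrt 2 :> R by rewrite !mulr_ge0.
exists (4 ^+ j * j`!%:R * Num.sqrt 2); split=> //.
move=> s s0; have ms n : measurable_fun setT (fun x : R => ((x ^+ 2) ^+ n)%:E).
  by apply/measurable_EFinP; do 2![apply: measurable_funX].
have mpdf r : measurable_fun setT (fun x : R => (normal_pdf 0 r x)%:E).
  by apply/measurable_EFinP; exact: measurable_normal_pdf.
rewrite ge0_integral_normal//; last first.
  by move=> x; rewrite lee_fin exprn_ge0// sqr_ge0.
apply: (@le_trans _ _ (\int[mu]_x ((4 ^+ j * j`!%:R * Num.sqrt 2 * (s ^+ 2) ^+ j)%:E *
   (normal_pdf 0 (Num.sqrt 2 * s) x)%:E))%E); last first.
  rewrite ge0_integralZl//.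
  - by rewrite integral_normal_pdf mule1.
  - by apply/measurable_EFinP; exact: measurable_normal_pdf.
  - by move=> x _; rewrite lee_fin normal_pdf_ge0.
  - by rewrite lee_fin mulr_ge0// exprn_ge0// sqr_ge0.
apply: ge0_le_integral => //.
- move=> x _; apply: mule_ge0; rewrite lee_fin ?normal_pdf_ge0//.
  exact/exprn_ge0/sqr_ge0.
- apply: emeasurable_funM; first exact: ms.
  exact: mpdf.
- by apply: emeasurable_funM => //; exact: mpdf.
move=> x _; rewrite -!EFinM lee_fin.
rewrite [X in _ <= X * _]mulrAC -[X in _ <= X]mulrA -normal_pdf_sqrt2// mulrA.
rewrite ler_wpM2r ?normal_pdf_ge0//.
have s2 : 0 < 4 * s ^+ 2 by rewrite mulr_gt0// exprn_gt0.
set y := x ^+ 2 / _; have y0 : 0 <= y by rewrite divr_ge0 ?sqr_ge0// ltW.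
have -> : x ^+ 2 = 4 * s ^+ 2 * y by rewrite /y mulrC divfK// gt_eqF.
have -> : 4 ^+ j * j`!%:R * (s ^+ 2) ^+ j * expR y =
    (4 * s ^+ 2) ^+ j * (j`!%:R * expR y) by rewrite [(4 * _) ^+ j]exprMn; ring.
rewrite [(_ * y) ^+ j]exprMn ler_wpM2l ?exprn_ge0 ?(ltW s2)//.
have f0 : 0 < j`!%:R :> R by rewrite ltr0n fact_gt0.
rewrite -ler_pdivrMl// mulrC.
case: j {ms f0 M0} => [|j]; first by rewrite expr0 fact0 divr1 -expR0 ler_expR.
by apply: le_trans (expR_ge1Dxn j y0); rewrite lerDr.
Qed.

End Gaussian.

Section Independence.
Context d (T : measurableType d) (R : realType) (P : probability T R).
Variables (N : probability (measurableTypeR R) R) (U w : T -> R).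
Hypothesis mU : measurable_fun setT U.
Hypothesis mw : measurable_fun setT w.
Hypothesis Uw : forall A D : set R, measurable A -> measurable D ->
  P (U @^-1` A `&` w @^-1` D) = (P (U @^-1` A) * N D)%E.

(** By [Uw], the joint law of U and w agrees on rectangles with the product of the law of U and [N];
    Tonelli does the rest. *)
Lemma indep_integral (f : R * measurableTypeR R -> \bar R) : measurable_fun setT f ->
  (forall z, (0 <= f z)%E) ->
  (\int[P]_om f (U om, w om) = \int[P]_om \int[N]_y f (U om, y))%E.
Proof.
move=> mf f0.
pose U' : {mfun T >-> R} := HB.pack U (isMeasurableFun.Build _ _ _ _ _ mU).
have mphi : measurable_fun setT ((fun om => (U om, w om)) : T -> R * measurableTypeR R).
  exact: (@measurable_fun_pair _ _ _ T R (measurableTypeR R) U w mU mw).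
pose phi : {mfun T >-> (R * measurableTypeR R)%type} :=
  HB.pack (fun om => (U om, w om)) (isMeasurableFun.Build _ _ _ _ _ mphi).
have E := @product_measure_unique _ _ _ _ _ (distribution P U') N (distribution P phi).
transitivity (\int[distribution P phi]_z f z)%E.
  by rewrite ge0_integral_distribution.
transitivity (\int[(distribution P U' \x N)]_z f z)%E.
  by apply: eq_measure_integral => A mA _; exact/esym/E.
rewrite fubini_tonelli1// ge0_integral_distribution//.
- exact: measurable_fun_fubini_tonelli_F.
- by move=> y; apply: integral_ge0.
Qed.

End Independence.

Section IndependentGaussian.
Context d (T : measurableType d) (R : realType) (P : probability T R).
Variables (s : R) (U w : T -> R).
Hypothesis s0 : 0 < s.
Hypothesis mU : measurable_fun setT U.
Hypothesis mw : measurable_fun setT w.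
Hypothesis Uw : forall A D : set R, measurable A -> measurable D ->
  P (U @^-1` A `&` w @^-1` D) = (P (U @^-1` A) * normal_prob 0 s D)%E.

Lemma ge0_integral_gaussian_pow (j : nat) (M : R) : 0 <= M ->
  (forall x, 0 <= U x) ->
  (\int[normal_prob 0 s]_x ((x ^+ 2) ^+ j)%:E <= (M * (s ^+ 2) ^+ j)%:E)%E ->
  (\int[P]_om (U om * (w om ^+ 2) ^+ j)%:E <=
   (M * (s ^+ 2) ^+ j)%:E * \int[P]_om (U om)%:E)%E.
Proof.
move=> M0 U0 HM.
have mj : measurable_fun setT (fun y : R => ((y ^+ 2) ^+ j)%:E).
  by apply/measurable_EFinP; do 2![apply: measurable_funX].
(* The absolute value makes f nonnegative on the whole plane; it is harmless since U >= 0. *)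
pose f (z : R * measurableTypeR R) : \bar R := (`|z.1| * (z.2 ^+ 2) ^+ j)%:E.
have mf : measurable_fun setT f.
  apply/measurable_EFinP; apply: measurable_funM.
    by apply: measurableT_comp => //; exact: normr_measurable.
  by do 2![apply: measurable_funX]; exact: measurable_snd.
have f0 z : (0 <= f z)%E by rewrite lee_fin mulr_ge0// exprn_ge0// sqr_ge0.
have -> : (\int[P]_om (U om * (w om ^+ 2) ^+ j)%:E = \int[P]_om ((U om)%:E *
    \int[normal_prob 0 s]_y ((y ^+ 2) ^+ j)%:E))%E.
  transitivity (\int[P]_om f (U om, w om))%E.
    by apply: eq_integral => om _; rewrite /f/= ger0_norm.
  rewrite (@indep_integral _ _ _ P (normal_prob 0 s) U w mU mw Uw f)//.
  apply: eq_integral => om _; rewrite /f/=.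
  under eq_integral do rewrite EFinM ger0_norm//.
  rewrite ge0_integralZl//; last by rewrite lee_fin.
  by move=> y _; rewrite lee_fin exprn_ge0// sqr_ge0.
rewrite -ge0_integralZl//; last 3 first.
- exact/measurable_EFinP.
- by move=> x _; rewrite lee_fin.
- by rewrite lee_fin mulr_ge0// exprn_ge0// sqr_ge0.
apply: ge0_le_integral => //.
- move=> x _; rewrite mule_ge0 ?lee_fin//; apply: integral_ge0 => y _.
  by rewrite lee_fin exprn_ge0// sqr_ge0.
- by apply: emeasurable_funM => //; exact/measurable_EFinP.
- by apply: emeasurable_funM => //; exact/measurable_EFinP.
- by move=> x _; rewrite muleC lee_wpmul2r// lee_fin.
Qed.

End IndependentGaussian.

Section IndependentGaussianMean.
Context d (T : measurableType d) (R : realType) (P : probability T R).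
Variables (s : R) (U w : T -> R).
Hypothesis s0 : 0 < s.
Hypothesis mU : measurable_fun setT U.
Hypothesis mw : measurable_fun setT w.
Hypothesis Uw : forall A D : set R, measurable A -> measurable D ->
  P (U @^-1` A `&` w @^-1` D) = (P (U @^-1` A) * normal_prob 0 s D)%E.

(** |U w| <= |U| + |U| w^2, and the last term is integrable because the second moment of w factors
    out. *)
Lemma integrable_gaussian_mul : P.-integrable setT (EFin \o U) ->
  P.-integrable setT (fun om => (U om * w om)%:E).
Proof.
move=> iU; have [M [M0 HM]] := @normal_moment_le R 1.
have mUw : measurable_fun setT (fun om => (U om * w om)%:E).
  by apply/measurable_EFinP; exact: measurable_funM.
have maU : measurable_fun setT (fun om => `|U om|).
  by apply: measurableT_comp => //; exact: normr_measurable.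
have maUw : measurable_fun setT (fun om => `|U om| * (w om ^+ 2) ^+ 1).
  by apply: measurable_funM => //; do 2![apply: measurable_funX].
have iaU : P.-integrable setT (fun om => (`|U om|)%:E) by exact: integrable_norm iU.
have aUw A D : measurable A -> measurable D ->
    P ((fun om => `|U om|%R) @^-1` A `&` w @^-1` D) =
    (P ((fun om => `|U om|%R) @^-1` A) * normal_prob 0 s D)%E.
  move=> mA mD; have mA' : measurable ((@Num.norm R R) @^-1` A).
    by rewrite -[X in measurable X]setTI; exact: normr_measurable.
  exact: (Uw mA' mD).
have iw2 : P.-integrable setT (fun om => (`|U om| * (w om ^+ 2) ^+ 1)%:E).
  apply/integrableP; split; first exact/measurable_EFinP.
  rewrite (eq_integral (fun om => (`|U om| * (w om ^+ 2) ^+ 1)%:E)); last first.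
    by move=> om _; rewrite /= ger0_norm// mulr_ge0// exprn_ge0// sqr_ge0.
  apply: (le_lt_trans (ge0_integral_gaussian_pow maU mw aUw M0 _ (HM s s0))) => //.
  rewrite lte_mul_pinfty//; first by rewrite lee_fin mulr_ge0// exprn_ge0// sqr_ge0.
  have /integrableP[_] := iaU.
  by under eq_integral do rewrite /= normr_id.
apply: (@le_integrable _ _ _ P _ measurableT _ (fun om => (`|U om|)%:E + (`|U om| * (w om ^+ 2) ^+ 1)%:E)%E) => //.
- move=> x _; have h : 0 <= `|U x| + `|U x| * (w x ^+ 2) ^+ 1.
    by rewrite addr_ge0// mulr_ge0// exprn_ge0// sqr_ge0.
  rewrite /= lee_fin normrM (ger0_norm h).
  rewrite expr1 -[X in X + _]mulr1 -mulrDr ler_wpM2l//.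
  have := sqr_ge0 (`|w x| - 1); rewrite -[w x ^+ 2]real_normK ?num_real//.
  have := normr_ge0 (w x); nra.
- exact: integrableD.
Qed.

(** The pairs (U, w) and (U, -w) have the same law, so the positive and negative parts of U w have
    equal integrals, which are finite. *)
Lemma integral_gaussian_mul : P.-integrable setT (EFin \o U) ->
  (\int[P]_om (U om * w om)%:E = 0)%E.
Proof.
move=> iU; have iUw := integrable_gaussian_mul iU.
have Uwn A D : measurable A -> measurable D ->
    P (U @^-1` A `&` (fun om => - w om) @^-1` D) =
    (P (U @^-1` A) * normal_prob 0 s D)%E.
  move=> mA mD; have mD' : measurable (-%R @^-1` D).
    by rewrite -[X in measurable X]setTI; exact: oppr_measurable.
  by rewrite -(normal_probN (lt0r_neq0 s0) mD) -Uw.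
have mwn : measurable_fun setT (fun om => - w om) by exact: measurableT_comp.
pose f (z : R * measurableTypeR R) : \bar R := (Num.max (z.1 * z.2) 0)%:E.
have mf : measurable_fun setT f.
  apply/measurable_EFinP; apply: measurable_maxr => //.
  by apply: measurable_funM; [exact: measurable_fst|exact: measurable_snd].
have f0 z : (0 <= f z)%E by rewrite lee_fin le_max lexx orbT.
have E := @indep_integral _ _ _ P (normal_prob 0 s) U w mU mw Uw f mf f0.
have En := @indep_integral _ _ _ P (normal_prob 0 s) U _ mU mwn Uwn f mf f0.
rewrite integralE.
have -> : (\int[P]_x (fun om => (U om * w om)%:E)^\+ x = \int[P]_om f (U om, w om))%E.
  by apply: eq_integral => om _; rewrite /f /= funeposE/= EFin_max.
have -> : (\int[P]_x (fun om => (U om * w om)%:E)^\- x = \int[P]_om f (U om, (- w om)%R))%E.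
  by apply: eq_integral => om _; rewrite /f /= funenegE/= mulrN EFin_max EFinN.
rewrite E En subee// -E.
suff -> : (\int[P]_om f (U om, w om) = \int[P]_x (fun om => (U om * w om)%:E)^\+ x)%E.
  exact: integrable_pos_fin_num.
by apply: eq_integral => om _; rewrite /f /= funeposE/= EFin_max.
Qed.

End IndependentGaussianMean.

(** * Stopping times *)

Section Dyadic.
Context {R : realType}.
Implicit Types (x y : R) (m n : nat).

(** For x >= 0 this is the least n with x <= n / 2^m; the absolute value only casts the ceiling to
    [nat]. Rounding goes up so that the event that a stopping time is rounded to n / 2^m is known at
    time n / 2^m. *)
Definition dyadic_index m x : nat := `|Num.ceil (x * 2 ^+ m)|%N.

Lemma dyadic_index_le m x n : 0 <= x ->
  (dyadic_index m x <= n)%N = (x <= n%:R / 2 ^+ m).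
Proof.
move=> x0; have m0 : 0 < 2 ^+ m :> R by rewrite exprn_gt0.
have c0 : 0 <= Num.ceil (x * 2 ^+ m).
  by rewrite ceil_ge0 (lt_le_trans (ltrN10 _))// mulr_ge0// ltW.
by rewrite ler_pdivlMr// -lez_nat /dyadic_index gez0_abs// ceil_le_int.
Qed.

Definition dyadic_up m x : R := (dyadic_index m x)%:R / 2 ^+ m.

Lemma dyadic_up_ge m x : 0 <= x -> x <= dyadic_up m x.
Proof. by move=> x0; rewrite -dyadic_index_le. Qed.

Lemma dyadic_up_ge0 m x : 0 <= x -> 0 <= dyadic_up m x.
Proof. by move=> x0; exact: le_trans (dyadic_up_ge m x0). Qed.

Lemma dyadic_up_le m x : 0 <= x -> dyadic_up m x <= x + (2 ^+ m)^-1.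
Proof.
move=> x0; have m0 : 0 < 2 ^+ m :> R by rewrite exprn_gt0.
rewrite /dyadic_up; case E : (dyadic_index m x) => [|n].
  by rewrite mul0r addr_ge0// invr_ge0 ltW.
rewrite -natr1 mulrDl mul1r lerD2r.
have : ~~ (dyadic_index m x <= n)%N by rewrite E ltnn.
by rewrite dyadic_index_le// -ltNge => /ltW.
Qed.

Lemma dyadic_index_homo m x y : 0 <= x -> x <= y ->
  (dyadic_index m x <= dyadic_index m y)%N.
Proof.
move=> x0 xy; rewrite dyadic_index_le//; apply: (le_trans xy).
by rewrite -dyadic_index_le// (le_trans x0).
Qed.

Lemma cvg_inv_pow2 : (2 ^+ m)^-1 @[m --> \oo] --> (0 : R).
Proof.
have -> : (fun m => (2 ^+ m)^-1) = (fun m => 2^-1 ^+ m) :> (nat -> R).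
  by apply/funext => m; rewrite exprVn.
by apply: cvg_expr; rewrite ger0_norm ?invr_ge0// invf_lt1// ltr1n.
Qed.

Lemma cvg_dyadic_up x : 0 <= x -> dyadic_up m x @[m --> \oo] --> x.
Proof.
move=> x0; apply: (@squeeze_cvgr _ _ _ _ (fun=> x) (fun m => x + (2 ^+ m)^-1)).
- by near=> m; rewrite dyadic_up_ge// dyadic_up_le.
- exact: cvg_cst.
- by rewrite -[X in _ --> X]addr0; apply: cvgD; [exact: cvg_cst|exact: cvg_inv_pow2].
Unshelve. all: by end_near. Qed.

End Dyadic.

(** A filtration is a family of bare sets of sets. Passing to [g_sigma_algebraType G] makes the
    closure lemmas for measurable functions available for each of its members. *)
Definition sub_measurable (R : realType) (T : pointedType) (G : set (set T)) (f : T -> R) :=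
  @measurable_fun _ _ (g_sigma_algebraType G) R setT f.

Lemma sub_measurableP (R : realType) (T : pointedType) (G : set (set T)) (f : T -> R) :
  sigma_algebra setT G ->
  (sub_measurable G f <-> forall D, measurable D -> G (f @^-1` D)).
Proof.
move=> sG; split => [mf D mD|H].
  by have := mf measurableT _ mD; rewrite setTI measurable_g_measurableTypeE.
by move=> _ D mD; rewrite setTI measurable_g_measurableTypeE//; exact: H.
Qed.

Lemma sub_measurableS (R : realType) (T : pointedType) (G G' : set (set T)) (f : T -> R) :
  sigma_algebra setT G -> sigma_algebra setT G' -> G `<=` G' ->
  sub_measurable G f -> sub_measurable G' f.
Proof.
move=> sG sG' GG' /(sub_measurableP _ sG) H; apply/(sub_measurableP _ sG').
by move=> D mD; apply: GG'; exact: H.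
Qed.

Lemma sub_measurableW d (T : measurableType d) (R : realType) (G : set (set T)) (f : T -> R) :
  sigma_algebra setT G -> G `<=` measurable -> sub_measurable G f ->
  measurable_fun setT f.
Proof.
move=> sG GT /(sub_measurableP _ sG) H _ D mD.
by rewrite setTI; apply: GT; exact: H.
Qed.

Section StoppingTimes.
Context d (T : measurableType d) (R : realType).
Variable F : R -> set (set T).
Hypothesis Ffil : is_filtration F.

Definition stopping_time (tau : T -> R) :=
  (forall om, 0 <= tau om) /\
  (forall t, 0 <= t -> F t [set om | tau om <= t]).

Let sF t (t0 : 0 <= t) : sigma_algebra setT (F t).
Proof. by case: Ffil => + _ _; apply. Qed.

Let FE t (t0 : 0 <= t) (A : set T) :
  F t A = (@measurable _ (g_sigma_algebraType (F t)) A).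
Proof. by rewrite (measurable_g_measurableTypeE (sF t0)). Qed.

Lemma stopped_sigma_algebra tau : stopping_time tau ->
  sigma_algebra setT (stopped_sigma F tau).
Proof.
move=> [tau0 st]; split=> [t t0|A HA t t0|A HA t t0].
- by rewrite set0I FE//; exact: measurable0.
- rewrite setTD.
  have -> : ~` A `&` [set om | tau om <= t] =
      [set om | tau om <= t] `\` (A `&` [set om | tau om <= t]).
    by rewrite setDE setCI setIUr setICr setU0 setIC.
  by have := HA t t0; have := st t t0; rewrite !FE// => *; exact: measurableD.
- rewrite setI_bigcupl FE//; apply: bigcupT_measurable => n.
  by have := HA n t t0; rewrite FE.
Qed.

Lemma stopped_sigma_measurable tau : stopping_time tau ->
  stopped_sigma F tau `<=` measurable.
Proof.
move=> [tau0 st] A HA.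
have -> : A = \bigcup_n (A `&` [set om | tau om <= n%:R]).
  rewrite -setI_bigcupr; apply/seteqP; split=> [om Aom|om []//]; split=> //.
  exists (Num.truncn (tau om)).+1 => //=.
  by rewrite ltW// truncnS_gt.
apply: bigcupT_measurable => n.
by case: Ffil => _ + _; apply; [|exact: HA].
Qed.

(** As tau <= tau', the event tau' <= t equals its intersection with tau <= t, which lies in F_t
    because tau' is F_tau-measurable. This is how t_(n+1) inherits the property from t_n. *)
Lemma stopping_time_dominated tau tau' : stopping_time tau ->
  sub_measurable (stopped_sigma F tau) tau' ->
  (forall om, tau om <= tau' om) -> stopping_time tau'.
Proof.
move=> stau mtau' tt'; have [tau0 st] := stau.
split=> [om|t t0]; first exact: le_trans (tt' om).
have /(sub_measurableP _ (stopped_sigma_algebra stau)) H := mtau'.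
have := H `]-oo, t]%classic (measurable_itv _) t t0.
rewrite (_ : _ `&` _ = [set om | tau' om <= t])//.
apply/seteqP; split=> om /=; rewrite in_itv/=; first by case.
by move=> h; split=> //; exact: le_trans (tt' om) h.
Qed.

Lemma stopped_sigma_cst0 tau : stopping_time tau -> F 0 `<=` stopped_sigma F tau.
Proof.
move=> [tau0 st] A HA t t0.
have {}HA : F t A by case: Ffil => _ _; apply; last exact: HA.
have := st t t0; move: HA; rewrite !FE// => *; exact: measurableI.
Qed.

(** Since rounding goes up, the cell n+1 is the difference of the events tau <= (n+1) / 2^m and tau
    <= n / 2^m. Events of F_tau thereby become events at a fixed time, where independence of
    increments applies. *)
Lemma stopped_sigma_cell tau A m n : stopping_time tau -> stopped_sigma F tau A ->
  F (n%:R / 2 ^+ m) (A `&` [set om | dyadic_index m (tau om) = n]).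
Proof.
move=> [tau0 st] HA; have q0 k : 0 <= k%:R / 2 ^+ m :> R by rewrite divr_ge0// exprn_ge0.
have qE k : [set om | (dyadic_index m (tau om) <= k)%N] = [set om | tau om <= k%:R / 2 ^+ m].
  by apply/funext => om /=; rewrite dyadic_index_le.
case: n => [|n].
  rewrite (_ : [set om | _ = 0%N] = [set om | tau om <= 0%:R / 2 ^+ m]).
    exact: HA.
  rewrite -qE; apply/seteqP; split=> om /=; first by move=> ->.
  by rewrite leqn0 => /eqP.
have -> : A `&` [set om | dyadic_index m (tau om) = n.+1] =
    (A `&` [set om | tau om <= n.+1%:R / 2 ^+ m]) `\` [set om | tau om <= n%:R / 2 ^+ m].
  rewrite -!qE; apply/seteqP; split=> om /=.
    by move=> [Aom ->]; rewrite leqnn ltnn.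
  move=> [[Aom]]; rewrite leq_eqVlt => /orP[/eqP -> //|].
  by rewrite ltnS.
have h : F (n.+1%:R / 2 ^+ m) [set om | tau om <= n%:R / 2 ^+ m].
  case: Ffil => _ _; apply; last exact: st.
  - exact: q0.
  - by rewrite ler_pM2r ?invr_gt0 ?exprn_gt0// ler_nat.
by have := HA _ (q0 n.+1); move: h; rewrite !FE// => *; exact: measurableD.
Qed.

(** Right-continuity is asked at tau only, because the scheme is known to be continuous along its
    grid but not past the limit of the grid. *)
Lemma sub_measurable_at_stopping_time (Y : R -> T -> R) tau : stopping_time tau ->
  (forall t, 0 <= t -> sub_measurable (F t) (Y t)) ->
  (forall om (u : nat -> R), (forall m, tau om <= u m) -> u @ \oo --> tau om ->
    Y (u m) om @[m --> \oo] --> Y (tau om) om) ->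
  sub_measurable (stopped_sigma F tau) (fun om => Y (tau om) om).
Proof.
move=> stau mY rY; have [tau0 st] := stau.
apply/(sub_measurableP _ (stopped_sigma_algebra stau)) => D mD t t0.
pose E : set T := [set om | tau om <= t].
have mE : @measurable _ (g_sigma_algebraType (F t)) E by rewrite -FE//; exact: st.
(* Capping the rounded time at t keeps each approximation F_t-measurable on the event tau <= t;
   letting m tend to infinity then does not leave F_t. *)
pose f m om := Y (Num.min t (dyadic_up m (tau om))) om.
suff : @measurable_fun _ _ (g_sigma_algebraType (F t)) R E (fun om => Y (tau om) om).
  by move=> /(_ mE D mD); rewrite -FE// setIC.
apply: (@measurable_fun_cvg _ (g_sigma_algebraType (F t)) R E f).
  move=> m _ B mB.
  have -> : E `&` f m @^-1` B = \bigcup_n (E `&` [set om | dyadic_index m (tau om) = n]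
      `&` Y (Num.min t (n%:R / 2 ^+ m)) @^-1` B).
    apply/seteqP; split=> [om [Eom fB]|om [n _ [[Eom /= <-] YB]]] //.
    by exists (dyadic_index m (tau om)).
  apply: bigcupT_measurable => n.
  have q0 : 0 <= n%:R / 2 ^+ m :> R by rewrite divr_ge0// exprn_ge0.
  have s0 : 0 <= Num.min t (n%:R / 2 ^+ m) by rewrite le_min t0.
  have st' : Num.min t (n%:R / 2 ^+ m) <= t by rewrite ge_min lexx.
  apply: measurableI; last first.
    rewrite -FE//; case: Ffil => _ _; apply; [exact: s0|exact: st'|].
    by have /(sub_measurableP _ (sF s0)) := mY _ s0; apply.
  have cell k : @measurable _ (g_sigma_algebraType (F t))
      (E `&` [set om | (dyadic_index m (tau om) <= k)%N]).
    have p0 : 0 <= Num.min t (k%:R / 2 ^+ m) by rewrite le_min t0 divr_ge0// exprn_ge0.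
    rewrite -FE//; case: Ffil => _ _; apply; [exact: p0|by rewrite ge_min lexx|].
    have -> : E `&` [set om | (dyadic_index m (tau om) <= k)%N] =
        [set om | tau om <= Num.min t (k%:R / 2 ^+ m)].
      apply/funext => om; apply/propext; rewrite /E /= le_min -dyadic_index_le//.
      by split=> [[-> ->]|/andP[]].
    exact: st.
  case: n {q0 s0 st'} => [|n].
    rewrite (_ : [set om | _ = 0%N] = [set om | (dyadic_index m (tau om) <= 0)%N])//.
    by apply/funext => om /=; rewrite leqn0; apply/propext; split=> /eqP.
  have -> : E `&` [set om | dyadic_index m (tau om) = n.+1] =
      (E `&` [set om | (dyadic_index m (tau om) <= n.+1)%N]) `\`
      (E `&` [set om | (dyadic_index m (tau om) <= n)%N]).
    apply/seteqP; split=> om /=.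
      by move=> [Aom ->]; rewrite leqnn ltnn; split=> // -[].
    move=> [[Eom]]; rewrite leq_eqVlt => /orP[/eqP -> //|].
    by rewrite ltnS => h; case; split.
  exact: measurableD.
move=> om Eom; apply: rY => [m|].
  by rewrite le_min Eom dyadic_up_ge.
apply: (@squeeze_cvgr _ _ _ _ (fun=> tau om) (fun m => dyadic_up m (tau om))).
- by near=> m; rewrite le_min Eom dyadic_up_ge//= ge_min lexx orbT.
- exact: cvg_cst.
- exact: cvg_dyadic_up.
Unshelve. all: by end_near. Qed.

Lemma stopping_time_measurable tau : stopping_time tau ->
  sub_measurable (stopped_sigma F tau) tau.
Proof.
move=> stau; have [tau0 st] := stau.
apply: (sub_measurable_at_stopping_time (Y := fun t _ => t)) => //.
by move=> t t0; exact: measurable_cst.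
Qed.

End StoppingTimes.

(** * Noise between two stopping times *)

Definition independent_gaussian_increments d (T : measurableType d) (R : realType)
    (P : probability T R) (F : R -> set (set T)) (w : R -> T -> R) :=
  forall s t, 0 <= s -> s < t -> forall (A : set T) (D : set R), F s A -> measurable D ->
    P (A `&` (fun om => w t om - w s om) @^-1` D) =
    (P A * normal_prob 0 (Num.sqrt (t - s)) D)%E.

Section Noise.
Context d (T : measurableType d) (R : realType) (P : probability T R).
Variable F : R -> set (set T).
Hypothesis Ffil : is_filtration F.
Variable w : R -> T -> R.
Hypothesis mw : forall t, 0 <= t -> measurable_fun setT (w t).
Hypothesis Hw : independent_gaussian_increments P F w.
Variables (tau tau' U : T -> R) (B : R) (m : nat).
Hypothesis stau : stopping_time F tau.
Hypothesis mtau' : sub_measurable (stopped_sigma F tau) tau'.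
Hypothesis mU : sub_measurable (stopped_sigma F tau) U.
Hypothesis supp : forall om, U om != 0 -> tau om <= tau' om <= B.

Let sF t (t0 : 0 <= t) : sigma_algebra setT (F t).
Proof. by case: Ffil => + _ _; apply. Qed.

Let sG := stopped_sigma_algebra Ffil stau.

Let FE t (t0 : 0 <= t) (A : set T) :
  F t A = (@measurable _ (g_sigma_algebraType (F t)) A).
Proof. by rewrite (measurable_g_measurableTypeE (sF t0)). Qed.

Let GE (A : set T) :
  stopped_sigma F tau A = (@measurable _ (g_sigma_algebraType (stopped_sigma F tau)) A).
Proof. by rewrite (measurable_g_measurableTypeE sG). Qed.

Let J b : set R := [set x | 0 <= x /\ dyadic_index m x = b].

Let measurable_J b : measurable (J b).
Proof.
have q k : [set x : R | 0 <= x /\ (dyadic_index m x <= k)%N] = `[0, k%:R / 2 ^+ m]%classic.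
  apply/funext => x; apply/propext; rewrite /= in_itv/=.
  split=> [[x0]|/andP[x0]]; first by rewrite dyadic_index_le// => ->; rewrite x0.
  by rewrite -dyadic_index_le.
case: b => [|b].
  rewrite (_ : J 0 = `[0, 0%:R / 2 ^+ m]%classic)// -q.
  by apply/seteqP; split=> x [x0 /= H]; split=> //; [rewrite H|apply/eqP; rewrite -leqn0].
rewrite (_ : J b.+1 = `[0, b.+1%:R / 2 ^+ m]%classic `\` `[0, b%:R / 2 ^+ m]%classic).
  exact: measurableD.
rewrite -!q; apply/seteqP; split=> x /=.
  by move=> [x0 ->]; rewrite leqnn ltnn; split=> // -[].
move=> [[x0]]; rewrite leq_eqVlt => /orP[/eqP E _|]; first by split.
by rewrite ltnS => h; case; split.
Qed.

(** Both roundings are prescribed on a cell. As tau' is F_tau-measurable, the cell belongs to F at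
    time q a even though q b lies in the future; hence [Uc a b] is independent of the increment from
    q a to q b. *)
Let cell a b : set T := tau' @^-1` J b `&` [set om | dyadic_index m (tau om) = a].
Let Uc a b om := U om * \1_(cell a b) om.
Let NN := (dyadic_index m B).+1.
Let q (a : nat) : R := a%:R / 2 ^+ m.
Let q0 a : 0 <= q a. Proof. by rewrite divr_ge0// exprn_ge0. Qed.

Let Uc_measurable a b : sub_measurable (F (q a)) (Uc a b).
Proof.
rewrite /sub_measurable (_ : Uc a b = U \_ (cell a b)); last first.
  by rewrite patch_indic.
have mJ : stopped_sigma F tau (tau' @^-1` J b).
  by have /(sub_measurableP _ sG) := mtau'; apply; exact: measurable_J.
have mc : @measurable _ (g_sigma_algebraType (F (q a))) (cell a b).
  by rewrite -FE//; exact: stopped_sigma_cell.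
refine ((@measurable_restrictT _ _ (g_sigma_algebraType (F (q a))) R _ U mc).1 _).
move=> _ D mD; rewrite -FE// /cell setIC setIA; apply: (stopped_sigma_cell Ffil m a stau).
have : stopped_sigma F tau (U @^-1` D).
  by have /(sub_measurableP _ sG) := mU; apply.
by move: mJ; rewrite !GE => *; exact: measurableI.
Qed.

Let Uc_measurableT a b : measurable_fun setT (Uc a b).
Proof.
apply: (sub_measurableW (sF (q0 a))); last exact: Uc_measurable.
by case: Ffil => _ + _; apply.
Qed.

(** The cells are disjoint and cover the support of U; [NN] of them in each direction suffice
    because tau <= tau' <= B there. A quantity at the two rounded times becomes a finite sum over
    fixed times. *)
Let Uc_sum (G : nat -> nat -> R) om :
  U om * G (dyadic_index m (tau om)) (dyadic_index m (tau' om)) =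
  \sum_(z : 'I_NN * 'I_NN) Uc z.1 z.2 om * G z.1 z.2.
Proof.
have [U0|U0] := eqVneq (U om) 0.
  by rewrite U0 mul0r big1// => z _; rewrite /Uc U0 !mul0r.
have /andP[tt' t'B] := supp U0.
have tau0 : 0 <= tau om by case: stau.
have tau'0 : 0 <= tau' om by exact: le_trans tt'.
have aN : (dyadic_index m (tau om) < NN)%N.
  by rewrite ltnS dyadic_index_homo// (le_trans tt').
have bN : (dyadic_index m (tau' om) < NN)%N by rewrite ltnS dyadic_index_homo.
rewrite (bigD1 (Ordinal aN, Ordinal bN))//= big1 ?addr0.
  by rewrite /Uc indicE mem_set ?mulr1.
move=> [a b] /= ab; rewrite /Uc indicE memNset ?mulr0 ?mul0r// => -[[_ /= E1] E2].
by move/eqP: ab; apply; congr (_, _); apply/val_inj.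
Qed.

Let Uc0 a b om : (b < a)%N -> Uc a b om = 0.
Proof.
move=> ba; have [U0|U0] := eqVneq (U om) 0; first by rewrite /Uc U0 mul0r.
have /andP[tt' t'B] := supp U0.
have tau0 : 0 <= tau om by case: stau.
rewrite /Uc indicE memNset ?mulr0// => -[[_ /= E1] E2].
by have := dyadic_index_homo m tau0 tt'; rewrite E1 E2 leqNgt ba.
Qed.

Let Uc_indep a b (A D : set R) : (a < b)%N -> measurable A -> measurable D ->
  P (Uc a b @^-1` A `&` (fun om => w (q b) om - w (q a) om) @^-1` D) =
  (P (Uc a b @^-1` A) * normal_prob 0 (Num.sqrt (q b - q a)) D)%E.
Proof.
move=> ab mA mD; apply: Hw => //.
  by rewrite ltr_pM2r ?invr_gt0 ?exprn_gt0// ltr_nat.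
by have /(sub_measurableP _ (sF (q0 a))) := @Uc_measurable a b; apply.
Qed.

Let mdw a b : measurable_fun setT (fun om => w (q b) om - w (q a) om).
Proof. by apply: measurable_funB; exact: mw. Qed.

Let s_gt0 a b : (a < b)%N -> 0 < q b - q a.
Proof. by move=> ab; rewrite subr_gt0 ltr_pM2r ?invr_gt0 ?exprn_gt0// ltr_nat. Qed.

Definition dyadic_increment om :=
  w (dyadic_up m (tau' om)) om - w (dyadic_up m (tau om)) om.

(** On a cell with a < b the increment is Gaussian with variance q b - q a and independent of the
    weight, and q b - q a <= tau' - tau + 2^-m, where the excess comes from rounding tau' up. Cells
    with b < a carry no weight; for a = b the increment is 0 and the positive exponent makes its
    power vanish. *)
Lemma ge0_integral_increment_pow (j : nat) (M : R) : 0 <= M ->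
  (forall om, 0 <= U om) ->
  (forall s : R, 0 < s ->
    (\int[normal_prob 0 s]_x ((x ^+ 2) ^+ j.+1)%:E <= (M * (s ^+ 2) ^+ j.+1)%:E)%E) ->
  (\int[P]_om (U om * (dyadic_increment om ^+ 2) ^+ j.+1)%:E <=
   \int[P]_om (M * (U om * (tau' om - tau om + (2 ^+ m)^-1) ^+ j.+1))%:E)%E.
Proof.
move=> M0 U0 HM.
have Uc_ge0 a b om : 0 <= Uc a b om by rewrite mulr_ge0.
have mUT : measurable_fun setT U.
  by apply: (sub_measurableW sG) => //; exact: stopped_sigma_measurable.
have mtT : measurable_fun setT tau.
  apply: (sub_measurableW sG); first exact: stopped_sigma_measurable.
  exact: stopping_time_measurable.
have mt'T : measurable_fun setT tau'.
  by apply: (sub_measurableW sG) => //; exact: stopped_sigma_measurable.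
have term_ge0 (z : 'I_NN * 'I_NN) om :
    (0 <= (Uc z.1 z.2 om * ((w (q z.2) om - w (q z.1) om) ^+ 2) ^+ j.+1)%:E)%E.
  by rewrite lee_fin mulr_ge0// exprn_ge0// sqr_ge0.
under eq_integral => om _.
  rewrite /dyadic_increment /dyadic_up.
  rewrite (Uc_sum (fun a b => ((w (q b) om - w (q a) om) ^+ 2) ^+ j.+1)) -sumEFin.
  over.
rewrite ge0_integral_sum//; last first.
  move=> z; apply/measurable_EFinP; apply: measurable_funM => //.
  by do 2![apply: measurable_funX].
apply: (@le_trans _ _ (\sum_(z : 'I_NN * 'I_NN)
    \int[P]_om (Uc z.1 z.2 om * (M * `|q z.2 - q z.1| ^+ j.+1))%:E)%E).
  apply: lee_sum => -[a b] _ /=.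
  have [ab|ab|ab] := ltngtP a b.
  - have sd := s_gt0 ab.
    have sd0 : 0 < Num.sqrt (q b - q a) by rewrite sqrtr_gt0.
    have H := @ge0_integral_gaussian_pow _ _ _ P (Num.sqrt (q b - q a)) (Uc a b) _
      (Uc_measurableT a b) (mdw a b) (fun A D => @Uc_indep a b A D ab) j.+1 M M0
      (Uc_ge0 a b) (HM _ sd0).
    apply: (le_trans H); rewrite sqr_sqrtr ?(ltW sd)//.
    rewrite -ge0_integralZl//.
    + apply: ge0_le_integral => //.
      * by move=> om _; rewrite -EFinM lee_fin !mulr_ge0// exprn_ge0// ltW.
      * by apply/measurable_EFinP; exact: measurable_funM.
      * by apply/measurable_EFinP; exact: measurable_funM.
      * by move=> om _; rewrite -EFinM lee_fin mulrC gtr0_norm.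
    + exact/measurable_EFinP.
    + by move=> om _; rewrite lee_fin.
    + by rewrite lee_fin mulr_ge0// exprn_ge0// ltW.
  - rewrite integral0_eq; last by move=> om _; rewrite Uc0// mul0r.
    by apply: integral_ge0 => om _; rewrite Uc0// mul0r.
  - rewrite ab integral0_eq; last by move=> om _; rewrite subrr expr0n/= exprS mul0r mulr0.
    by apply: integral_ge0 => om _; rewrite lee_fin mulr_ge0// mulr_ge0// exprn_ge0.
rewrite -ge0_integral_sum//; last 2 first.
- by move=> z; apply/measurable_EFinP; exact: measurable_funM.
- by move=> z om _; rewrite lee_fin mulr_ge0// mulr_ge0// exprn_ge0.
apply: ge0_le_integral => //.
- by move=> om _; apply: sume_ge0 => z _; rewrite lee_fin mulr_ge0// mulr_ge0// exprn_ge0.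
- apply: emeasurable_sum => z; apply/measurable_EFinP; exact: measurable_funM.
- apply/measurable_EFinP; apply: measurable_funM => //; apply: measurable_funM => //.
  apply: measurable_funX; apply: measurable_funD => //; exact: measurable_funB.
move=> om _; rewrite sumEFin.
rewrite -(Uc_sum (fun a b => M * `|q b - q a| ^+ j.+1)) lee_fin mulrCA ler_wpM2l//.
have [->|Un0] := eqVneq (U om) 0; first by rewrite !mul0r.
have /andP[tt' t'B] := supp Un0.
have tau0 : 0 <= tau om by case: stau.
rewrite ler_wpM2l// lerXn2r// ?nnegrE//.
  by rewrite addr_ge0 ?subr_ge0// invr_ge0 exprn_ge0.
rewrite ger0_norm; last first.
  by rewrite subr_ge0 ler_pM2r ?invr_gt0 ?exprn_gt0// ler_nat dyadic_index_homo.
have := dyadic_up_le m (le_trans tau0 tt'); have := dyadic_up_ge m tau0.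
rewrite /dyadic_up -/(q _) -/(q _); lra.
Qed.

(** The optional stopping statement for the rounded times, obtained cell by cell from the vanishing
    Gaussian mean. *)
Lemma integrable_increment : P.-integrable setT (EFin \o U) ->
  P.-integrable setT (fun om => (U om * dyadic_increment om)%:E) /\
  (\int[P]_om (U om * dyadic_increment om)%:E = 0)%E.
Proof.
move=> iU.
have iUc a b : P.-integrable setT (EFin \o Uc a b).
  apply: (le_integrable measurableT _ _ iU); first exact/measurable_EFinP.
  move=> om _; rewrite /= lee_fin normrM ler_piMr// indicE.
  by case: (_ \in _); rewrite ?normr1 ?normr0.
have E : (fun om => (U om * dyadic_increment om)%:E) = (fun om =>
   \sum_(z : 'I_NN * 'I_NN) (Uc z.1 z.2 om * (w (q z.2) om - w (q z.1) om))%:E)%E.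
  apply/funext => om; rewrite sumEFin; congr (_%:E).
  exact: (Uc_sum (fun a b => w (q b) om - w (q a) om)).
have H (z : 'I_NN * 'I_NN) :
    P.-integrable setT (fun om => (Uc z.1 z.2 om * (w (q z.2) om - w (q z.1) om))%:E) /\
    (\int[P]_om (Uc z.1 z.2 om * (w (q z.2) om - w (q z.1) om))%:E = 0)%E.
  case: z => a b /=; have [ab|ab|ab] := ltngtP a b.
  - have s0 : 0 < Num.sqrt (q b - q a) by rewrite sqrtr_gt0 s_gt0.
    split.
      exact: (integrable_gaussian_mul s0 (Uc_measurableT a b) (mdw a b) (fun A D => @Uc_indep a b A D ab)).
    exact: (integral_gaussian_mul s0 (Uc_measurableT a b) (mdw a b) (fun A D => @Uc_indep a b A D ab)).
  - rewrite (_ : (fun om => _) = cst 0%E); last first.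
      by apply/funext => om; rewrite Uc0// mul0r.
    by split; [exact: integrable0|exact: integral0].
  - rewrite ab (_ : (fun om => _) = cst 0%E); last first.
      by apply/funext => om; rewrite subrr mulr0.
    by split; [exact: integrable0|exact: integral0].
rewrite E; split; first by apply: integrable_sum => // z _; have [] := H z.
rewrite integral_sum//; last by move=> z; have [] := H z.
by rewrite big1// => z _; have [] := H z.
Qed.

End Noise.

(** * Empirical measures *)

Section MatrixMeasurability.
Context {R : realType}.

Lemma ball_mxP (m n : nat) (X Y : 'M[R]_(m, n)) (e : R) : 0 < e ->
  ball X e Y <-> forall i j, `|X i j - Y i j| < e.
Proof. by move=> e0; split=> [[]|]. Qed.

(* An open set of matrices is a countable union of rational boxes, so entrywise
   measurability suffices. *)
Lemma continuous_mx_measurable dT (T : measurableType dT) (m n : nat)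
    (f : 'M[R]_(m, n) -> R) (X : T -> 'M[R]_(m, n)) :
  continuous f -> (forall i j, measurable_fun setT (fun om => X om i j)) ->
  measurable_fun setT (fun om => f (X om)).
Proof.
move=> cf mX; apply: (measurability _ (RGenOInfty.measurableE R)).
move=> _ [_ [a ->] <-]; rewrite setTI.
pose O : set 'M[R]_(m, n) := f @^-1` `]a, +oo[%classic.
have oO : open O by move/continuousP : cf; apply; exact: interval_open.
pose r (k : nat) : R := k.+1%:R^-1.
have r0 k : 0 < r k by rewrite invr_gt0.
pose box (z : 'M[rat]_(m, n) * nat) : set 'M[R]_(m, n) :=
  ball (map_mx (ratr : rat -> R) z.1 : 'M[R]_(m, n)) (r z.2).
pose V (z : 'M[rat]_(m, n) * nat) : set T :=
  if pselect (box z `<=` O) then X @^-1` box z else set0.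
have -> : (fun om => f (X om)) @^-1` `]a, +oo[%classic = \bigcup_z V z.
  apply/seteqP; split=> [om Oom|om [z _]]; last first.
    by rewrite /V; case: pselect => // zO; exact: zO.
  have /nbhs_ballP[e /= e0 eO] : nbhs (X om) O by apply: open_nbhs_nbhs.
  (* Half of e, since a box of radius r k around a rational matrix within r k of X has to fit into
     the ball of radius e around X. *)
  have [k ke] : exists k, r k < e / 2.
    exists (Num.truncn (2 / e)); rewrite /r invf_plt ?posrE ?divr_gt0//.
    by rewrite invfM invrK mulrC truncnS_gt.
  have qex i j : exists q : rat, `|ratr q - X om i j| < r k.
    have [|q] := @rat_in_itvoo R (X om i j - r k) (X om i j + r k).
      by have := r0 k; lra.
    rewrite in_itv/= => /andP[q1 q2]; exists q.
    by rewrite ltr_distl q1 q2.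
  pose Q : 'M[rat]_(m, n) := \matrix_(i, j) projT1 (cid (qex i j)).
  have QE i j : `|ratr (Q i j) - X om i j| < r k.
    by rewrite mxE; case: cid.
  exists (Q, k) => //; rewrite /V; case: pselect => [?|nO].
    by apply/ball_mxP => // i j; rewrite mxE.
  exfalso; apply: nO => Y /ball_mxP H; apply: eO; apply/ball_mxP => // i j.
  have := H (r0 k) i j; rewrite mxE /= => h.
  have := QE i j; rewrite distrC => h'.
  have := ler_normD (X om i j - ratr (Q i j)) (ratr (Q i j) - Y i j).
  by rewrite addrA subrK => /le_lt_trans; apply; lra.
apply: countable_bigcupT_measurable => // z.
rewrite /V; case: pselect => ? /=; last exact: measurable0.
have -> : X @^-1` box z = \bigcap_(ij in [set: 'I_m * 'I_n])
    ((fun om => X om ij.1 ij.2) @^-1` ball (ratr (z.1 ij.1 ij.2) : R) (r z.2)).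
  apply/seteqP; split=> [om /ball_mxP H [i j] _|om H].
    by have := H (r0 _) i j; rewrite mxE.
  by apply/ball_mxP => // i j; rewrite mxE; exact: (H (i, j) I).
apply: fin_bigcap_measurable => // ij _.
rewrite -[X in measurable X]setTI; apply: mX => //.
exact: measurable_ball.
Qed.

Lemma measurable_coord d (i : 'I_d) :
  measurable_fun setT (fun x : Rd R d => (x : 'cV[R]_d) i 0).
Proof.
apply: (measurability _ (RGenOInfty.measurableE R)).
move=> _ [_ [a ->] <-]; rewrite setTI; apply: sub_sigma_algebra.
have /continuousP := @coord_continuous R d 1 i 0; apply.
exact: interval_open.
Qed.

Lemma measurable_hsnorm dT (T : measurableType dT) d (X : T -> 'cV[R]_d) :
  (forall i, measurable_fun setT (fun om => X om i 0)) ->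
  measurable_fun setT (fun om => hsnorm (X om)).
Proof.
move=> mX; rewrite /hsnorm.
apply: (@measurableT_comp _ _ _ _ _ _ (@Num.sqrt R)).
  by apply: continuous_measurable_fun; exact: sqrt_continuous.
apply: measurable_sum => i; apply: measurable_sum => j.
by apply: measurable_funX; rewrite (ord1 j).
Qed.

Lemma hsnorm_le_sum d (z : 'cV[R]_d) : hsnorm z <= \sum_i `|z i 0|.
Proof.
have s0 : 0 <= \sum_i `|z i 0| by apply: sumr_ge0.
rewrite -(@ler_pXn2r _ 2)// ?nnegrE ?hsnorm_ge0// hsnorm_sqr_cV expr2 mulr_suml.
apply: ler_sum => i _; apply: (le_trans (ler_norm _)); rewrite normrM ler_wpM2l//.
by rewrite (bigD1 i)//= lerDl sumr_ge0.
Qed.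

Lemma ler_coord_hsnorm d (z : 'cV[R]_d) i : `|z i 0| <= hsnorm z.
Proof.
rewrite -(@ler_pXn2r _ 2)// ?nnegrE ?hsnorm_ge0// hsnorm_sqr_cV real_normK ?num_real//.
rewrite /inner (bigD1 i)//= -expr2 lerDl; apply: sumr_ge0 => k _.
by rewrite -expr2 sqr_ge0.
Qed.

End MatrixMeasurability.

Section PointAverage.
Context {R : realType} dT (T : measurableType dT) (N : nat) (p : T) (y : 'I_N -> T).
Local Open Scope ereal_scope.

(** The construction of [empirical] over an arbitrary measurable type; on pairs of points it
    supplies a coupling of two empirical measures. *)
Definition point_average : probability T R :=
  mnormalize (msum (fun k => dirac (nth p (codom y) k)) N) (dirac p).

Let nth_codom (j : 'I_N) : nth p (codom y) j = y j.
Proof. by rewrite (nth_map j) ?size_enum_ord// nth_ord_enum. Qed.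

Lemma point_averageE A : (0 < N)%N ->
  point_average A = (N%:R^-1)%:E * \sum_(j < N) dirac (y j) A.
Proof.
move=> N0; have sumE C : msum (fun k => dirac (nth p (codom y) k)) N C =
    \sum_(j < N) dirac (y j) C :> \bar R.
  by rewrite /msum; apply: eq_bigr => j _; rewrite nth_codom.
have sumT : \sum_(j < N) dirac (y j) [set: T] = N%:R%:E :> \bar R.
  under eq_bigr do rewrite diracT.
  by rewrite sumEFin sumr_const card_ord.
rewrite /point_average/= /mnormalize/= !sumE sumT /= eqe pnatr_eq0 eqn0Ngt N0/= muleC.
by congr (_ * _)%E; exact: sumE.
Qed.

(** Stated for any measure with these values, so that it covers both [empirical] and
    [point_average]. *)
Lemma ge0_integral_point_average (e : {measure set T -> \bar R}) (f : T -> \bar R) :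
  (0 < N)%N ->
  (forall A, measurable A -> e A = (N%:R^-1)%:E * \sum_(j < N) dirac (y j) A) ->
  measurable_fun setT f -> (forall x, 0 <= f x) ->
  \int[e]_x f x = (N%:R^-1)%:E * \sum_(j < N) f (y j).
Proof.
move=> N0 eE mf f0.
pose m := msum (fun k => dirac (nth p (codom y) k)) N : {measure set T -> \bar R}.
have k0 : (0 <= N%:R^-1 :> R)%R by [].
transitivity (\int[mscale (NngNum k0) m]_x f x).
  apply: eq_measure_integral => A mA _; rewrite eE// /mscale/=; congr (_ * _).
  by rewrite /m /msum; apply: eq_bigr => j _; rewrite nth_codom.
rewrite ge0_integral_mscale//=; congr (_ * _).
rewrite ge0_integral_measure_sum//; apply: eq_bigr => j _.
by rewrite integral_dirac// diracT mul1e nth_codom.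
Qed.

End PointAverage.

Section Empirical.
Context {R : realType} (d N : nat).
Hypothesis N0 : (0 < N)%N.
Implicit Types x y : 'I_N -> 'cV[R]_d.

Lemma finite_first_moment_empirical x : finite_first_moment (empirical x).
Proof.
rewrite /finite_first_moment.
rewrite (@ge0_integral_point_average R _ (Rd R d) N (0 : 'cV[R]_d) x)//.
- by rewrite sumEFin -EFinM ltry.
- by move=> A _; exact: empiricalE.
- apply/measurable_EFinP; apply: measurable_hsnorm => i; exact: measurable_coord.
- by move=> z; rewrite lee_fin hsnorm_ge0.
Qed.

(** The coupling that pairs x_j with y_j, each pair having mass 1 / N, is admissible in the
    infimum. *)
Lemma W1_empirical_le x y : (W1 (empirical x) (empirical y) <=
  (N%:R^-1 * \sum_j hsnorm (x j - y j))%:E)%E.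
Proof.
pose xy (j : 'I_N) : (Rd R d * Rd R d)%type := (x j, y j).
pose z0 : (Rd R d * Rd R d)%type := (0 : 'cV[R]_d, 0 : 'cV[R]_d).
apply: ereal_inf_lbound; exists (point_average z0 xy).
  move=> A mA; split.
    by rewrite point_averageE// empiricalE.
  by rewrite point_averageE// empiricalE.
rewrite (@ge0_integral_point_average R _ (Rd R d * Rd R d)%type N z0 xy)//.
- by rewrite sumEFin -EFinM.
- by move=> A _; exact: point_averageE.
- apply/measurable_EFinP; apply: measurable_hsnorm => i.
  rewrite (_ : (fun om => _) = (fun om : (Rd R d * Rd R d)%type =>
    (om.1 : 'cV[R]_d) i 0 - (om.2 : 'cV[R]_d) i 0)); last first.
    by apply/funext => om; rewrite !mxE.
  apply: measurable_funB.
    exact: (measurableT_comp (@measurable_coord R d i) measurable_fst).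
  exact: (measurableT_comp (@measurable_coord R d i) measurable_snd).
- by move=> z; rewrite lee_fin hsnorm_ge0.
Qed.

End Empirical.

(** * Drift at empirical measures: Lipschitz bound, continuity, coercivity *)

Section Drift.
Context {R : realType} (d N : nat).
Variables (b : 'cV[R]_d -> PRd R d -> 'cV[R]_d) (lambda2 l K : R).
Hypothesis N0 : (0 < N)%N.
Hypothesis lambda2_gt0 : 0 < lambda2.
Hypothesis b_W1 : forall (x : 'cV[R]_d) (mu nu : PRd R d),
  finite_first_moment mu -> finite_first_moment nu ->
  ((hsnorm (b x mu - b x nu))%:E <= lambda2%:E * W1 mu nu)%E.
Hypothesis l_ge0 : 0 <= l.
Hypothesis K_gt0 : 0 < K.
Hypothesis b_poly : forall (x y : 'cV[R]_d) (mu : PRd R d), finite_first_moment mu ->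
  hsnorm (b x mu - b y mu) <= K * (1 + hsnorm x `^ l + hsnorm y `^ l) * hsnorm (x - y).

Lemma b_empirical_lipschitz (u : 'cV[R]_d) (x y : 'I_N -> 'cV[R]_d) :
  hsnorm (b u (empirical x) - b u (empirical y)) <=
  lambda2 * (N%:R^-1 * \sum_j hsnorm (x j - y j)).
Proof.
rewrite -lee_fin EFinM.
apply: (le_trans (b_W1 _ (finite_first_moment_empirical N0 _) (finite_first_moment_empirical N0 _))).
by rewrite lee_wpmul2l// ?W1_empirical_le// lee_fin ltW.
Qed.

(** With the particles packed as the columns of a matrix, the drift of one particle is a continuous
    function on a finite-dimensional space. Its measurability is thus obtained without any
    sigma-algebra on the set of measures. *)
Lemma b_empirical_continuous (i : 'I_N) (a : 'I_d) :
  continuous (fun X : 'M[R]_(d, N) => b (col i X) (empirical (fun j => col j X)) a 0).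
Proof.
move=> X; have FX := nbhs_filter X; apply/(@cvgrPdist_lt _ _ _ _ FX) => /= e e0.
pose x j := col j X; pose n := hsnorm (x i).
pose C := K * (1 + n `^ l + (n + 1) `^ l) + lambda2.
have C0 : 0 < C.
  by rewrite addr_gt0// mulr_gt0// ltr_wpDr ?powR_ge0// ltr_wpDr ?powR_ge0.
(* The first bound gives d r <= 1, which keeps |y_i| <= n + 1 and the polynomial factor below that
   in C; the second gives C d r < e. Using d + 1 in place of d also covers d = 0. *)
pose r := Num.min (d.+1%:R^-1) (e / (C * d.+1%:R)).
have r0 : 0 < r by rewrite lt_min invr_gt0 ltr0n/= divr_gt0// mulr_gt0.
apply/nbhs_ballP; exists r => //= Y /(ball_mxP _ _ r0) XY.
pose y j := col j Y.
have hj j : hsnorm (x j - y j) <= d%:R * r.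
  apply: (le_trans (hsnorm_le_sum _)).
  rewrite -[d in d%:R]card_ord mulr_natl -sumr_const; apply: ler_sum => k _.
  by rewrite !mxE ltW.
have dr1 : d%:R * r <= 1.
  apply: (@le_trans _ _ (d.+1%:R * d.+1%:R^-1)); last by rewrite divff.
  by rewrite ler_pM// ?(ltW r0)// ?ler_nat// ge_min lexx.
have yi : hsnorm (y i) <= n + 1.
  have := ler_hsnormB (y i) (x i); rewrite -[hsnorm (y i - x i)]hsnormN opprB => /le_trans; apply.
  by rewrite addrC lerD2l (le_trans (hj i)).
have b1 : hsnorm (b (x i) (empirical x) - b (y i) (empirical x)) <=
    K * (1 + n `^ l + (n + 1) `^ l) * (d%:R * r).
  apply: (le_trans (b_poly _ _ (finite_first_moment_empirical N0 _))).
  rewrite ler_pM ?hsnorm_ge0//.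
    by rewrite mulr_ge0 ?(ltW K_gt0)// !addr_ge0 ?powR_ge0.
  rewrite ler_pM2l// lerD2l; apply: ge0_ler_powR => //; rewrite nnegrE ?hsnorm_ge0//.
  by rewrite addr_ge0 ?hsnorm_ge0.
have b2 : hsnorm (b (y i) (empirical x) - b (y i) (empirical y)) <= lambda2 * (d%:R * r).
  apply: (le_trans (b_empirical_lipschitz _ _ _)).
  rewrite ler_pM2l// ler_pdivrMl ?ltr0n//.
  apply: (@le_trans _ _ (\sum_(j < N) d%:R * r)); first exact: ler_sum.
  by rewrite sumr_const card_ord [leRHS]mulr_natl.
have : `|b (x i) (empirical x) a 0 - b (y i) (empirical y) a 0| <= C * (d%:R * r).
  have := ler_coord_hsnorm (b (x i) (empirical x) - b (y i) (empirical y)) a.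
  rewrite !mxE => /le_trans; apply.
  have -> : b (x i) (empirical x) - b (y i) (empirical y) =
      (b (x i) (empirical x) - b (y i) (empirical x)) +
      (b (y i) (empirical x) - b (y i) (empirical y)) by rewrite [RHS]addrA subrK.
  apply: (le_trans (ler_hsnormD _ _)); rewrite /C mulrDl; exact: lerD.
move=> /le_lt_trans; apply.
have re : r <= e / (C * d.+1%:R) by rewrite ge_min lexx orbT.
apply: (@le_lt_trans _ _ (C * (d%:R * (e / (C * d.+1%:R))))).
  by rewrite ler_pM2l// ler_wpM2l.
have -> : C * (d%:R * (e / (C * d.+1%:R))) = e * (d%:R / d.+1%:R).
  by rewrite invfM [e * _]mulrCA [d%:R * _]mulrCA mulVKf ?gt_eqF// mulrCA.
by rewrite gtr_pMr// ltr_pdivrMr ?ltr0n// mul1r ltr_nat.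
Qed.

(** The drift is compared with its value at 0 in the space variable (dissipativity) and then with
    the configuration of N particles at 0 in the measure, whose distance is at most the mean of the
    |x_k|. For |x_i| <= l0 the constants l0 phi(l0) and lambda1 l0^2 make up for the missing
    quadratic decay. *)
Lemma drift_bound (lambda1 l0 : R) (phi : R -> R) :
  0 < lambda1 -> 1 <= l0 ->
  (forall r : R, 0 <= r -> 0 <= phi r) ->
  (forall r s : R, 0 <= r -> r <= s -> phi r <= phi s) ->
  (forall (x y : 'cV[R]_d) (mu : PRd R d), finite_first_moment mu ->
     inner (x - y) (b x mu - b y mu) <=
       hsnorm (x - y) * phi (hsnorm (x - y)) * \1_[set r : R | r <= l0] (hsnorm (x - y))
       - lambda1 * hsnorm (x - y) ^+ 2 * \1_[set r : R | l0 < r] (hsnorm (x - y))) ->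
  exists C0 : R, 0 <= C0 /\ forall (x : 'I_N -> 'cV[R]_d) i,
   inner (x i) (b (x i) (empirical x)) <= - lambda1 * hsnorm (x i) ^+ 2
     + lambda2 * hsnorm (x i) * (N%:R^-1 * \sum_k hsnorm (x k)) + C0 * (1 + hsnorm (x i)).
Proof.
move=> lambda1_gt0 l0_ge1 phi_ge0 phi_incr b_diss.
pose z : 'I_N -> 'cV[R]_d := fun=> 0.
pose B0 := hsnorm (b 0 (empirical z)).
have l00 : 0 <= l0 by exact: le_trans l0_ge1.
exists (l0 * phi l0 + lambda1 * l0 ^+ 2 + B0); split.
  by rewrite !addr_ge0 ?hsnorm_ge0// mulr_ge0 ?phi_ge0 ?exprn_ge0// ltW.
move=> x i; set r := hsnorm (x i); have r0 : 0 <= r by exact: hsnorm_ge0.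
have c0 : 0 <= l0 * phi l0 + lambda1 * l0 ^+ 2.
  by rewrite !addr_ge0// mulr_ge0 ?phi_ge0 ?exprn_ge0// ltW.
have h1 : inner (x i) (b (x i) (empirical x) - b 0 (empirical x)) <=
    - lambda1 * r ^+ 2 + (l0 * phi l0 + lambda1 * l0 ^+ 2).
  have := b_diss (x i) 0 _ (finite_first_moment_empirical N0 x).
  rewrite subr0 -/r => /le_trans; apply; rewrite !indicE.
  have [rl|rl] := leP r l0.
    rewrite mem_set// memNset/= ?mulr1 ?mulr0 ?subr0; last by rewrite ltNge rl.
    have p1 : r * phi r <= l0 * phi l0 by rewrite ler_pM ?phi_ge0 ?phi_incr.
    have : lambda1 * r ^+ 2 <= lambda1 * l0 ^+ 2 by rewrite ler_pM2l// lerXn2r ?nnegrE.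
    lra.
  rewrite memNset/= ?mem_set// ?mulr1 ?mulr0; last by rewrite leNgt rl.
  lra.
have h2 : hsnorm (b 0 (empirical x)) <= B0 + lambda2 * (N%:R^-1 * \sum_k hsnorm (x k)).
  apply: (le_trans (ler_hsnormB _ (b 0 (empirical z)))).
  rewrite addrC lerD2l (le_trans (b_empirical_lipschitz _ _ _))//.
  by rewrite /z; under eq_bigr do rewrite subr0.
have h3 : inner (x i) (b 0 (empirical x)) <=
    r * (B0 + lambda2 * (N%:R^-1 * \sum_k hsnorm (x k))).
  apply: (le_trans (ler_norm _)); apply: (le_trans (ler_norm_inner _ _)).
  by rewrite ler_wpM2l.
rewrite -[b (x i) _](subrK (b 0 (empirical x))) innerDr.
apply: (le_trans (lerD h1 h3)).
set M := N%:R^-1 * _; have B00 : 0 <= B0 by exact: hsnorm_ge0.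
have := mulr_ge0 c0 r0; nra.
Qed.

End Drift.

(** * Adaptive schemes driven by Gaussian noise *)

Section FatouBound.
Context d (T : measurableType d) (R : realType) (mu : {measure set T -> \bar R}).
Local Open Scope ereal_scope.

(** Two features matter: a vanishing error [e], which absorbs the dyadic rounding, and a mere lower
    bound of the limit inferior by [g], which allows integrands diverging to infinity when the grid
    stays below t. *)
Lemma fatou_le (f : nat -> T -> \bar R) (g : T -> \bar R) (c : R) (e : nat -> R) :
  (forall n, measurable_fun setT (f n)) -> (forall n x, 0 <= f n x) ->
  measurable_fun setT g -> (forall x, 0 <= g x) ->
  (forall x, g x <= limn_einf (f^~ x)) ->
  (forall n, \int[mu]_x f n x <= (c + e n)%:E) ->
  e @ \oo --> (0%R : R) ->
  \int[mu]_x g x <= c%:E.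
Proof.
move=> mf f0 mg g0 gf fc e0.
apply: (@le_trans _ _ (\int[mu]_x limn_einf (f^~ x))).
  apply: ge0_le_integral => //.
  rewrite (_ : (fun x => _) = (fun x => - limn_esup (fun n => - f n x))).
    apply: measurableT_comp => //; apply: measurable_fun_limn_esup => n.
    exact: measurableT_comp.
  by apply/funext => x; rewrite (limn_esupN (f^~ x)) oppeK.
apply: (le_trans (fatou mu measurableT mf (fun n x _ => f0 n x))).
have ce : (fun n => (c + e n)%:E) @ \oo --> c%:E.
  apply: cvg_EFin; first by near=> n.
  rewrite -[X in _ --> X]addr0; apply: cvgD => //; exact: cvg_cst.
rewrite -(cvg_limn_einf_sup ce).1 !limn_einf_lim; apply: lee_lim.
- exact: is_cvg_einfs.
- exact: is_cvg_einfs.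
- near=> n; apply: le_ereal_inf_tmp => _ /= [k nk <-].
  by apply: le_trans (fc k); apply: ereal_inf_lbound; exists k.
Unshelve. all: by end_near. Qed.

End FatouBound.

Lemma cvg_expr_nat (R : realType) (u : nat -> R) (l : R) k :
  u @ \oo --> l -> u m ^+ k @[m --> \oo] --> l ^+ k.
Proof.
move=> ul; elim: k => [|k IH].
  by rewrite expr0; under eq_fun do rewrite expr0; exact: cvg_cst.
by rewrite exprS; under eq_fun do rewrite exprS; exact: cvgM.
Qed.

Section DyadicEvaluation.
Context d (T : measurableType d) (R : realType).

Lemma measurable_dyadic_eval (w : R -> T -> R) (tau : T -> R) m :
  (forall t, 0 <= t -> measurable_fun setT (w t)) ->
  measurable_fun setT tau -> (forall om, 0 <= tau om) ->
  measurable_fun setT (fun om => w (dyadic_up m (tau om)) om).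
Proof.
move=> mw mtau tau0 _ D mD; rewrite setTI.
have cellE k : [set om | (dyadic_index m (tau om) <= k)%N] =
    tau @^-1` `]-oo, k%:R / 2 ^+ m]%classic.
  by apply/funext => om; rewrite /= in_itv/= dyadic_index_le.
have mc k : measurable [set om | (dyadic_index m (tau om) <= k)%N].
  by rewrite cellE -[X in measurable X]setTI; apply: mtau.
have -> : (fun om => w (dyadic_up m (tau om)) om) @^-1` D =
    \bigcup_n ([set om | dyadic_index m (tau om) = n] `&` w (n%:R / 2 ^+ m) @^-1` D).
  apply/seteqP; split=> [om wD|om [n _ [/= <-]]]//.
  by exists (dyadic_index m (tau om)).
apply: bigcupT_measurable => n; apply: measurableI; last first.
  by rewrite -[X in measurable X]setTI; apply: mw => //; rewrite divr_ge0// exprn_ge0.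
case: n => [|n].
  rewrite (_ : [set om | _ = 0%N] = [set om | (dyadic_index m (tau om) <= 0)%N])//.
  by apply/funext => om /=; rewrite leqn0; apply/propext; split=> /eqP.
rewrite (_ : [set om | _ = n.+1] = [set om | (dyadic_index m (tau om) <= n.+1)%N] `\`
    [set om | (dyadic_index m (tau om) <= n)%N]); first exact: measurableD.
apply/seteqP; split=> om /=; first by move=> ->; rewrite leqnn ltnn.
by move=> []; rewrite leq_eqVlt => /orP[/eqP //|]; rewrite ltnS.
Qed.

End DyadicEvaluation.

(** * Abstract adaptive scheme: measurability of the grid, one-step bound, telescoping *)

Section Scheme.
Context dT (T : measurableType dT) (R : realType) (P : probability T R).
Variable F : R -> set (set T).
Hypothesis Ffil : is_filtration F.
Variables (d N : nat) (K : finType).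
Variable w : K -> R -> T -> R.
Hypothesis mw : forall c t, 0 <= t -> measurable_fun setT (w c t).
Hypothesis cw : forall c om (u : nat -> R) (t : R), (forall m, 0 <= u m) -> 0 <= t ->
  u @ \oo --> t -> w c (u m) om @[m --> \oo] --> w c t om.
Hypothesis Hw : forall c, independent_gaussian_increments P F (w c).
Variables (step : ('I_N -> 'cV[R]_d) -> R) (be : ('I_N -> 'cV[R]_d) -> 'I_N -> 'cV[R]_d).
Variables (tn : nat -> T -> R) (X : 'I_N -> R -> T -> 'cV[R]_d).
Variables (G : nat -> 'I_N -> K -> T -> 'cV[R]_d) (L : R).
Local Notation xn n om := (fun j => X j (tn n om) om).
Hypothesis step_gt0 : forall x, 0 < step x.
Hypothesis step_le1 : forall x, step x <= 1.
Hypothesis step_be : forall x i, step x * hsnorm (be x i) ^+ 2 <= 1.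
(** The quantification over all measurable types allows the sigma-algebra F_(t_n) as the source;
    this is how t_(n+1) is seen to be F_(t_n)-measurable. *)
Hypothesis step_measurable : forall dT' (T' : measurableType dT') (Y : T' -> 'I_N -> 'cV[R]_d),
  (forall j a, measurable_fun setT (fun om => Y om j a 0)) ->
  measurable_fun setT (fun om => step (Y om)).
Hypothesis be_measurable : forall dT' (T' : measurableType dT') (Y : T' -> 'I_N -> 'cV[R]_d) i a,
  (forall j a, measurable_fun setT (fun om => Y om j a 0)) ->
  measurable_fun setT (fun om => be (Y om) i a 0).
Hypothesis tn0 : forall om, tn 0 om = 0.
Hypothesis tnS : forall n om, tn n.+1 om = tn n om + step (xn n om).
Hypothesis mX : forall i t a, 0 <= t -> sub_measurable (F t) (fun om => X i t om a 0).
Hypothesis mG : forall n i c a, sub_measurable (stopped_sigma F (tn n)) (fun om => G n i c om a 0).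
Hypothesis GL : forall n i c om, hsnorm (G n i c om) <= L.
Hypothesis XE : forall i n t om, tn n om <= t <= tn n.+1 om ->
  X i t om = X i (tn n om) om + (t - tn n om) *: be (xn n om) i
    + \sum_c (w c t om - w c (tn n om) om) *: G n i c om.

Lemma grid_lt n om : tn n om < tn n.+1 om.
Proof. by rewrite tnS ltrDl. Qed.

Lemma grid_nondecreasing om : {homo (fun n => tn n om) : m n / (m <= n)%N >-> m <= n}.
Proof. by apply: homo_leq => [x|x y z|n] //; [exact: le_trans|exact/ltW/grid_lt]. Qed.

Lemma grid_ge0 n om : 0 <= tn n om.
Proof. by rewrite -(tn0 om); exact: (grid_nondecreasing om (leq0n n)). Qed.

(** Times that decrease to t_n are eventually below t_(n+1), where [XE] is an explicit formula,
    continuous because the noise paths are. *)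
Lemma state_right_continuous i n a om (u : nat -> R) :
  (forall m, tn n om <= u m) -> u @ \oo --> tn n om ->
  X i (u m) om a 0 @[m --> \oo] --> X i (tn n om) om a 0.
Proof.
move=> tu ut; have t0 := grid_ge0 n om.
pose g m := X i (tn n om) om a 0 + (u m - tn n om) * be (xn n om) i a 0
  + \sum_c (w c (u m) om - w c (tn n om) om) * G n i c om a 0.
have gE : \forall m \near \oo, g m = X i (u m) om a 0.
  have : \forall m \near \oo, u m < tn n.+1 om.
    by apply: (cvgr_lt _ ut); exact: grid_lt.
  apply: filterS => m um; rewrite (@XE i n (u m)) ?tu ?(ltW um)//.
  by rewrite !mxE summxE /g; congr (_ + _); apply: eq_bigr => c _; rewrite !mxE.
apply: cvg_trans (near_eq_cvg gE) _.
have -> : X i (tn n om) om a 0 = X i (tn n om) om a 0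
  + (tn n om - tn n om) * be (xn n om) i a 0
  + \sum_c (w c (tn n om) om - w c (tn n om) om) * G n i c om a 0.
  by rewrite subrr mul0r addr0 big1 ?addr0// => c _; rewrite subrr mul0r.
apply: cvgD.
  apply: cvgD; first exact: cvg_cst.
  by apply: cvgMl; apply: cvgB => //; exact: cvg_cst.
apply: cvg_big => [|c _]; first exact: add_continuous.
apply: cvgMl; apply: cvgB; last exact: cvg_cst.
by apply: cw => // m; exact: le_trans (tu m).
Qed.

Lemma state_measurable n : stopping_time F (tn n) -> forall i a,
  sub_measurable (stopped_sigma F (tn n)) (fun om => X i (tn n om) om a 0).
Proof.
move=> st i a.
apply: (@sub_measurable_at_stopping_time _ _ _ F Ffil (fun t om => X i t om a 0)) => //.
  by move=> t t0; exact: mX.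
by move=> om u; exact: state_right_continuous.
Qed.

Lemma grid_next_measurable n : stopping_time F (tn n) ->
  sub_measurable (stopped_sigma F (tn n)) (tn n.+1).
Proof.
move=> st; rewrite /sub_measurable.
rewrite (_ : tn n.+1 = (fun om => tn n om + step (xn n om))); last first.
  by apply/funext => om; exact: tnS.
apply: (@measurable_funD _ (g_sigma_algebraType (stopped_sigma F (tn n)))).
  exact: stopping_time_measurable.
apply: (@step_measurable _ (g_sigma_algebraType (stopped_sigma F (tn n)))) => j a.
exact: state_measurable.
Qed.

(** The induction runs through the state: if t_n is a stopping time, X at t_n is F_(t_n)-measurable,
    hence so is t_(n+1) >= t_n, which is then a stopping time too. *)
Lemma grid_stopping_time n : stopping_time F (tn n).
Proof.
elim: n => [|n IH].
  split=> [om|t t0]; first by rewrite tn0.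
  rewrite (_ : [set _ | _] = setT); last by apply/seteqP; split=> om //= _; rewrite tn0.
  have sF : sigma_algebra setT (F t) by case: Ffil => + _ _; apply.
  by rewrite -(measurable_g_measurableTypeE sF); exact: measurableT.
apply: (@stopping_time_dominated _ _ _ F Ffil (tn n)) => //.
  exact: grid_next_measurable.
by move=> om; exact/ltW/grid_lt.
Qed.

Lemma stopped_state_measurable n (t : R) i a : 0 <= t ->
  measurable_fun setT (fun om => X i (Num.min (tn n om) t) om a 0).
Proof.
move=> t0; have stn := grid_stopping_time n.
have sG := stopped_sigma_algebra Ffil stn.
have GT := stopped_sigma_measurable Ffil stn.
have -> : (fun om => X i (Num.min (tn n om) t) om a 0) =
    (fun om => if tn n om <= t then X i (tn n om) om a 0 else X i t om a 0).
  by apply/funext => om; rewrite /Num.min; case: ltgtP => // ->.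
apply: measurable_fun_ifT.
- apply: measurable_fun_ler => //.
  exact: (sub_measurableW sG GT (stopping_time_measurable Ffil stn)).
- exact: (sub_measurableW sG GT (state_measurable stn i a)).
- apply: (@sub_measurableW _ _ _ (F t)); [| |exact: mX].
    by case: Ffil => + _ _; apply.
  by case: Ffil => _ + _; apply.
Qed.

Variables (j : nat) (l1 l2 C0 : R).
Hypothesis L_ge0 : 0 <= L.
Hypothesis l12 : l2 < l1.
Hypothesis l2_ge0 : 0 <= l2.
Hypothesis C0_ge0 : 0 <= C0.
Hypothesis be_drift : forall x i, inner (x i) (be x i) <= - l1 * hsnorm (x i) ^+ 2
  + l2 * hsnorm (x i) * (N%:R^-1 * \sum_k hsnorm (x k)) + C0 * (1 + hsnorm (x i)).

Definition power_sum (x : 'I_N -> 'cV[R]_d) : R := \sum_i (hsnorm (x i) ^+ 2) ^+ j.+1.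
Local Notation S := power_sum.

Lemma power_sum_ge0 x : 0 <= S x.
Proof. by apply: sumr_ge0 => i _; rewrite exprn_ge0// sqr_ge0. Qed.

Lemma power_sum_measurable dT' (T' : measurableType dT') (Y : T' -> 'I_N -> 'cV[R]_d) :
  (forall i a, measurable_fun setT (fun om => Y om i a 0)) ->
  measurable_fun setT (fun om => S (Y om)).
Proof.
move=> mY; apply: measurable_sum => i; do 2!apply: measurable_funX.
exact: measurable_hsnorm.
Qed.

(** The factors 1 + |x_i|^(q-2) from the error term of [perturb_pow], with q = 2 (j+1). They are of
    lower order than S, so the drift can absorb them. *)
Let V (x : 'I_N -> 'cV[R]_d) : R := \sum_i (1 + (hsnorm (x i) ^+ 2) ^+ j).

Let V_ge0 x : 0 <= V x.
Proof. by apply: sumr_ge0 => i _; rewrite addr_ge0// exprn_ge0// sqr_ge0. Qed.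

Let V_le x : V x <= 2 * N%:R + S x.
Proof.
rewrite /V /power_sum mulr_natr -[2 *+ N](_ : \sum_(i < N) 2 = _); last first.
  by rewrite sumr_const card_ord.
rewrite -big_split/=; apply: ler_sum => i _; set u := hsnorm _ ^+ 2.
have u0 : 0 <= u by exact: sqr_ge0.
have [u1|/ltW u1] := leP u 1.
  have : u ^+ j <= 1 by rewrite exprn_ile1.
  by have := exprn_ge0 j.+1 u0; lra.
have : u ^+ j <= u ^+ j.+1 by rewrite ler_weXn2l.
lra.
Qed.

(** The weight vanishes on paths with t_n > t, so only steps begun by time t count, and the last one
    is cut at t. [perturb_pow] is applied path by path with the noise increments between dyadic
    roundings; after integration the linear noise terms vanish and [mean_field_drift] absorbs the
    even ones. Fatou's lemma removes the rounding. *)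
Lemma one_step_bound : exists a C : R, [/\ 0 < a, a <= 1, 0 <= C &
  forall n (t : R) (Y : T -> R), 0 <= t -> (forall om, 0 <= Y om) ->
    sub_measurable (stopped_sigma F (tn n)) Y ->
    (forall om, Y om != 0 -> tn n om <= t) ->
    P.-integrable setT (EFin \o Y) ->
    P.-integrable setT (fun om => (Y om * S (xn n om))%:E) ->
    (\int[P]_om (Y om * S (fun i => X i (Num.min (tn n.+1 om) t) om))%:E <=
     \int[P]_om (Y om * ((1 - a * (Num.min (tn n.+1 om) t - tn n om)) * S (xn n om)
                         + C * (Num.min (tn n.+1 om) t - tn n om)))%:E)%E].
Proof.
have [C1 [C10 H1]] := perturb_pow K j L_ge0.
have [M1 [M10 HM1]] := @normal_moment_le R 1.
have [Mq [Mq0 HMq]] := @normal_moment_le R j.+1.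
(* With z = D + 2^-m <= 2 one has z^(j+1) <= 2^j z, so [c0] bounds the moments of orders 2 and q of
   one noise coordinate per unit of z. [C2] adds up the coordinates, and C1 (1 + C2) collects the
   step error and the noise for the drift to absorb. *)
pose c0 := M1 + Mq * 2 ^+ j.
have c00 : 0 <= c0 by rewrite addr_ge0// mulr_ge0// exprn_ge0.
pose C2 : R := #|K|%:R * c0.
have C20 : 0 <= C2 by rewrite mulr_ge0.
have C40 : 0 <= C1 * (1 + C2) by rewrite mulr_ge0// addr_ge0.
have [a [C [a0 a1 Cge0 Hdrift]]] := mean_field_drift N j l12 l2_ge0 C0_ge0 C40.
exists a, C; split=> // n t Y t0 Y0 mY Yt iY iYS.
pose tau' om := Num.min (tn n.+1 om) t.
have stn := grid_stopping_time n.
have sG := stopped_sigma_algebra Ffil stn.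
have GT := stopped_sigma_measurable Ffil stn.
have mxn := state_measurable stn.
have mxnT i b : measurable_fun setT (fun om => X i (tn n om) om b 0).
  by apply: (sub_measurableW sG GT); exact: mxn.
have mtau' : sub_measurable (stopped_sigma F (tn n)) tau'.
  apply: (@measurable_minr _ (g_sigma_algebraType (stopped_sigma F (tn n)))) => //.
  exact: grid_next_measurable.
have mtau'T := sub_measurableW sG GT mtau'.
have mtnT := sub_measurableW sG GT (stopping_time_measurable Ffil stn).
have mYT := sub_measurableW sG GT mY.
have tau'0 om : 0 <= tau' om by rewrite le_min t0 grid_ge0.
have supp om : Y om != 0 -> tn n om <= tau' om <= t.
  by move=> /Yt tt; rewrite le_min tt (ltW (grid_lt n om))/= ge_min lexx orbT.
pose D om := tau' om - tn n om.
have D0 om : Y om != 0 -> 0 <= D om.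
  by move=> /supp /andP[h _]; rewrite subr_ge0.
have Dstep om : D om <= step (xn n om).
  by rewrite lerBlDl -tnS ge_min lexx.
have D1 om : D om <= 1 by exact: le_trans (Dstep om) (step_le1 _).
have mDT : measurable_fun setT D by exact: measurable_funB.
have mST : measurable_fun setT (fun om => S (xn n om)) by exact: power_sum_measurable.
have mVT : measurable_fun setT (fun om => V (xn n om)).
  apply: measurable_sum => i; apply: measurable_funD => //.
  by do 2!apply: measurable_funX; exact: measurable_hsnorm.
pose dw c m om := dyadic_increment (w c) (tn n) tau' m om.
have mdw c m : measurable_fun setT (dw c m).
  by apply: measurable_funB; apply: measurable_dyadic_eval => //; [exact: mw|exact: mw|move=> om; exact: grid_ge0].
(* The weighted power sum after the step, with the noise increments taken between the rounded
   times. *)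
pose f m om := Y om * \sum_i (hsnorm (X i (tn n om) om + D om *: be (xn n om) i
  + \sum_c dw c m om *: G n i c om) ^+ 2) ^+ j.+1.
have f0 m om : 0 <= f m om.
  by rewrite mulr_ge0// sumr_ge0// => i _; rewrite exprn_ge0// sqr_ge0.
have mbeT i b : measurable_fun setT (fun om => be (xn n om) i b 0) by exact: be_measurable.
have mGT i c b : measurable_fun setT (fun om => G n i c om b 0).
  by apply: (sub_measurableW sG GT); exact: mG.
have mf m : measurable_fun setT (f m).
  apply: measurable_funM => //; apply: measurable_sum => i.
  do 2!apply: measurable_funX; apply: measurable_hsnorm => b.
  rewrite (_ : (fun om => _) = (fun om => X i (tn n om) om b 0
    + D om * be (xn n om) i b 0 + \sum_c dw c m om * G n i c om b 0)); last first.
    by apply/funext => om; rewrite !mxE summxE; congr (_ + _); apply: eq_bigr => c _; rewrite !mxE.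
  apply: measurable_funD.
    by apply: measurable_funD => //; exact: measurable_funM.
  by apply: measurable_sum => c; exact: measurable_funM.
pose q : R := (2 * j.+1)%:R.
(* [U c] is the coefficient of the noise coordinate c in the linear term, [A] the integrand of the
   claimed bound, and [Bq] the even noise terms. *)
pose U c om := q * (Y om * \sum_i (hsnorm (X i (tn n om) om) ^+ 2) ^+ j
  * inner (X i (tn n om) om) (G n i c om)).
pose YV om := Y om * V (xn n om).
pose A om := Y om * ((1 - a * D om) * S (xn n om) + C * D om).
pose Bq c m om := YV om * (dw c m om ^+ 2 + (dw c m om ^+ 2) ^+ j.+1).
have YV0 om : 0 <= YV om by rewrite mulr_ge0.
have Bq0 c m om : 0 <= Bq c m om.
  rewrite mulr_ge0// addr_ge0 ?sqr_ge0//; exact/exprn_ge0/sqr_ge0.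
(* The drift absorbs C1 (1 + C2) V D, of which only C1 V D is present so far. The excess is put on
   the left rather than subtracted on the right, so that the left side stays nonnegative; it will
   pay for the integral of [Bq]. *)
have PT m om : f m om + C1 * C2 * (YV om * D om) <=
    A om + \sum_c U c om * dw c m om + C1 * \sum_c Bq c m om.
  have [Yz|Yn0] := eqVneq (Y om) 0.
    rewrite /f /YV /A Yz !mul0r mulr0 addr0 !big1 ?mulr0 ?addr0// => c _.
      by rewrite /Bq /YV Yz !mul0r.
    by rewrite /U Yz mul0r mulr0 mul0r.
  have Dge0 := D0 _ Yn0.
  have Dbe i : D om * hsnorm (be (xn n om) i) ^+ 2 <= 1.
    by apply: le_trans (step_be (xn n om) i); rewrite ler_wpM2r ?sqr_ge0.
  have H1i i := H1 d (X i (tn n om) om) (be (xn n om) i) (D om)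
    (fun c => G n i c om) (fun c => dw c m om) Dge0 (D1 om) (Dbe i) (fun c => GL n i c om).
  set W := \sum_c (dw c m om ^+ 2 + (dw c m om ^+ 2) ^+ j.+1) in H1i.
  pose I := \sum_i (hsnorm (X i (tn n om) om) ^+ 2) ^+ j * inner (X i (tn n om) om) (be (xn n om) i).
  pose J c := \sum_i (hsnorm (X i (tn n om) om) ^+ 2) ^+ j * inner (X i (tn n om) om) (G n i c om).
  have sumH1 : \sum_i (hsnorm (X i (tn n om) om + D om *: be (xn n om) i
      + \sum_c dw c m om *: G n i c om) ^+ 2) ^+ j.+1 <=
      S (xn n om) + q * (D om * I + \sum_c dw c m om * J c) + C1 * (V (xn n om) * (D om + W)).
    apply: (le_trans (ler_sum _ (fun i _ => H1i i))).
    rewrite !big_split/= -mulr_sumr -mulr_suml -/(V _) lerD2r lerD2l.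
    rewrite le_eqVlt; apply/orP; left; apply/eqP.
    under eq_bigr do rewrite mulrDr.
    rewrite big_split/= mulrDr; congr (_ + _).
      rewrite /I !mulr_sumr; apply: eq_bigr => i _; ring.
    rewrite mulr_sumr.
    under eq_bigr do rewrite mulr_sumr.
    rewrite exchange_big/=; apply: eq_bigr => c _.
    by rewrite /J !mulr_sumr; apply: eq_bigr => i _; rewrite /q; ring.
  have drift : q * I + C1 * (1 + C2) * V (xn n om) <= - a * S (xn n om) + C.
    have := Hdrift (fun i => hsnorm (X i (tn n om) om))
       (fun i => inner (X i (tn n om) om) (be (xn n om) i)) (fun i => hsnorm_ge0 _).
    by apply=> i; exact: (be_drift (xn n om) i).
  have main : \sum_i (hsnorm (X i (tn n om) om + D om *: be (xn n om) i
      + \sum_c dw c m om *: G n i c om) ^+ 2) ^+ j.+1 + C1 * C2 * (V (xn n om) * D om) <=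
      ((1 - a * D om) * S (xn n om) + C * D om) + q * (\sum_c dw c m om * J c)
      + C1 * (V (xn n om) * W).
    have := ler_wpM2l Dge0 drift; lra.
  have := ler_wpM2l (Y0 om) main.
  have -> : \sum_c U c om * dw c m om = Y om * (q * (\sum_c dw c m om * J c)).
    rewrite !mulr_sumr; apply: eq_bigr => c _; rewrite /U -/(J c); ring.
  have -> : \sum_c Bq c m om = Y om * (V (xn n om) * W).
    by rewrite /Bq -mulr_sumr /YV -/W mulrA.
  rewrite /f /A /YV; lra.
have iYV : P.-integrable setT (EFin \o YV).
  apply: (@le_integrable _ _ _ P _ measurableT _ (fun om => (2 * N%:R)%:E * (Y om)%:E + (Y om * S (xn n om))%:E)%E).
  - by apply/measurable_EFinP; exact: measurable_funM.
  - move=> om _; rewrite /= lee_fin ger0_norm// ger0_norm; last first.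
      by rewrite addr_ge0// !mulr_ge0// power_sum_ge0.
    by rewrite [2 * _ * _]mulrC -mulrDr ler_wpM2l// V_le.
  - by apply: integrableD => //; exact: integrableZl.
have iA : P.-integrable setT (EFin \o A).
  apply: (@le_integrable _ _ _ P _ measurableT _ (fun om => (Y om * S (xn n om))%:E + C%:E * (Y om)%:E)%E).
  - apply/measurable_EFinP; apply: measurable_funM => //; apply: measurable_funD.
      by apply: measurable_funM => //; apply: measurable_funB => //; exact: measurable_funM.
    exact: measurable_funM.
  - move=> om _; rewrite /= lee_fin.
    have [Yz|Yn0] := eqVneq (Y om) 0; first by rewrite /A Yz !mul0r mulr0 addr0.
    have Dge0 := D0 _ Yn0.
    have aD : 0 <= 1 - a * D om by rewrite subr_ge0 mulr_ile1// ltW.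
    have S0 := power_sum_ge0 (xn n om).
    rewrite !ger0_norm; last 2 first.
      by rewrite addr_ge0// mulr_ge0.
      by rewrite mulr_ge0// addr_ge0// mulr_ge0.
    rewrite /A (mulrC C (Y om)) -mulrDr ler_wpM2l// lerD//.
      by rewrite ler_piMl// gerBl mulr_ge0// ltW.
    by rewrite ler_piMr.
  - by apply: integrableD => //; exact: integrableZl.
have mU c : sub_measurable (stopped_sigma F (tn n)) (U c).
  apply: measurable_funM; first exact: measurable_cst.
  apply: measurable_funM => //; apply: measurable_sum => i.
  apply: measurable_funM.
    do 2!apply: measurable_funX.
    apply: (@measurable_hsnorm _ _ (g_sigma_algebraType (stopped_sigma F (tn n)))) => b.
    exact: mxn.
  apply: measurable_sum => b; apply: measurable_funM; first exact: mxn.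
  exact: mG.
have mYV : sub_measurable (stopped_sigma F (tn n)) YV.
  apply: measurable_funM => //; apply: measurable_sum => i; apply: measurable_funD.
    exact: measurable_cst.
  do 2!apply: measurable_funX.
  apply: (@measurable_hsnorm _ _ (g_sigma_algebraType (stopped_sigma F (tn n)))) => b.
  exact: mxn.
have mUT c := sub_measurableW sG GT (mU c).
have mYVT := sub_measurableW sG GT mYV.
have iU c : P.-integrable setT (EFin \o U c).
  apply: (@le_integrable _ _ _ P _ measurableT _ (fun om => (q * L)%:E * ((N%:R)%:E * (Y om)%:E + (Y om * S (xn n om))%:E))%E).
  - exact/measurable_EFinP.
  - move=> om _; rewrite /= lee_fin /U.
    have S0 := power_sum_ge0 (xn n om).
    rewrite [leRHS]ger0_norm ?mulr_ge0 ?addr_ge0 ?mulr_ge0//.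
    rewrite normrM [`|q|]ger0_norm// -mulrA ler_wpM2l// normrM [`|Y om|]ger0_norm//.
    rewrite [N%:R * _]mulrC -mulrDr mulrCA ler_wpM2l//.
    apply: (le_trans (ler_norm_sum _ _ _)).
    have -> : L * (N%:R + S (xn n om)) = \sum_(i < N) L * (1 + (hsnorm (X i (tn n om) om) ^+ 2) ^+ j.+1).
      by rewrite -mulr_sumr big_split/= sumr_const card_ord.
    apply: ler_sum => i _; set r := hsnorm _.
    have r0 : 0 <= r by exact: hsnorm_ge0.
    rewrite normrM ger0_norm ?exprn_ge0 ?sqr_ge0//.
    apply: (@le_trans _ _ ((r ^+ 2) ^+ j * (r * L))).
      rewrite ler_wpM2l ?exprn_ge0 ?sqr_ge0// (le_trans (ler_norm_inner _ _))//.
      by rewrite ler_wpM2l.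
    rewrite mulrA mulrC ler_wpM2l// [(r ^+ 2) ^+ j.+1]exprSr.
    have [r1|/ltW r1] := leP r 1.
      have h : (r ^+ 2) ^+ j * r <= 1 by rewrite mulr_ile1 ?exprn_ge0 ?sqr_ge0// exprn_ile1 ?sqr_ge0// expr2 mulr_ile1.
      have : 0 <= (r ^+ 2) ^+ j * r ^+ 2 by rewrite mulr_ge0 ?exprn_ge0 ?sqr_ge0.
      lra.
    have : (r ^+ 2) ^+ j * r <= (r ^+ 2) ^+ j * r ^+ 2.
      by rewrite ler_wpM2l ?exprn_ge0 ?sqr_ge0// expr2 ler_peMr.
    lra.
  - by apply: integrableZl => //; apply: integrableD => //; exact: integrableZl.
have q0 : 0 <= q by [].
have suppU c om : U c om != 0 -> tn n om <= tau' om <= t.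
  by move=> Un0; apply: supp; apply: contra_neq Un0 => Yz; rewrite /U Yz mul0r mulr0.
have suppYV om : YV om != 0 -> tn n om <= tau' om <= t.
  by move=> Un0; apply: supp; apply: contra_neq Un0 => Yz; rewrite /YV Yz mul0r.
have HU c m := @integrable_increment _ _ _ P F Ffil (w c) (@mw c) (Hw c) (tn n) tau' (U c) t m stn mtau' (mU c) (suppU c) (iU c).
have mBq c m : measurable_fun setT (Bq c m).
  apply: measurable_funM => //; apply: measurable_funD; first exact: measurable_funX.
  by do 2!apply: measurable_funX.
have YVD0 om : 0 <= YV om * D om.
  have [Yz|Yn0] := eqVneq (Y om) 0; first by rewrite /YV Yz !mul0r.
  by rewrite mulr_ge0// D0.
have p2 m : 0 <= (2 ^+ m)^-1 :> R by rewrite invr_ge0 exprn_ge0.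
have p21 m : (2 ^+ m)^-1 <= 1 :> R by rewrite invf_le1 ?exprn_gt0// exprn_ege1// ler1n.
have HB c m : (\int[P]_om (Bq c m om)%:E <=
    c0%:E * (\int[P]_om (YV om * D om)%:E + ((2 ^+ m)^-1)%:E * \int[P]_om (YV om)%:E))%E.
  have B1 := @ge0_integral_increment_pow _ _ _ P F Ffil (w c) (@mw c) (Hw c) (tn n) tau' YV t m stn mtau' mYV suppYV 0 M1 M10 YV0 HM1.
  have B2 := @ge0_integral_increment_pow _ _ _ P F Ffil (w c) (@mw c) (Hw c) (tn n) tau' YV t m stn mtau' mYV suppYV j Mq Mq0 YV0 HMq.
  have -> : (\int[P]_om (Bq c m om)%:E = \int[P]_om (YV om * (dw c m om ^+ 2) ^+ 1)%:E +
      \int[P]_om (YV om * (dw c m om ^+ 2) ^+ j.+1)%:E)%E.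
    rewrite -ge0_integralD//.
    - by apply: eq_integral => om _; rewrite -EFinD -mulrDr expr1.
    - by move=> om _; rewrite lee_fin mulr_ge0// exprn_ge0// sqr_ge0.
    - by apply/measurable_EFinP; apply: measurable_funM => //; do 2!apply: measurable_funX.
    - by move=> om _; rewrite lee_fin mulr_ge0// exprn_ge0// sqr_ge0.
    - by apply/measurable_EFinP; apply: measurable_funM => //; do 2!apply: measurable_funX.
  apply: (le_trans (leeD B1 B2)).
  have Dp om : Y om != 0 -> 0 <= D om + (2 ^+ m)^-1 by move=> ?; rewrite addr_ge0// D0.
  have Z0 k om : 0 <= YV om * (D om + (2 ^+ m)^-1) ^+ k.
    have [Yz|Yn0] := eqVneq (Y om) 0; first by rewrite /YV Yz !mul0r.
    by rewrite mulr_ge0// exprn_ge0// Dp.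
  rewrite -ge0_integralD//; first last.
  - apply/measurable_EFinP; apply: measurable_funM => //; apply: measurable_funM => //.
    by apply: measurable_funX; exact: measurable_funD.
  - by move=> om _; rewrite lee_fin mulr_ge0// Z0.
  - apply/measurable_EFinP; apply: measurable_funM => //; apply: measurable_funM => //.
    by apply: measurable_funX; exact: measurable_funD.
  - by move=> om _; rewrite lee_fin mulr_ge0// Z0.
  rewrite -ge0_integralZl//; first last.
  - by move=> om _; rewrite lee_fin.
  - exact/measurable_EFinP.
  rewrite -ge0_integralD//; first last.
  - by apply/measurable_EFinP; exact: measurable_funM.
  - by move=> om _; rewrite -EFinM lee_fin mulr_ge0.
  - by apply/measurable_EFinP; exact: measurable_funM.
  - by move=> om _; rewrite lee_fin.
  rewrite -ge0_integralZl//; first last.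
  - by move=> om _; rewrite -EFinM -EFinD lee_fin addr_ge0// mulr_ge0.
  - apply/measurable_EFinP; apply: measurable_funD; exact: measurable_funM.
  apply: ge0_le_integral => //.
  - by move=> om _; rewrite -EFinD lee_fin addr_ge0// mulr_ge0// Z0.
  - apply/measurable_EFinP; apply: measurable_funD.
      apply: measurable_funM => //; apply: measurable_funM => //.
      by apply: measurable_funX; exact: measurable_funD.
    apply: measurable_funM => //; apply: measurable_funM => //.
    by apply: measurable_funX; exact: measurable_funD.
  - apply/measurable_EFinP; apply: measurable_funM => //; apply: measurable_funD; exact: measurable_funM.
  move=> om _; change ((M1 * (YV om * (D om + (2 ^+ m)^-1) ^+ 1)
      + Mq * (YV om * (D om + (2 ^+ m)^-1) ^+ j.+1))%:E <=
    (c0 * (YV om * D om + (2 ^+ m)^-1 * YV om))%:E)%E; rewrite lee_fin.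
  have [Yz|Yn0] := eqVneq (Y om) 0.
    by rewrite /YV Yz !mul0r !mulr0 !addr0 !mulr0.
  have h := Dp _ Yn0; set z := D om + _ in h *.
  have z2 : z <= 2 by have := D1 om; have := p21 m; rewrite /z; lra.
  have zj : z ^+ j.+1 <= 2 ^+ j * z.
    by rewrite exprSr ler_wpM2r// lerXn2r// nnegrE.
  have -> : YV om * D om + (2 ^+ m)^-1 * YV om = YV om * z by rewrite /z; ring.
  rewrite expr1 /c0.
  have := ler_wpM2l Mq0 (ler_wpM2l (YV0 om) zj); lra.
have fI g : P.-integrable setT (EFin \o g) -> (\int[P]_om (g om)%:E)%E \is a fin_num.
  by move=> ig; exact: integrable_fin_num.
have iYVD : P.-integrable setT (fun om => (YV om * D om)%:E).
  apply: (@le_integrable _ _ _ P _ measurableT _ (EFin \o YV)) => //.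
    by apply/measurable_EFinP; exact: measurable_funM.
  move=> om _; rewrite /= lee_fin.
  have [Yz|Yn0] := eqVneq (Y om) 0; first by rewrite /YV Yz !mul0r.
  by rewrite !ger0_norm// ler_piMr.
pose vD := fine (\int[P]_om (YV om * D om)%:E)%E.
have EvD : (\int[P]_om (YV om * D om)%:E = vD%:E)%E by rewrite fineK// fI.
pose vY := fine (\int[P]_om (YV om)%:E)%E.
have EvY : (\int[P]_om (YV om)%:E = vY%:E)%E by rewrite fineK// fI.
pose vA := fine (\int[P]_om (A om)%:E)%E.
have EvA : (\int[P]_om (A om)%:E = vA%:E)%E by rewrite fineK// fI.
have {}HB c m : (\int[P]_om (Bq c m om)%:E <= (c0 * (vD + (2 ^+ m)^-1 * vY))%:E)%E.
  by have := HB c m; rewrite EvD EvY.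
(* The part of the noise bound caused by rounding the times up by at most 2^-m. *)
pose e m : R := C1 * C2 * vY * (2 ^+ m)^-1.
have fbound m : (\int[P]_om (f m om)%:E <= (vA + e m)%:E)%E.
  have iBq c : P.-integrable setT (EFin \o Bq c m).
    apply/integrableP; split; first exact/measurable_EFinP.
    under eq_integral do rewrite /= ger0_norm//.
    apply: (le_lt_trans (HB c m)).
    exact: ltry.
  have iSU : P.-integrable setT (fun om => \sum_c (U c om * dw c m om)%:E)%E.
    by apply: integrable_sum => // c _; have [] := HU c m.
  have iSB : P.-integrable setT (fun om => \sum_c (Bq c m om)%:E)%E.
    by apply: integrable_sum => // c _; exact: iBq.
  (* The integral of [PT]: the terms with [U c] have disappeared because their integrals are 0. *)
  have step1 : (\int[P]_om (f m om)%:E + (C1 * C2)%:E * \int[P]_om (YV om * D om)%:E <=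
      \int[P]_om (A om)%:E + C1%:E * \sum_c \int[P]_om (Bq c m om)%:E)%E.
    rewrite -ge0_integralZl//; first last.
    - by rewrite lee_fin mulr_ge0.
    - by move=> om _; rewrite lee_fin.
    - by apply/measurable_EFinP; exact: measurable_funM.
    rewrite -ge0_integralD//; first last.
    - by apply/measurable_EFinP; apply: measurable_funM => //; exact: measurable_funM.
    - by move=> om _; rewrite -EFinM lee_fin mulr_ge0// mulr_ge0.
    - exact/measurable_EFinP.
    - by move=> om _; rewrite lee_fin.
    have -> : (\int[P]_om (A om)%:E + C1%:E * \sum_c \int[P]_om (Bq c m om)%:E =
       \int[P]_om ((A om)%:E + \sum_c (U c om * dw c m om)%:E + C1%:E * \sum_c (Bq c m om)%:E))%E.
      rewrite integralD//; last 2 first.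
      - exact: integrableD.
      - exact: integrableZl.
      rewrite integralD// integral_sum//; last by move=> c; have [] := HU c m.
      have -> : (\sum_c \int[P]_om (U c om * dw c m om)%:E = 0)%E.
        by apply: big1 => c _; have [] := HU c m.
      rewrite adde0.
      rewrite integralZl//; congr (_ + _ * _)%E.
      by rewrite integral_sum// => c; exact: iBq.
    apply: ge0_le_integral => //.
    - by move=> om _; rewrite -EFinM -EFinD lee_fin addr_ge0// mulr_ge0// mulr_ge0.
    - apply/measurable_EFinP; apply: measurable_funD => //; apply: measurable_funM => //.
      exact: measurable_funM.
    - apply: (@measurable_int _ _ _ P); apply: integrableD => //; last exact: integrableZl.
      exact: integrableD.
    - by move=> om _; rewrite !sumEFin -!EFinM -!EFinD lee_fin PT.
  have HBs : (\sum_c \int[P]_om (Bq c m om)%:E <=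
      (#|K|%:R * (c0 * (vD + (2 ^+ m)^-1 * vY)))%:E)%E.
    by rewrite mulr_natl -sumr_const -sumEFin; apply: lee_sum => c _; exact: HB.
  have C1e : (0 <= C1%:E)%E by rewrite lee_fin.
  (* As C2 is the number of coordinates times c0, the term C1 C2 vD stands on both sides and
     cancels, leaving vA + e m. It is finite, which also excludes an infinite integral of f. *)
  have := le_trans step1 (leeD2l _ (lee_wpmul2l C1e HBs)).
  rewrite EvD EvA; case: (\int[P]_om (f m om)%:E)%E => [r| |]; last 2 first.
  - by rewrite -EFinM addye// -EFinM -EFinD leye_eq.
  - by move=> _; exact: leNye.
  rewrite -!EFinM -!EFinD !lee_fin /e /C2; lra.
apply: (@le_trans _ _ vA%:E); last by rewrite -EvA.
apply: (@fatou_le _ _ _ P (fun m om => (f m om)%:E) _ _ e).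
- by move=> m; exact/measurable_EFinP.
- by move=> m om; rewrite lee_fin.
- apply/measurable_EFinP; apply: measurable_funM => //; apply: power_sum_measurable => i b.
  exact: stopped_state_measurable.
- by move=> om; rewrite lee_fin mulr_ge0// power_sum_ge0.
(* By continuity of the paths, the increments between rounded times tend to the true ones, and [XE]
   identifies the limit as the state at the end of the cut step. *)
- move=> om; suff fl : (fun m => (f m om)%:E) @ \oo --> (Y om * S (fun i => X i (tau' om) om))%:E.
    by rewrite (cvg_limn_einf_sup fl).1.
  apply: cvg_EFin; first by near=> m.
  have [Yz|Yn0] := eqVneq (Y om) 0.
    rewrite /f Yz mul0r (_ : (fun m => _) = cst 0); first exact: cvg_cst.
    by apply/funext => m; rewrite /= mul0r.
  apply: cvgMr; apply: cvg_big => [|i _]; first exact: add_continuous.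
  rewrite (@XE i n (tau' om)); last first.
    by have /andP[-> _] := supp _ Yn0; rewrite ge_min lexx.
  apply: cvg_expr_nat.
  rewrite hsnorm_sqr; under eq_fun do rewrite hsnorm_sqr.
  apply: cvg_big => [|b _]; first exact: add_continuous.
  apply: cvg_big => [|b' _]; first exact: add_continuous.
  apply: cvg_expr_nat.
  rewrite !mxE summxE; under eq_fun do rewrite !mxE summxE.
  apply: cvgD; first exact: cvg_cst.
  apply: cvg_big => [|c _]; first exact: add_continuous.
  rewrite !mxE; under eq_fun do rewrite !mxE.
  apply: cvgMl; apply: cvgB.
    by apply: cw => //; [move=> m; exact: dyadic_up_ge0|exact: cvg_dyadic_up].
  apply: cw; [by move=> m; apply: dyadic_up_ge0; exact: grid_ge0|exact: grid_ge0|].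
  by apply: cvg_dyadic_up; exact: grid_ge0.
- exact: fbound.
- rewrite -[X in _ --> X](mulr0 (C1 * C2 * vY)).
  by apply: cvgMr; exact: cvg_inv_pow2.
Unshelve. all: by end_near. Qed.

Hypothesis step_lb : forall M, exists c : R, 0 < c /\
  forall x, (forall i, hsnorm (x i) <= M) -> c <= step x.

(* If the grid stays below [t], its steps tend to 0, which forces the states to
   leave every ball. *)
Lemma stopped_power_sum_liminf (a t z : R) om : 0 <= a -> 0 <= t -> 0 < z ->
  ((z * expR (a * t) * S (fun i => X i t om))%:E <=
   limn_einf (fun n => (z * expR (a * Num.min (tn n om) t) *
     S (fun i => X i (Num.min (tn n om) t) om))%:E))%E.
Proof.
move=> a0 t0 z0.
pose u (n : nat) := (z * expR (a * Num.min (tn n om) t) *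
  S (fun i => X i (Num.min (tn n om) t) om))%:E.
rewrite -/u.
have [[n tn_t]|bounded] := pselect (exists n, t < tn n om).
  suff ul : u @ \oo --> (z * expR (a * t) * S (fun i => X i t om))%:E.
    by rewrite (cvg_limn_einf_sup ul).1.
  apply: cvg_near_cst; exists n => // k /= nk; rewrite /u.
  have -> // : Num.min (tn k om) t = t.
  by apply/min_idPr/ltW/(lt_le_trans tn_t)/(grid_nondecreasing om).
have {}bounded n : tn n om <= t by rewrite leNgt; apply/negP => ?; apply: bounded; exists n.
suff ul : u @ \oo --> +oo%E by rewrite (cvg_limn_einf_sup ul).1 leey.
apply/cvgeryP/cvgryPge => A.
(* Chosen so that z M >= A; moreover M >= 1 gives M <= M^q, so one particle outside the ball of
   radius M already forces S >= M. *)
pose M := 1 + `|A| / z.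
have M1 : 1 <= M by rewrite lerDl divr_ge0// ltW.
have [c [c0 cM]] := step_lb M.
have cv : cvgn (fun n => tn n om).
  apply: nondecreasing_is_cvgn; first exact: grid_nondecreasing.
  by exists t => _ [n _ <-].
have : \forall n \near \oo, tn n.+1 om - tn n om < c.
  have d0 : (fun n => tn n.+1 om - tn n om) @ \oo --> (0 : R).
    rewrite -(subrr (limn (fun n => tn n om))); apply: cvgB => //.
    by rewrite (cvg_shiftS (fun n => tn n om)).
  exact: (cvgr_lt _ d0).
apply: filterS => n; rewrite tnS addrAC subrr add0r => stepc.
have [i Mi] : exists i, M < hsnorm (X i (tn n om) om).
  apply: contrapT => H; move: stepc; rewrite ltNge => /negP; apply.
  apply: cM => i; rewrite leNgt; apply/negP => Mi; apply: H; by exists i.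
rewrite /u (min_idPl (bounded n)).
have SM : M <= S (xn n om).
  rewrite /power_sum (bigD1 i)//=; apply: (@le_trans _ _ ((hsnorm (X i (tn n om) om) ^+ 2) ^+ j.+1)).
    rewrite -exprM; apply: (@le_trans _ _ (M ^+ (2 * j.+1))).
      by rewrite ler_eXnr// mulnS.
    by rewrite lerXn2r ?nnegrE ?hsnorm_ge0 ?(ltW Mi)// (le_trans _ M1).
  by rewrite lerDl sumr_ge0// => k _; rewrite exprn_ge0// sqr_ge0.
have e1 : 1 <= expR (a * tn n om) by rewrite -expR0 ler_expR mulr_ge0// grid_ge0.
apply: (@le_trans _ _ (z * 1 * M)).
  by rewrite /M mulr1 mulrDr mulrCA divff ?gt_eqF// !mulr1 (le_trans (ler_norm A))// lerDr ltW.
by rewrite ler_pM ?mulr_ge0 ?(ltW z0)// ?(le_trans _ M1)// ler_pM2l.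
Qed.

(** The constant depends neither on t nor on Z. The weight has to be F_0-measurable in order to be
    admissible at every step, and bounded in order that a multiple of it be integrable without any
    moment of the state. *)
Lemma weighted_moment_bound : exists C : R, 0 <= C /\
  forall Z : T -> R, (forall om, 0 < Z om) -> (forall om, Z om <= 1) ->
    sub_measurable (F 0) Z ->
    P.-integrable setT (fun om => (Z om * S (fun i => X i 0 om))%:E) ->
  forall t, 0 <= t ->
    (\int[P]_om (Z om * S (fun i => X i t om))%:E <=
     \int[P]_om (Z om * S (fun i => X i 0 om))%:E + C%:E)%E.
Proof.
have [a [C' [a0 a1 C'0 H]]] := one_step_bound.
(* With D the length of a cut step, v_(n+1) C' D <= e^a v_n C' D = C2 v_n a D <= C2 (v_(n+1) - v_n).
   The additive errors of the steps thus telescope. *)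
pose C2 : R := C' * expR a / a.
have C20 : 0 <= C2 by rewrite divr_ge0 ?mulr_ge0 ?expR_ge0// ltW.
exists C2; split=> // Z Z0 Z1 mZ iZS t t0.
have sF0 : sigma_algebra setT (F 0) by case: Ffil => + _ _; apply.
have mZT : measurable_fun setT Z.
  by apply: (sub_measurableW sF0) => //; case: Ffil => _ + _; apply.
pose rho n om := Num.min (tn n om) t.
have rho_t n om : rho n om <= t by rewrite ge_min lexx orbT.
have rho_ge0 n om : 0 <= rho n om by rewrite le_min grid_ge0.
have mtn n : measurable_fun setT (tn n).
  have stn := grid_stopping_time n.
  apply: (sub_measurableW (stopped_sigma_algebra Ffil stn)).
    exact: stopped_sigma_measurable.
  exact: stopping_time_measurable.
have mrho n : measurable_fun setT (rho n) by exact: measurable_minr.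
pose St n om := S (fun i => X i (rho n om) om).
have mSt n : measurable_fun setT (St n).
  by apply: power_sum_measurable => i b; exact: stopped_state_measurable.
have St0 n om : 0 <= St n om by exact: power_sum_ge0.
pose v n om := Z om * expR (a * rho n om).
have v0 n om : 0 <= v n om by rewrite mulr_ge0 ?expR_ge0// ltW.
have mv n : measurable_fun setT (v n).
  by apply: measurable_funM => //; apply: measurableT_comp => //; exact: measurable_funM.
have vt n om : v n om <= expR (a * t).
  rewrite -[leRHS]mul1r ler_pM ?expR_ge0 ?(ltW (Z0 _))//.
  by rewrite ler_expR ler_pM2l.
have v_homo n om : v n om <= v n.+1 om.
  rewrite ler_pM2l// ler_expR ler_pM2l// /rho le_min rho_t andbT.
  by rewrite (le_trans _ (ltW (grid_lt n om)))// ge_min lexx.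
have vZ n om : Z om <= v n om.
  by rewrite -[leLHS]mulr1 ler_pM2l// -expR0 ler_expR mulr_ge0// ltW.
have iv n : P.-integrable setT (EFin \o v n).
  apply: (@le_integrable _ _ _ P _ measurableT _ (cst (expR (a * t))%:E)).
  - exact/measurable_EFinP.
  - by move=> om _; rewrite /= lee_fin !ger0_norm ?expR_ge0.
  - exact: finite_measure_integrable_cst.
pose u n om := v n om * St n om.
have u0 n om : 0 <= u n om by rewrite mulr_ge0.
have mu n : measurable_fun setT (u n) by exact: measurable_funM.
pose ZS om := Z om * S (fun i => X i 0 om).
have ZS0 om : 0 <= ZS om by rewrite mulr_ge0 ?power_sum_ge0// ltW.
have mZS : measurable_fun setT ZS by apply/measurable_EFinP; exact: measurable_int iZS.
pose g n om := ZS om + C2 * (v n om - Z om).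
have g0 n om : 0 <= g n om by rewrite addr_ge0// mulr_ge0// subr_ge0.
have mg n : measurable_fun setT (g n).
  by apply: measurable_funD => //; apply: measurable_funM => //; exact: measurable_funB.
have g_le n om : g n om <= ZS om + C2 * expR (a * t).
  by rewrite lerD2l ler_wpM2l// (le_trans _ (vt n om))// gerBl ltW.
have ig n : P.-integrable setT (EFin \o g n).
  apply: (@le_integrable _ _ _ P _ measurableT _ (fun om => (ZS om)%:E + (C2 * expR (a * t))%:E)%E).
  - exact/measurable_EFinP.
  - move=> om _; rewrite /= lee_fin !ger0_norm//.
    by rewrite addr_ge0// mulr_ge0// expR_ge0.
  - apply: integrableD => //; exact: finite_measure_integrable_cst.
have claim n : (\int[P]_om (u n om)%:E <= \int[P]_om (g n om)%:E)%E.
  elim: n => [|n IH].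
    rewrite le_eqVlt; apply/orP; left; apply/eqP; apply: eq_integral => om _.
    have r0 : rho 0%N om = 0 by rewrite /rho tn0; exact/min_idPl.
    by rewrite /u /g /v /St r0 mulr0 expR0 mulr1 subrr mulr0 addr0.
  have stn := grid_stopping_time n.
  have sG := stopped_sigma_algebra Ffil stn.
  have iu : P.-integrable setT (EFin \o u n).
    apply/integrableP; split; first exact/measurable_EFinP.
    under eq_integral do rewrite /= ger0_norm//.
    by apply: (le_lt_trans IH); rewrite ltey_eq integrable_fin_num//; exact: (ig n).
  pose ind om : R := if tn n om <= t then 1 else 0.
  have ind0 om : 0 <= ind om by rewrite /ind; case: ifP.
  have ind1 om : ind om <= 1 by rewrite /ind; case: ifP.
  have mind : sub_measurable (stopped_sigma F (tn n)) ind.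
    apply: (@measurable_fun_ifT _ _ (g_sigma_algebraType (stopped_sigma F (tn n))) R) => //.
    apply: (@measurable_fun_ler _ (g_sigma_algebraType (stopped_sigma F (tn n)))) => //.
    exact: stopping_time_measurable.
  have mindT : measurable_fun setT ind.
    by apply: (sub_measurableW sG) => //; exact: stopped_sigma_measurable.
  (* The exponential is taken at the end of the step, which is admissible because t_(n+1) is
     F_(t_n)-measurable. Then e^(a D) (1 - a D) <= 1 turns v_(n+1) (1 - a D) into at most v_n. *)
  pose Y om := ind om * v n.+1 om.
  have Y0 om : 0 <= Y om by rewrite mulr_ge0.
  have mY : sub_measurable (stopped_sigma F (tn n)) Y.
    apply: (@measurable_funM _ (g_sigma_algebraType (stopped_sigma F (tn n)))) => //.
    apply: (@measurable_funM _ (g_sigma_algebraType (stopped_sigma F (tn n)))).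
      by apply: (sub_measurableS sF0 sG) => //; exact: stopped_sigma_cst0.
    apply: measurableT_comp => //.
    apply: (@measurable_funM _ (g_sigma_algebraType (stopped_sigma F (tn n)))) => //.
    apply: (@measurable_minr _ (g_sigma_algebraType (stopped_sigma F (tn n)))) => //.
    exact: grid_next_measurable.
  have Yt om : Y om != 0 -> tn n om <= t.
    by rewrite /Y /ind; case: ifP => // _; rewrite mul0r eqxx.
  have iY : P.-integrable setT (EFin \o Y).
    apply: (@le_integrable _ _ _ P _ measurableT _ (EFin \o v n.+1)) => //.
      by apply/measurable_EFinP; exact: measurable_funM.
    by move=> om _; rewrite /= lee_fin !ger0_norm// ler_piMl.
  have rhoS om : rho n.+1 om <= rho n om + 1.
    rewrite /rho; have := step_le1 (xn n om); rewrite tnS.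
    by rewrite /Num.min; case: ltP => ?; case: ltP => ?; lra.
  have rho_le om : rho n om <= rho n.+1 om.
    by rewrite /rho le_min rho_t andbT (le_trans _ (ltW (grid_lt n om)))// ge_min lexx.
  have mSxn : measurable_fun setT (fun om => S (xn n om)).
    apply: power_sum_measurable => i b; apply: (sub_measurableW sG).
      exact: stopped_sigma_measurable.
    exact: state_measurable.
  have indE om : tn n om <= t -> tn n om = rho n om by move=> h; rewrite /rho (min_idPl h).
  have iYS : P.-integrable setT (fun om => (Y om * S (xn n om))%:E).
    apply: (@le_integrable _ _ _ P _ measurableT _ (fun om => (expR a)%:E * (u n om)%:E)%E).
    - by apply/measurable_EFinP; apply: measurable_funM => //; exact: measurable_funM.
    - move=> om _; rewrite /= lee_fin.
      rewrite ger0_norm; last by apply: mulr_ge0; [exact: Y0|exact: power_sum_ge0].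
      rewrite ger0_norm; last by apply: mulr_ge0; [exact: expR_ge0|exact: u0].
      rewrite /Y /ind; case: ifPn => [h|_]; last by rewrite !mul0r mulr_ge0// expR_ge0.
      rewrite mul1r /u /St -(indE _ h) mulrA ler_wpM2r ?power_sum_ge0//.
      rewrite /v mulrCA ler_pM2l// -expRD ler_expR.
      by have := rhoS om; rewrite -subr_ge0 => /(mulr_ge0 (ltW a0)); lra.
    - exact: integrableZl.
  have HY := H n t Y t0 Y0 mY Yt iY iYS.
  pose G1 om := u n om + C2 * (v n.+1 om - v n om).
  have G10 om : 0 <= G1 om by rewrite addr_ge0// mulr_ge0// subr_ge0.
  have mG1 : measurable_fun setT G1.
    by apply: measurable_funD => //; apply: measurable_funM => //; exact: measurable_funB.
  have pt om : Y om * ((1 - a * (rho n.+1 om - tn n om)) * S (xn n om)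
      + C' * (rho n.+1 om - tn n om)) <= ind om * G1 om.
    rewrite /Y /ind; case: ifPn => [h|_]; last by rewrite !mul0r.
    rewrite !mul1r (indE _ h) /G1 /u /St -/(rho n om).
    set s := S _; have s0 : 0 <= s by exact: power_sum_ge0.
    set D := rho n.+1 om - rho n om.
    have D0 : 0 <= D by rewrite subr_ge0.
    have D1 : D <= 1 by rewrite lerBlDl.
    have vE : v n.+1 om = v n om * expR (a * D).
      by rewrite /v -mulrA -expRD -mulrDr /D addrC subrK.
    have vE' : v n om = v n.+1 om * expR (- (a * D)).
      by rewrite vE -mulrA -expRD subrr expR0 mulr1.
    have h1 : v n.+1 om * (1 - a * D) <= v n om.
      by rewrite [leRHS]vE' ler_wpM2l// (le_trans _ (expR_ge1Dx _))// addrC.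
    have h2 : v n.+1 om * (C' * D) <= C2 * (v n.+1 om - v n om).
      apply: (@le_trans _ _ (C2 * (v n om * (a * D)))); last first.
        rewrite ler_wpM2l// vE -[X in _ <= _ - X]mulr1 -mulrBr ler_wpM2l//.
        by rewrite lerBrDl expR_ge1Dx.
      have -> : C2 * (v n om * (a * D)) = v n om * expR a * (C' * D).
        by rewrite /C2; field; rewrite gt_eqF.
      rewrite ler_wpM2r ?mulr_ge0// vE ler_wpM2l// ler_expR.
      by rewrite -[leRHS]mulr1 ler_pM2l.
    have := ler_wpM2r s0 h1; move: h2; lra.
  have mrest : measurable_fun setT (fun om => 1 - ind om) by exact: measurable_funB.
  have ind10 om : 0 <= 1 - ind om by rewrite subr_ge0.
  (* On paths with t_n > t both stopped times equal t, so u does not change; the indicator separates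
     them from the paths on which a step is made. *)
  have splitu om : (u n.+1 om = Y om * S (fun i => X i (Num.min (tn n.+1 om) t) om)
      + (1 - ind om) * G1 om).
    rewrite /Y /ind; case: ifPn => [h|]; first by rewrite mul1r subrr mul0r addr0.
    rewrite -ltNge => h; rewrite !mul0r add0r subr0 mul1r /G1.
    have r1 : rho n om = t by exact/min_idPr/ltW.
    have r2 : rho n.+1 om = t.
      by apply/min_idPr/ltW/(lt_trans h); exact: grid_lt.
    by rewrite /u /v /St r1 r2 subrr mulr0 addr0.
  have mYSt : measurable_fun setT (fun om => Y om * S (fun i => X i (Num.min (tn n.+1 om) t) om)).
    apply: measurable_funM; first by exact: measurable_funM.
    exact: (mSt n.+1).
  apply: (@le_trans _ _ (\int[P]_om (G1 om)%:E)%E).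
    have -> : (\int[P]_om (u n.+1 om)%:E = \int[P]_om (Y om * S (fun i => X i (Num.min (tn n.+1 om) t) om))%:E
        + \int[P]_om ((1 - ind om) * G1 om)%:E)%E.
      rewrite -ge0_integralD//.
      - by apply: eq_integral => om _; rewrite splitu.
      - by move=> om _; rewrite lee_fin mulr_ge0// power_sum_ge0.
      - exact/measurable_EFinP.
      - by move=> om _; rewrite lee_fin mulr_ge0.
      - by apply/measurable_EFinP; exact: measurable_funM.
    have -> : (\int[P]_om (G1 om)%:E = \int[P]_om (ind om * G1 om)%:E
        + \int[P]_om ((1 - ind om) * G1 om)%:E)%E.
      rewrite -ge0_integralD//.
      - by apply: eq_integral => om _; rewrite -EFinD; congr (_%:E); ring.
      - by move=> om _; rewrite lee_fin mulr_ge0.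
      - by apply/measurable_EFinP; exact: measurable_funM.
      - by move=> om _; rewrite lee_fin mulr_ge0.
      - by apply/measurable_EFinP; exact: measurable_funM.
    apply: leeD2r; apply: (le_trans HY).
    apply: ge0_le_integral => //.
    - move=> om _; rewrite lee_fin /Y /ind; case: ifPn => [h|_]; last by rewrite !mul0r.
      rewrite mul1r mulr_ge0//.
      have D0 : 0 <= rho n.+1 om - tn n om by rewrite (indE _ h) subr_ge0.
      have D1 : rho n.+1 om - tn n om <= 1 by rewrite (indE _ h) lerBlDl.
      by rewrite addr_ge0 ?mulr_ge0 ?power_sum_ge0// subr_ge0 mulr_ile1// ltW.
    - apply/measurable_EFinP; apply: measurable_funM; first exact: measurable_funM.
      have mD : measurable_fun setT (fun om => Num.min (tn n.+1 om) t - tn n om).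
        by apply: measurable_funB => //; exact: (mrho n.+1).
      apply: measurable_funD; last exact: measurable_funM.
      by apply: measurable_funM => //; apply: measurable_funB => //; exact: measurable_funM.
    - by apply/measurable_EFinP; exact: measurable_funM.
    - by move=> om _; rewrite lee_fin; exact: pt.
  have -> : (\int[P]_om (G1 om)%:E = \int[P]_om (u n om)%:E + \int[P]_om (C2 * (v n.+1 om - v n om))%:E)%E.
    rewrite -ge0_integralD//.
    - by move=> om _; rewrite lee_fin.
    - exact/measurable_EFinP.
    - by move=> om _; rewrite lee_fin mulr_ge0// subr_ge0.
    - by apply/measurable_EFinP; apply: measurable_funM => //; exact: measurable_funB.
  have -> : (\int[P]_om (g n.+1 om)%:E = \int[P]_om (g n om)%:E + \int[P]_om (C2 * (v n.+1 om - v n om))%:E)%E.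
    rewrite -ge0_integralD//.
    - by apply: eq_integral => om _; rewrite -EFinD; congr (_%:E); rewrite /g; ring.
    - by move=> om _; rewrite lee_fin.
    - exact/measurable_EFinP.
    - by move=> om _; rewrite lee_fin mulr_ge0// subr_ge0.
    - by apply/measurable_EFinP; apply: measurable_funM => //; exact: measurable_funB.
  exact: leeD2r.
pose s0 := fine (\int[P]_om (ZS om)%:E)%E.
have Es0 : (\int[P]_om (ZS om)%:E = s0%:E)%E by rewrite fineK// integrable_fin_num.
have s00 : 0 <= s0 by rewrite fine_ge0// integral_ge0// => om _; rewrite lee_fin.
have mSX : measurable_fun setT (fun om => S (fun i => X i t om)).
  apply: power_sum_measurable => i b; apply: (@sub_measurableW _ _ _ (F t)); [| |exact: mX].
    by case: Ffil => + _ _; apply.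
  by case: Ffil => _ + _; apply.
have mlast : measurable_fun setT (fun om => Z om * S (fun i => X i t om)).
  exact: measurable_funM.
have key : (\int[P]_om (Z om * expR (a * t) * S (fun i => X i t om))%:E <=
    (s0 + C2 * expR (a * t))%:E)%E.
  apply: (@fatou_le _ _ _ P (fun n om => (u n om)%:E) _ _ (fun=> 0)).
  - by move=> n; exact/measurable_EFinP.
  - by move=> n om; rewrite lee_fin.
  - by apply/measurable_EFinP; apply: measurable_funM => //; exact: measurable_funM.
  - by move=> om; rewrite lee_fin !mulr_ge0 ?expR_ge0 ?power_sum_ge0// ltW.
  - move=> om; exact: (stopped_power_sum_liminf om (ltW a0) t0 (Z0 om)).
  - move=> n; apply: (le_trans (claim n)).
    apply: (@le_trans _ _ (\int[P]_om ((ZS om)%:E + (C2 * expR (a * t))%:E))%E).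
      apply: ge0_le_integral => //.
      - by move=> om _; rewrite lee_fin.
      - exact/measurable_EFinP.
      - by apply: emeasurable_funD => //; exact/measurable_EFinP.
      - by move=> om _; rewrite -EFinD lee_fin.
    rewrite integralD//; last exact: finite_measure_integrable_cst.
    by rewrite Es0 integral_cst// [X in (_ * X)%E](probability_setT P) mule1 addr0.
  - exact: cvg_cst.
(* Multiplication by e^(- a t) turns s0 + C2 e^(a t) into at most s0 + C2, which is uniform in t. *)
have -> : (\int[P]_om (Z om * S (fun i => X i t om))%:E = (expR (- (a * t)))%:E *
    \int[P]_om (Z om * expR (a * t) * S (fun i => X i t om))%:E)%E.
  rewrite -ge0_integralZl//.
  - apply: eq_integral => om _; rewrite -EFinM; congr (_%:E).
    rewrite [Z om * expR _]mulrC !mulrA -expRD addNr expR0; ring.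
  - by apply/measurable_EFinP; apply: measurable_funM => //; exact: measurable_funM.
  - by move=> om _; rewrite lee_fin !mulr_ge0 ?expR_ge0 ?power_sum_ge0// ltW.
change (\int[P]_om (Z om * S (fun i => X i 0 om))%:E)%E with (\int[P]_om (ZS om)%:E)%E; rewrite Es0.
have e0 : (0 <= (expR (- (a * t)))%:E)%E by rewrite lee_fin expR_ge0.
apply: (le_trans (lee_wpmul2l e0 key)); rewrite -EFinM -EFinD lee_fin mulrDr.
apply: lerD; last by rewrite mulrCA -expRD addNr expR0 mulr1.
by rewrite ler_piMl// -expR0 ler_expR oppr_le0 mulr_ge0// ltW.
Qed.

End Scheme.

(** * Moments of order p *)

Section MomentInterpolation.
Context {R : realType}.

(** For y <= s the first term suffices; for y > s, y^r = y^(r-1) y <= s^(r-1) y because r - 1 <=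
    0. *)
Lemma powR_le_tangent (r s y : R) : 0 <= r <= 1 -> 0 < s -> 0 <= y ->
  y `^ r <= s `^ r + s `^ (r - 1) * y.
Proof.
move=> /andP[r0 r1] s0 y0.
have p0 : 0 <= s `^ (r - 1) * y by rewrite mulr_ge0// powR_ge0.
have [ys|sy] := leP y s.
  rewrite (le_trans _ (_ : s `^ r <= _))// ?lerDl//.
  by rewrite ge0_ler_powR// nnegrE// ltW.
have yp : 0 < y by exact: lt_trans sy.
rewrite (le_trans _ (_ : s `^ (r - 1) * y <= _))// ?lerDr ?powR_ge0//.
have -> : y `^ r = y `^ (r - 1) * y.
  by rewrite -[X in _ * X]powRr1// -powRD ?subrK// (gt_eqF yp) implybT.
rewrite ler_pM2r// -(opprB 1 r) !powRN lef_pV2 ?posrE ?powR_gt0//.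
by rewrite ge0_ler_powR ?nnegrE ?subr_ge0// ltW.
Qed.

(** With A = 1 + sum of |x_i|^p and q = 2 (j+1), each |x_i|^q is at most A^(q/p), and so is 1. The N
    + 1 terms add up to (N+1) A^(q/p), whose power p/q is at most (N+1) A. *)
Lemma powR_power_sum_le d N (x : 'I_N -> 'cV[R]_d) j (p : R) : 0 < p -> p <= (2 * j.+1)%:R ->
  (1 + power_sum j x) `^ (p / (2 * j.+1)%:R) <= N.+1%:R * (1 + \sum_i hsnorm (x i) `^ p).
Proof.
move=> p0 pq; set q : R := (2 * j.+1)%:R.
have q0 : 0 < q by rewrite ltr0n.
set r := p / q; have r0 : 0 < r by rewrite divr_gt0.
have r1 : r <= 1 by rewrite ler_pdivrMr// mul1r.
set A := 1 + \sum_i _.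
have A1 : 1 <= A by rewrite lerDl sumr_ge0// => i _; exact: powR_ge0.
have A0 : 0 <= A by exact: le_trans A1.
have hA i : (hsnorm (x i) ^+ 2) ^+ j.+1 <= A `^ r^-1.
  rewrite -exprM -powR_mulrn ?hsnorm_ge0// -/q.
  have -> : hsnorm (x i) `^ q = (hsnorm (x i) `^ p) `^ r^-1.
    by rewrite -powRrM /r invfM invrK mulrA divff ?gt_eqF// mul1r.
  rewrite ge0_ler_powR ?nnegrE ?powR_ge0 ?invr_ge0 ?(ltW r0)//.
  rewrite /A (bigD1 i)//= addrCA lerDl addr_ge0// sumr_ge0// => k _; exact: powR_ge0.
have A1' : 1 <= A `^ r^-1.
  by rewrite -(powRr0 A) ler_powR// invr_ge0 ltW.
have hS : 1 + power_sum j x <= N.+1%:R * A `^ r^-1.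
  rewrite -natr1 mulrDl mul1r addrC lerD// /power_sum.
  apply: (le_trans (ler_sum _ (fun i _ => hA i))).
  by rewrite sumr_const card_ord mulr_natl.
have S0 : 0 <= 1 + power_sum j x by rewrite addr_ge0// power_sum_ge0.
apply: (@le_trans _ _ ((N.+1%:R * A `^ r^-1) `^ r)).
  by rewrite ge0_ler_powR ?nnegrE ?(ltW r0)// mulr_ge0// powR_ge0.
rewrite powRM// ?powR_ge0// -powRrM mulVf ?gt_eqF// powRr1// ler_wpM2r//.
by rewrite -[leRHS]powRr1// ler_powR// ler1n.
Qed.

Lemma moment_of_weighted_moment dT (T : measurableType dT) (P : probability T R)
    (F0 : set (set T)) d N (X : 'I_N -> R -> T -> 'cV[R]_d) j (p C : R) :
  sigma_algebra setT F0 -> F0 `<=` measurable ->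
  (forall i a, sub_measurable F0 (fun om => X i 0 om a 0)) ->
  (forall i (t : R) a, 0 <= t -> measurable_fun setT (fun om => X i t om a 0)) ->
  (forall Z : T -> R, (forall om, 0 < Z om) -> (forall om, Z om <= 1) ->
    sub_measurable F0 Z ->
    P.-integrable setT (fun om => (Z om * power_sum j (fun i => X i 0 om))%:E) ->
    forall t : R, 0 <= t ->
    (\int[P]_om (Z om * power_sum j (fun i => X i t om))%:E <=
     \int[P]_om (Z om * power_sum j (fun i => X i 0 om))%:E + C%:E)%E) ->
  0 < p -> p <= (2 * j.+1)%:R ->
  (forall i, (\int[P]_om (hsnorm (X i 0 om) `^ p)%:E < +oo)%E) ->
  exists C' : R, 0 <= C' /\ forall i (t : R), 0 <= t ->
    (\int[P]_om (hsnorm (X i t om) `^ p)%:E <= C'%:E)%E.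
Proof.
move=> sF0 F0T mX0 mX HC p0 pq fin; set q : R := (2 * j.+1)%:R in pq.
have q0 : 0 < q by rewrite ltr0n.
set r := p / q; have r0 : 0 < r by rewrite divr_gt0.
have r1 : r <= 1 by rewrite ler_pdivrMr// mul1r.
pose s om := 1 + power_sum j (fun i => X i 0 om).
have s1 om : 1 <= s om by rewrite lerDl power_sum_ge0.
have s0 om : 0 < s om by exact: lt_le_trans (s1 om).
have msF0 : sub_measurable F0 s.
  apply: (@measurable_funD _ (g_sigma_algebraType F0)) => //.
  apply: (@power_sum_measurable _ _ _ _ _ (g_sigma_algebraType F0)) => i a; exact: mX0.
have ms : measurable_fun setT s by exact: sub_measurableW msF0.
(* As s >= 1 and r <= 1, Z <= 1; as S(X_0) <= s, Z S(X_0) <= s^r, which is integrable under the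
   moment of order p alone. *)
pose Z om := s om `^ (r - 1).
have Z0 om : 0 < Z om by exact: powR_gt0.
have Z1 om : Z om <= 1.
  by rewrite -(powRr0 (s om)) ler_powR// subr_le0.
have mZF0 : sub_measurable F0 Z.
  apply: (@measurableT_comp _ _ _ (g_sigma_algebraType F0) _ _ (fun x : R => x `^ (r - 1))) => //.
have mZ : measurable_fun setT Z by exact: sub_measurableW mZF0.
have mh i t : 0 <= t -> measurable_fun setT (fun om => hsnorm (X i t om) `^ p).
  move=> t0; apply: (measurableT_comp (measurable_powR _)).
  by apply: measurable_hsnorm => a; exact: mX.
have mS t : 0 <= t -> measurable_fun setT (fun om => power_sum j (fun i => X i t om)).
  by move=> t0; apply: power_sum_measurable => i a; exact: mX.
have msr : measurable_fun setT (fun om => s om `^ r) by exact: (measurableT_comp (measurable_powR _)).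
have ih i : P.-integrable setT (fun om => (hsnorm (X i 0 om) `^ p)%:E).
  apply/integrableP; split; first by apply/measurable_EFinP; exact: mh.
  under eq_integral do rewrite /= ger0_norm ?powR_ge0//.
  exact: fin.
have isr : P.-integrable setT (fun om => (s om `^ r)%:E).
  apply: (@le_integrable _ _ _ P _ measurableT _
    (fun om => N.+1%:R%:E * (1%:E + \sum_i (hsnorm (X i 0 om) `^ p)%:E))%E).
  - exact/measurable_EFinP.
  - move=> om _; rewrite sumEFin -EFinD -EFinM /= lee_fin.
    rewrite ger0_norm ?powR_ge0// ger0_norm; first exact: powR_power_sum_le.
    by rewrite mulr_ge0// addr_ge0// sumr_ge0// => k _; exact: powR_ge0.
  - apply: integrableZl => //; apply: integrableD => //.
      exact: finite_measure_integrable_cst.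
    by apply: integrable_sum => // i _; exact: ih.
have ZS om : Z om * power_sum j (fun i => X i 0 om) <= s om `^ r.
  apply: (@le_trans _ _ (Z om * s om)); first by rewrite ler_wpM2l ?(ltW (Z0 om))// lerDr.
  by rewrite /Z -[X in _ * X]powRr1 ?(ltW (s0 om))// -powRD ?subrK// (gt_eqF (s0 om)) implybT.
have iZS : P.-integrable setT (fun om => (Z om * power_sum j (fun i => X i 0 om))%:E).
  apply: (@le_integrable _ _ _ P _ measurableT _ (fun om => (s om `^ r)%:E)) => //.
    by apply/measurable_EFinP; apply: measurable_funM => //; exact: mS.
  move=> om _; rewrite /= lee_fin !ger0_norm ?powR_ge0// mulr_ge0 ?power_sum_ge0//.
  exact: ltW.
have ZS0 t om : 0 <= Z om * power_sum j (fun i => X i t om).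
  by rewrite mulr_ge0 ?power_sum_ge0// ltW.
pose c := fine (\int[P]_om (s om `^ r)%:E)%E.
have cE : (\int[P]_om (s om `^ r)%:E)%E = c%:E by rewrite fineK// integrable_fin_num.
pose c' := fine (\int[P]_om (Z om * power_sum j (fun i => X i 0 om))%:E)%E.
have c'E : (\int[P]_om (Z om * power_sum j (fun i => X i 0 om))%:E)%E = c'%:E.
  by rewrite fineK// integrable_fin_num.
(* No sign of C is assumed, so the absolute value secures nonnegativity. *)
exists `|c + (c' + C)|; split=> // i t t0.
apply: (@le_trans _ _ (c + (c' + C))%:E); last by rewrite lee_fin ler_norm.
rewrite !EFinD -cE -c'E.
apply: (@le_trans _ _ (\int[P]_om ((s om `^ r)%:E +
    (Z om * power_sum j (fun i => X i t om))%:E))%E).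
  apply: ge0_le_integral => //.
  - by move=> om _; rewrite lee_fin powR_ge0.
  - by apply/measurable_EFinP; exact: mh.
  - apply: emeasurable_funD; apply/measurable_EFinP => //.
    by apply: measurable_funM => //; exact: mS.
  - move=> om _; rewrite -EFinD lee_fin.
    set h := hsnorm _; have h0 : 0 <= h by exact: hsnorm_ge0.
    have -> : h `^ p = ((h ^+ 2) ^+ j.+1) `^ r.
      by rewrite -exprM -(powR_mulrn (2 * j.+1) h0) -powRrM -/q mulrC /r divfK// gt_eqF.
    have r01 : 0 <= r <= 1 by rewrite (ltW r0).
    apply: (le_trans (powR_le_tangent r01 (s0 om) _)).
      by rewrite exprn_ge0// sqr_ge0.
    rewrite lerD2l ler_wpM2l ?(ltW (Z0 om))// /power_sum (bigD1 i)//= lerDl.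
    by rewrite sumr_ge0// => k _; rewrite exprn_ge0// sqr_ge0.
rewrite ge0_integralD//.
- by apply: leeD2l; exact: HC.
- by move=> om _; rewrite lee_fin powR_ge0.
- exact/measurable_EFinP.
- by move=> om _; rewrite lee_fin.
- by apply/measurable_EFinP; apply: measurable_funM => //; exact: mS.
Qed.

End MomentInterpolation.

(** * Brownian families on a product space *)

Lemma measurable_wrt_comp (R : realType) (T : pointedType) (U : topologicalType)
    (G : set (set T)) (f : T -> U) (g : U -> R) : sigma_algebra setT G ->
  measurable_wrt G f -> continuous g -> sub_measurable G (g \o f).
Proof.
move=> sG mf /continuousP cg.
apply: (@measurability _ _ (g_sigma_algebraType G) R _ _ _ (RGenOInfty.measurableE R)).
move=> _ [_ [a ->] <-]; rewrite setTI; apply: sub_sigma_algebra.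
rewrite comp_preimage; apply: mf; apply: sub_sigma_algebra.
by apply: cg; exact: interval_open.
Qed.

Section BrownianFamily.
Context dT (T : measurableType dT) (R : realType) (P : probability T R).
Variables (F : R -> set (set T)) (K : finType) (w : K -> R -> T -> R).
Hypothesis BM : brownian_family P F w.

(** The joint statement is used with the whole line as target set of every other coordinate, so that
    those factors are 1. *)
Lemma brownian_independent_increments k : independent_gaussian_increments P F (w k).
Proof.
case: BM => _ _ _ H s t s0 st A D FA mD.
pose Dk k' : set R := if k' == k then D else setT.
have mDk k' : measurable (Dk k') by rewrite /Dk; case: ifP.
have := H s t s0 st A Dk FA mDk.
have -> : [set om | forall k', Dk k' (w k' t om - w k' s om)] =
    (fun om => w k t om - w k s om) @^-1` D.
  apply/seteqP; split=> [om /(_ k)|om /= h k']; rewrite /Dk ?eqxx//.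
  by case: eqP => // ->.
move=> ->; congr (_ * _)%E; rewrite (bigD1 k)//= /Dk eqxx big1 ?mule1// => k' /negPf ->.
exact: (@probability_setT _ (measurableTypeR R) R (normal_prob 0 (Num.sqrt (t - s)))).
Qed.

Lemma brownian_sub_measurable k (t : R) : is_filtration F -> 0 <= t ->
  sub_measurable (F t) (w k t).
Proof.
move=> [sF _ _] t0; case: BM => _ _ ad _.
apply: (@measurable_wrt_comp _ _ R (F t) (w k t) id); [exact: sF|exact: ad|].
by move=> x; exact: cvg_id.
Qed.

Lemma brownian_measurable k (t : R) : is_filtration F -> 0 <= t ->
  measurable_fun setT (w k t).
Proof.
move=> fF t0; have := brownian_sub_measurable k fF t0.
by case: fF => sF FT _; apply: sub_measurableW; [exact: sF|exact: FT].
Qed.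

(** At t = 0 only right-continuity is available; this is why the sequence is required to be
    nonnegative. *)
Lemma brownian_sequentially_continuous k om (u : nat -> R) (t : R) :
  (forall m, 0 <= u m) -> 0 <= t -> u @ \oo --> t ->
  w k (u m) om @[m --> \oo] --> w k t om.
Proof.
move=> u0 t0 ut; case: BM => /(_ k om) /continuous_within_itvcyP[ci c0] _ _ _.
have [tp|] := ltP 0 t.
  by apply: (cvg_comp u (fun x => w k x om) ut); apply: ci; rewrite in_itv/= andbT.
move=> t_le0; have t00 : t = 0 by apply/eqP; rewrite eq_le t_le0.
rewrite t00 in ut *.
have := cvg_at_right_within c0 => {}c0.
apply: cvg_comp c0 => A; rewrite /within/= nbhs_simpl => /ut h.
by apply: filterS (h : \forall m \near \oo, 0 <= u m -> A (u m)) => m; apply.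
Qed.

End BrownianFamily.

Section ProductFiltration.
Context (R : realType) d1 d2 (T1 : measurableType d1) (T2 : measurableType d2).
Variables (F1 : R -> set (set T1)) (F2 : R -> set (set T2)).
Hypothesis fF1 : is_filtration F1.
Hypothesis fF2 : is_filtration F2.
Local Notation F := (prod_filtration F1 F2).

Lemma prod_filtration_is_filtration : is_filtration F.
Proof.
case: fF1 fF2 => s1 m1 h1 [s2 m2 h2]; split=> [t t0|t t0|s t s0 st].
- exact: smallest_sigma_algebra.
- apply: smallest_sub; first exact: sigma_algebra_measurable.
  by move=> _ [A FA [C FC <-]]; apply: measurableX; [exact: m1 FA|exact: m2 FC].
- apply: sub_sigma_algebra2 => _ [A FA [C FC <-]].
  by exists A; [exact: h1 FA|exists C => //; exact: h2 FC].
Qed.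

Section Increments.
Variables (P1 : probability T1 R) (P2 : probability T2 R).

(* Rectangles form a pi-system generating [F s], and both sides are finite
   measures in [A]. *)
Let independent_increments_rectangles (w : R -> T1 * T2 -> R) :
  (forall t : R, 0 <= t -> measurable_fun setT (w t)) ->
  (forall s t : R, 0 <= s -> s < t -> forall A C (D : set R), F1 s A -> F2 s C -> measurable D ->
    (P1 \x P2)%E ((A `*` C) `&` (fun om => w t om - w s om) @^-1` D) =
    ((P1 \x P2)%E (A `*` C) * normal_prob 0 (Num.sqrt (t - s)) D)%E) ->
  independent_gaussian_increments (P1 \x P2)%E F w.
Proof.
move=> mw H s t s0 st A D FA mD.
case: (fF1) (fF2) => s1 m1 h1 [s2 m2 h2].
pose P := (P1 \x P2)%E : probability (T1 * T2)%type R.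
set D' := _ @^-1` D.
have mD' : measurable D'.
  rewrite -[D']setTI; apply: measurable_funB => //; apply: mw => //.
  exact: le_trans (ltW st).
pose nu := normal_prob 0 (Num.sqrt (t - s)) : probability (measurableTypeR R) R.
have nuf : nu D \is a fin_num by exact: fin_num_measure.
have c0 : 0 <= fine (nu D) by rewrite fine_ge0.
pose mu1 := mrestr P mD' : {measure set (T1 * T2) -> \bar R}.
pose mu2 := mscale (NngNum c0) P : {measure set (T1 * T2) -> \bar R}.
have mu2E C : mu2 C = (P C * nu D)%E by rewrite /mu2/= /mscale/= fineK// muleC.
rewrite -/(nu D) -mu2E; change (mu1 A = mu2 A).
pose Rect := [set A `*` C | A in F1 s & C in F2 s].
have RE : [set X | Rect X /\ X `<=` setT] = Rect.
  by apply/seteqP; split=> [X []|X ?].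
have rT : Rect setT.
  exists setT; first by case: (s1 _ s0) => e0 eC _; rewrite -(setD0 setT); exact: eC.
  exists setT; last by rewrite setXTT.
  by case: (s2 _ s0) => e0 eC _; rewrite -(setD0 setT); exact: eC.
have eqR X : Rect X -> mu1 X = mu2 X.
  by move=> [B FB [C FC <-]]; rewrite mu2E; exact: H.
apply: (@g_sigma_algebra_measure_unique_trace _ _ _ Rect setT measurableT) => //.
- rewrite RE => _ [B FB [C FC <-]].
  by apply: measurableX; [exact: (m1 s s0) FB|exact: (m2 s s0) FC].
- rewrite RE => _ _ [B FB [C FC <-]] [B' FB' [C' FC' <-]].
  exists (B `&` B').
    move: FB FB'; rewrite -(measurable_g_measurableTypeE (s1 _ s0)); exact: measurableI.
  exists (C `&` C'); last by rewrite setXI.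
  move: FC FC'; rewrite -(measurable_g_measurableTypeE (s2 _ s0)); exact: measurableI.
- exact: eqR.
- by move=> X; rewrite RE; exact: eqR.
- by rewrite ltey_eq fin_num_measure.
- by rewrite RE.
Qed.

Lemma independent_increments_fst (w : R -> T1 -> R) :
  (forall t : R, 0 <= t -> measurable_fun setT (w t)) ->
  independent_gaussian_increments P1 F1 w ->
  independent_gaussian_increments (P1 \x P2)%E F (fun t om => w t om.1).
Proof.
move=> mw Hw; apply: independent_increments_rectangles.
  by move=> t t0; apply: (measurableT_comp (mw t t0)); exact: measurable_fst.
move=> s t s0 st A C D FA FC mD.
have -> : (A `*` C) `&` (fun om : T1 * T2 => w t om.1 - w s om.1) @^-1` D =
    (A `&` (fun om => w t om - w s om) @^-1` D) `*` C.
  by apply/seteqP; split=> [[x y] [[? ?] ?]|[x y] [[? ?] ?]].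
case: (fF1) (fF2) => _ m1 _ [_ m2 _].
have mA := m1 s s0 A FA; have mC := m2 s s0 C FC.
rewrite product_measure1E//; last first.
  apply: measurableI => //; rewrite -[X in measurable X]setTI.
  by apply: measurable_funB => //; apply: mw => //; exact: le_trans (ltW st).
by rewrite product_measure1E// [X in (X * _)%E]Hw// muleAC.
Qed.

Lemma independent_increments_snd (w : R -> T2 -> R) :
  (forall t : R, 0 <= t -> measurable_fun setT (w t)) ->
  independent_gaussian_increments P2 F2 w ->
  independent_gaussian_increments (P1 \x P2)%E F (fun t om => w t om.2).
Proof.
move=> mw Hw; apply: independent_increments_rectangles.
  by move=> t t0; apply: (measurableT_comp (mw t t0)); exact: measurable_snd.
move=> s t s0 st A C D FA FC mD.
have -> : (A `*` C) `&` (fun om : T1 * T2 => w t om.2 - w s om.2) @^-1` D =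
    A `*` (C `&` (fun om => w t om - w s om) @^-1` D).
  by apply/seteqP; split=> [[x y] [[? ?] ?]|[x y] [? [? ?]]].
case: (fF1) (fF2) => _ m1 _ [_ m2 _].
have mA := m1 s s0 A FA; have mC := m2 s s0 C FC.
rewrite product_measure1E//; last first.
  apply: measurableI => //; rewrite -[X in measurable X]setTI.
  by apply: measurable_funB => //; apply: mw => //; exact: le_trans (ltW st).
by rewrite product_measure1E// [X in (_ * X)%E]Hw// muleA.
Qed.

End Increments.
End ProductFiltration.

(** * The adaptive Euler-Maruyama step *)

Section AdaptiveStep.
Context {R : realType} (d N : nat).
Variables (b : 'cV[R]_d -> PRd R d -> 'cV[R]_d) (lambda2 l K delta : R).
Hypothesis N0 : (0 < N)%N.
Hypothesis lambda2_gt0 : 0 < lambda2.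
Hypothesis b_W1 : forall (x : 'cV[R]_d) (mu nu : PRd R d),
  finite_first_moment mu -> finite_first_moment nu ->
  ((hsnorm (b x mu - b x nu))%:E <= lambda2%:E * W1 mu nu)%E.
Hypothesis l_ge0 : 0 <= l.
Hypothesis K_gt0 : 0 < K.
Hypothesis b_poly : forall (x y : 'cV[R]_d) (mu : PRd R d), finite_first_moment mu ->
  hsnorm (b x mu - b y mu) <= K * (1 + hsnorm x `^ l + hsnorm y `^ l) * hsnorm (x - y).
Hypothesis delta_gt0 : 0 < delta.
Hypothesis delta_lt1 : delta < 1.
Implicit Types x : 'I_N -> 'cV[R]_d.

Let onep x i : 0 < 1 + hsnorm (b (x i) (empirical x)) ^+ 2.
Proof. by rewrite ltr_pwDl// sqr_ge0. Qed.

Lemma em_step_gt0 x : 0 < em_step b delta x.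
Proof.
rewrite mulr_gt0//; apply: lt_bigmin => // i _; by rewrite invr_gt0.
Qed.

Lemma em_step_le1 x : em_step b delta x <= 1.
Proof.
by rewrite mulr_ile1 ?(ltW delta_gt0) ?(ltW delta_lt1) ?bigmin_le_id// ltW// lt_bigmin// => i _; rewrite invr_gt0.
Qed.

(** The minimum is at most its i-th entry and delta < 1, so the product is at most y / (1 + y) with
    y = |b|^2. This is the smallness of the step that [perturb_pow] requires. *)
Lemma em_step_drift_sqr x i :
  em_step b delta x * hsnorm (b (x i) (empirical x)) ^+ 2 <= 1.
Proof.
apply: (@le_trans _ _ ((1 + hsnorm (b (x i) (empirical x)) ^+ 2)^-1
    * hsnorm (b (x i) (empirical x)) ^+ 2)).
  rewrite ler_wpM2r ?sqr_ge0//.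
  apply: (@le_trans _ _ (1 * (1 + hsnorm (b (x i) (empirical x)) ^+ 2)^-1)); last by rewrite mul1r.
  rewrite ler_pM ?(ltW delta_gt0) ?(ltW delta_lt1)//; last exact: bigmin_le.
  by rewrite le_bigmin// => k _; rewrite invr_ge0 ltW.
by rewrite mulrC ler_pdivrMr// mul1r lerDr.
Qed.

(** On a bounded configuration the drift is bounded, by comparison with b at 0 in space (polynomial
    Lipschitz bound) and then with the zero configuration in the measure. The term 0 to the power l
    is kept in [D] because it equals 1 for l = 0. *)
Lemma em_step_lower_bound (M : R) : exists c : R, 0 < c /\
  forall x, (forall i, hsnorm (x i) <= M) -> c <= em_step b delta x.
Proof.
pose z : 'I_N -> 'cV[R]_d := fun=> 0.
pose D := hsnorm (b 0 (empirical z)) + lambda2 * `|M| + K * (1 + `|M| `^ l + 0 `^ l) * `|M|.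
have D0 : 0 <= D.
  by rewrite !addr_ge0 ?hsnorm_ge0// mulr_ge0 ?(ltW lambda2_gt0)// mulr_ge0 ?(ltW K_gt0)// !addr_ge0 ?powR_ge0.
have D1 : 0 < 1 + D ^+ 2 by rewrite ltr_pwDl// sqr_ge0.
exists (delta * (1 + D ^+ 2)^-1); split; first by rewrite mulr_gt0// invr_gt0.
move=> x xM; rewrite ler_pM2l//; apply: le_bigmin.
  by rewrite invf_le1// lerDl sqr_ge0.
move=> i _; rewrite lef_pV2 ?posrE// lerD2l lerXn2r ?nnegrE ?hsnorm_ge0//.
have xM' k : hsnorm (x k) <= `|M| by rewrite (le_trans (xM k))// ler_norm.
have h1 : hsnorm (b (x i) (empirical x) - b 0 (empirical x)) <=
    K * (1 + `|M| `^ l + 0 `^ l) * `|M|.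
  apply: (le_trans (b_poly _ _ (finite_first_moment_empirical N0 x))).
  rewrite subr0 hsnorm0 ler_pM ?hsnorm_ge0//.
    by rewrite mulr_ge0 ?(ltW K_gt0)// !addr_ge0 ?powR_ge0.
  by rewrite ler_pM2l// lerD2r lerD2l ge0_ler_powR ?nnegrE ?hsnorm_ge0.
have h2 : hsnorm (b 0 (empirical x) - b 0 (empirical z)) <= lambda2 * `|M|.
  apply: (le_trans (b_empirical_lipschitz N0 lambda2_gt0 b_W1 _ _ _)).
  rewrite ler_pM2l// ler_pdivrMl ?ltr0n//.
  apply: (@le_trans _ _ (\sum_(j < N) `|M|)).
    by apply: ler_sum => k _; rewrite subr0.
  by rewrite sumr_const card_ord mulr_natl.
apply: (le_trans (ler_hsnormB _ (b 0 (empirical x)))).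
have := ler_hsnormB (b 0 (empirical x)) (b 0 (empirical z)).
by rewrite /D; move: h1 h2; lra.
Qed.

Section Measurability.
Context dT (T : measurableType dT) (Y : T -> 'I_N -> 'cV[R]_d).
Hypothesis mY : forall j a, measurable_fun setT (fun om => Y om j a 0).

Lemma measurable_drift i a :
  measurable_fun setT (fun om => b (Y om i) (empirical (Y om)) a 0).
Proof.
pose M om : 'M[R]_(d, N) := \matrix_(k, j) Y om j k 0.
have colM om j : col j (M om) = Y om j.
  by apply/matrixP => k c; rewrite !mxE (ord1 c).
have EM om : (fun j => col j (M om)) = Y om by apply/funext => j; exact: colM.
have := continuous_mx_measurable
  (@b_empirical_continuous _ _ _ _ _ _ _ N0 lambda2_gt0 b_W1 l_ge0 K_gt0 b_poly i a) (X := M).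
under eq_fun do rewrite EM colM.
move=> H; apply: H => k j; under eq_fun do rewrite mxE; exact: mY.
Qed.

Lemma measurable_em_step : measurable_fun setT (fun om => em_step b delta (Y om)).
Proof.
apply: measurable_funM => //.
elim: (index_enum 'I_N) => [|i r IH].
  by under eq_fun do rewrite big_nil; exact: measurable_cst.
under eq_fun do rewrite big_cons.
apply: measurable_minr => //.
pose g (y : R) := (1 + y ^+ 2)^-1.
apply: (@measurableT_comp _ _ _ _ _ _ g).
  apply: continuous_measurable_fun => y; apply: cvgV.
    by rewrite gt_eqF// ltr_pwDl// sqr_ge0.
  by apply: cvgD; [exact: cvg_cst|exact: exprn_continuous].
by apply: measurable_hsnorm => a; exact: measurable_drift.
Qed.

End Measurability.
End AdaptiveStep.

(** * Scalar coordinates of the noise and identical initial laws *)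

Lemma mulmx_sum_col (R : realType) m n (A : 'M[R]_(m, n)) (v : 'cV[R]_n) :
  A *m v = \sum_k v k 0 *: col k A.
Proof.
apply/matrixP => a c; rewrite !mxE summxE; apply: eq_bigr => k _.
by rewrite !mxE (ord1 c) mulrC.
Qed.

Lemma hsnorm_col_le (R : realType) m n (A : 'M[R]_(m, n)) k : hsnorm (col k A) <= hsnorm A.
Proof.
rewrite /hsnorm ler_wsqrtr//; apply: ler_sum => a _.
rewrite big_ord1 mxE (bigD1 k)//= lerDl sumr_ge0// => c _; exact: sqr_ge0.
Qed.

Lemma ge0_integral_same_law (R : realType) d (T : measurableType d) d' (T' : measurableType d')
    (P : probability T R) (Y1 Y2 : T -> T') (f : T' -> \bar R) :
  measurable_fun setT Y1 -> measurable_fun setT Y2 ->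
  (forall A, measurable A -> P (Y1 @^-1` A) = P (Y2 @^-1` A)) ->
  measurable_fun setT f -> (forall y, (0 <= f y)%E) ->
  (\int[P]_om f (Y1 om) = \int[P]_om f (Y2 om))%E.
Proof.
move=> mY1 mY2 law mf f0.
have E1 := @ge0_integral_pushforward _ _ _ _ _ _ mY1 P setT f measurableT mf (fun y _ => f0 y).
have E2 := @ge0_integral_pushforward _ _ _ _ _ _ mY2 P setT f measurableT mf (fun y _ => f0 y).
rewrite !preimage_setT in E1 E2; rewrite -[LHS]E1 -[RHS]E2.
by apply: eq_measure_integral => A mA _; exact: law.
Qed.

(** The moment is assumed finite for one particle, whereas the power sum involves all of them;
    equality of the laws bridges the gap. *)
Lemma iid_product_moment (R : realType) d N dB dW (OmB : measurableType dB)
    (OmW : measurableType dW) (PB : probability OmB R) (PW : probability OmW R)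
    (G : set (set OmB)) (X0 : 'I_N -> OmB -> 'cV[R]_d) (p : R) i k :
  G `<=` measurable -> (forall j, measurable_wrt G (X0 j)) -> iid PB X0 ->
  (\int[PB \x PW]_om (hsnorm (X0 i om.1) `^ p)%:E =
   \int[PB \x PW]_om (hsnorm (X0 k om.1) `^ p)%:E)%E.
Proof.
move=> Gm mX0 [_ law].
have m1 j : measurable_fun setT (fun om : OmB * OmW => X0 j om.1 : Rd R d).
  move=> _ D mD; rewrite setTI.
  rewrite (_ : _ @^-1` D = (X0 j @^-1` D) `*` setT); last first.
    by apply/seteqP; split=> [[x y]|[x y] []].
  by apply: measurableX => //; apply: Gm; exact: mX0.
apply: (@ge0_integral_same_law R _ _ _ (Rd R d) (PB \x PW)%E (fun om => X0 i om.1)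
  (fun om => X0 k om.1) (fun x : Rd R d => (hsnorm (x : 'cV[R]_d) `^ p)%:E)) => //.
- move=> A mA.
  have E j : (fun om : OmB * OmW => X0 j om.1) @^-1` A = (X0 j @^-1` A) `*` setT.
    by apply/seteqP; split=> [[x y]|[x y] []].
  have mE j : measurable (X0 j @^-1` A) by apply: Gm; exact: mX0.
  have EP j : (PB \x PW)%E ((X0 j @^-1` A) `*` setT) = (PB (X0 j @^-1` A) * PW setT)%E.
    exact: product_measure1E.
  by rewrite !E; apply: (etrans (EP i)); rewrite (law i k)// -EP.
- apply/measurable_EFinP; apply: (measurableT_comp (measurable_powR _)).
  by apply: measurable_hsnorm => a; exact: measurable_coord.
- by move=> y; rewrite lee_fin powR_ge0.
Qed.

Unset Implicit Arguments.
Set Strict Implicit.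

Theorem lemma3p4 (R : realType) (d m1 m2 N : nat)
  (b : 'cV[R]_d -> PRd R d -> 'cV[R]_d)
  (sigma : 'cV[R]_d -> PRd R d -> 'M[R]_(d, m1))
  (sigmabar : 'cV[R]_d -> PRd R d -> 'M[R]_(d, m2))
  (sigma0 sigma1 : R)
  (* (i) *)
  (lambda1 lambda2 l0 : R) (phi : R -> R)
  (b_loclip : locally_lipschitz (fun x => b x (delta0 R d)))
  (lambda1_gt0 : 0 < lambda1) (l0_ge1 : 1 <= l0)
  (phi_ge0 : forall r : R, 0 <= r -> 0 <= phi r)
  (phi_incr : forall r s : R, 0 <= r -> r <= s -> phi r <= phi s)
  (phi_cont : {within `[0, +oo[, continuous phi})
  (phi0 : phi 0 = 0)
  (b_diss : forall (x y : 'cV[R]_d) (mu : PRd R d), finite_first_moment mu ->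
     inner (x - y) (b x mu - b y mu) <=
       hsnorm (x - y) * phi (hsnorm (x - y)) * \1_[set r : R | r <= l0] (hsnorm (x - y))
       - lambda1 * hsnorm (x - y) ^+ 2 * \1_[set r : R | l0 < r] (hsnorm (x - y)))
  (lambda2_gt0 : 0 < lambda2)
  (b_W1 : forall (x : 'cV[R]_d) (mu nu : PRd R d), finite_first_moment mu -> finite_first_moment nu ->
     ((hsnorm (b x mu - b x nu))%:E <= lambda2%:E * W1 mu nu)%E)
  (* (ii) *)
  (l K : R) (l_ge0 : 0 <= l) (K_gt0 : 0 < K)
  (b_poly : forall (x y : 'cV[R]_d) (mu : PRd R d), finite_first_moment mu ->
     hsnorm (b x mu - b y mu) <=
       K * (1 + hsnorm x `^ l + hsnorm y `^ l) * hsnorm (x - y))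
  (* (iii) *)
  (Lhat : R) (Lhat_gt0 : 0 < Lhat)
  (sigma_bounded : forall (x : 'cV[R]_d) (mu : PRd R d), finite_first_moment mu ->
     Num.max (hsnorm (sigma x mu)) (hsnorm (sigmabar x mu)) <= Lhat)
  (* (iv) *)
  (lambda12 : 2 * lambda2 < lambda1)
  (* probability spaces, Brownian motions, initial data *)
  (dB dW : measure_display) (OmB : measurableType dB) (OmW : measurableType dW)
  (PB : probability OmB R) (PW : probability OmW R)
  (FB : R -> set (set OmB)) (FW : R -> set (set OmW))
  (FB_filtration : is_filtration FB) (FW_filtration : is_filtration FW)
  (FB_usual : usual_conditions PB FB) (FW_usual : usual_conditions PW FW)
  (B : 'I_N -> R -> OmB -> 'cV[R]_d) (Bbar : 'I_N -> R -> OmB -> 'cV[R]_m1)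
  (W : R -> OmW -> 'cV[R]_d) (Wbar : R -> OmW -> 'cV[R]_m2)
  (BM_B : brownian_family PB FB (fun (k : 'I_N * 'I_(d + m1)) t om =>
     col_mx (B k.1 t om) (Bbar k.1 t om) k.2 0))
  (BM_W : brownian_family PW FW (fun (k : 'I_(d + m2)) t om =>
     col_mx (W t om) (Wbar t om) k 0))
  (X0 : 'I_N -> OmB -> 'cV[R]_d)
  (X0_meas : forall j, measurable_wrt (FB 0) (X0 j))
  (X0_iid : iid PB X0)
  (* the scheme *)
  (delta : R) (X : 'I_N -> R -> OmB * OmW -> 'cV[R]_d)
  (X_EM : is_adaptive_EM (prod_filtration FB FW) b sigma sigmabar
     sigma0 sigma1 delta X0 B Bbar W Wbar X)
  (p : R) (p_gt0 : 0 < p) (i : 'I_N)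
  (delta_gt0 : 0 < delta) (delta_lt1 : delta < 1)
  (delta_small : delta < 1 / (2 * (lambda1 - 2 * lambda2))) :
  ('E_(PB \x PW)[fun om => (hsnorm (X i 0%R om) `^ p)%R] < +oo)%E ->
  exists C : R, 0 < C /\
    forall t : R, 0 <= t ->
      ('E_(PB \x PW)[fun om => (hsnorm (X i t om) `^ p)%R] <=
       'E_(PB \x PW)[fun om => (hsnorm (X i 0%R om) `^ p)%R] + C%:E)%E.
Proof.
move=> fin0.
have N0 : (0 < N)%N by exact: leq_ltn_trans (ltn_ord i).
case: X_EM => adX msig msigbar X0E XEM.
pose F := prod_filtration FB FW.
have fF : is_filtration F by exact: prod_filtration_is_filtration.
have sF (t : R) : 0 <= t -> sigma_algebra setT (F t) by case: fF => + _ _; apply.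
have FT (t : R) : 0 <= t -> F t `<=` measurable by case: fF => _ + _; apply.
pose P := (PB \x PW)%E : probability (OmB * OmW)%type R.
pose wB (k : 'I_N * 'I_(d + m1)) t om : R := col_mx (B k.1 t om) (Bbar k.1 t om) k.2 0.
pose wW (k : 'I_(d + m2)) t om : R := col_mx (W t om) (Wbar t om) k 0.
(* All scalar noises in one finite family: on the left a particle and a coordinate of its own
   stacked noise (B, Bbar), on the right a coordinate of the common stacked noise (W, Wbar). *)
pose w (c : ('I_N * 'I_(d + m1) + 'I_(d + m2))%type) t (om : OmB * OmW) : R :=
  match c with inl k => wB k t om.1 | inr k => wW k t om.2 end.
have mB k (t : R) : 0 <= t -> measurable_fun setT (wB k t).
  exact: (brownian_measurable BM_B).
have mW k (t : R) : 0 <= t -> measurable_fun setT (wW k t).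
  exact: (brownian_measurable BM_W).
have mw c (t : R) : 0 <= t -> measurable_fun setT (w c t).
  case: c => k t0.
    exact: (measurableT_comp (mB k t t0) measurable_fst).
  exact: (measurableT_comp (mW k t t0) measurable_snd).
have cw c om (u : nat -> R) (t : R) : (forall m, 0 <= u m) -> 0 <= t -> u @ \oo --> t ->
    w c (u m) om @[m --> \oo] --> w c t om.
  case: c => k.
    exact: (brownian_sequentially_continuous BM_B).
  exact: (brownian_sequentially_continuous BM_W).
have Hw c : independent_gaussian_increments P F (w c).
  case: c => k.
    apply: (@independent_increments_fst _ _ _ _ _ _ _ FB_filtration FW_filtration PB PW (wB k)).
      exact: mB.
    exact: (brownian_independent_increments BM_B).
  apply: (@independent_increments_snd _ _ _ _ _ _ _ FB_filtration FW_filtration PB PW (wW k)).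
    exact: mW.
  exact: (brownian_independent_increments BM_W).
pose tn := em_grid b delta X.
pose xn := em_state b delta X.
pose AB n j om := row_mx (sigma0%:M) (sigma (xn n om j) (empirical (xn n om))).
pose AW n j om := row_mx (sigma1%:M) (sigmabar (xn n om j) (empirical (xn n om))).
pose G n j (c : ('I_N * 'I_(d + m1) + 'I_(d + m2))%type) om : 'cV[R]_d :=
  match c with
  | inl k => if k.1 == j then col k.2 (AB n j om) else 0
  | inr k => col k (AW n j om) end.
pose L : R := hsnorm (sigma0%:M : 'M[R]_d) + hsnorm (sigma1%:M : 'M[R]_d) + Lhat.
have L0 : 0 <= L by rewrite !addr_ge0 ?hsnorm_ge0// ltW.
have GL n j c om : hsnorm (G n j c om) <= L.
  have := sigma_bounded (xn n om j) _ (finite_first_moment_empirical N0 (xn n om)).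
  rewrite ge_max => /andP[s1 s2].
  have n0 := hsnorm_ge0 (sigma0%:M : 'M[R]_d); have n1 := hsnorm_ge0 (sigma1%:M : 'M[R]_d).
  case: c => [[j' k]|k] /=.
    case: ifP => _; last by rewrite hsnorm0.
    rewrite /AB; case: (split_ordP k) => k' ->; rewrite ?colKl ?colKr.
      by apply: (le_trans (hsnorm_col_le _ _)); rewrite /L; lra.
    by apply: (le_trans (hsnorm_col_le _ _)); apply: (le_trans s1); rewrite /L; lra.
  rewrite /AW; case: (split_ordP k) => k' ->; rewrite ?colKl ?colKr.
    by apply: (le_trans (hsnorm_col_le _ _)); rewrite /L; lra.
  by apply: (le_trans (hsnorm_col_le _ _)); apply: (le_trans s2); rewrite /L; lra.
pose be (x : 'I_N -> 'cV[R]_d) j := b (x j) (empirical x).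
have XE j n (t : R) om : tn n om <= t <= tn n.+1 om ->
    X j t om = X j (tn n om) om + (t - tn n om) *: be (fun k => X k (tn n om) om) j
      + \sum_c (w c t om - w c (tn n om) om) *: G n j c om.
  move=> tt; rewrite [LHS](XEM j n t om tt) -!addrA; congr (_ + (_ + _)).
  rewrite big_sumType/= addrA; congr (_ + _).
    rewrite -mul_scalar_mx -mul_row_col mulmx_sum_col.
    rewrite -(pair_bigA _ (fun a k => (wB (a, k) t om.1 - wB (a, k) (tn n om) om.1)
      *: (if a == j then col k (AB n j om) else 0)))/= (bigD1 j)//= eqxx.
    rewrite [X in _ = _ + X]big1 ?addr0.
      apply: eq_bigr => k _; congr (_ *: _).
      by case: (split_ordP k) => k' ->; rewrite /wB/= !(col_mxEu, col_mxEd) !mxE.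
    by move=> a /negPf aj; apply: big1 => k _; rewrite aj scaler0.
  rewrite -mul_scalar_mx -mul_row_col mulmx_sum_col.
  apply: eq_bigr => k _; congr (_ *: _).
  by case: (split_ordP k) => k' ->; rewrite /wW/= !(col_mxEu, col_mxEd) !mxE.
have mX j (t : R) a : 0 <= t -> sub_measurable (F t) (fun om => X j t om a 0).
  move=> t0; apply: (@measurable_wrt_comp R _ _ (F t) (X j t) (fun x => x a 0)).
  - exact: sF.
  - exact: adX.
  - exact: coord_continuous.
have step_gt0 (x : 'I_N -> 'cV[R]_d) : 0 < em_step b delta x by exact: em_step_gt0.
have step_meas dT' (T' : measurableType dT') (Y : T' -> 'I_N -> 'cV[R]_d) :
    (forall j a, measurable_fun setT (fun om => Y om j a 0)) ->
    measurable_fun setT (fun om => em_step b delta (Y om)).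
  by move=> mY; exact: (measurable_em_step delta N0 lambda2_gt0 b_W1 l_ge0 K_gt0 b_poly mY).
have be_meas dT' (T' : measurableType dT') (Y : T' -> 'I_N -> 'cV[R]_d) j a :
    (forall k a', measurable_fun setT (fun om => Y om k a' 0)) ->
    measurable_fun setT (fun om => be (Y om) j a 0).
  by move=> mY; exact: (measurable_drift N0 lambda2_gt0 b_W1 l_ge0 K_gt0 b_poly mY j a).
have tn0 om : tn 0%N om = 0 by [].
have tnS n om : tn n.+1 om = tn n om + em_step b delta (fun k => X k (tn n om) om) by [].
(* Proved ahead of [mG], because [stopped_sigma] is known to be a sigma-algebra only at stopping
   times. *)
have stn n := @grid_stopping_time _ _ _ _ fF _ _ _ _ cw _ _ _ _ _ step_gt0 step_meas tn0 tnS mX XE n.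
have mG n j c a : sub_measurable (stopped_sigma F (tn n)) (fun om => G n j c om a 0).
  have sG := stopped_sigma_algebra fF (stn n).
  case: c => [[j' k]|k] /=.
    case: eqP => _; last by under eq_fun do rewrite mxE; exact: measurable_cst.
    under eq_fun do rewrite mxE.
    rewrite /AB; case: (split_ordP k) => k' ->.
      by under eq_fun do rewrite row_mxEl; exact: measurable_cst.
    under eq_fun do rewrite row_mxEr.
    exact: (@measurable_wrt_comp R _ _ (stopped_sigma F (tn n)) _
      (fun x : 'M[R]_(d, m1) => x a k') sG (msig j n) (@coord_continuous R d m1 a k')).
  under eq_fun do rewrite mxE.
  rewrite /AW; case: (split_ordP k) => k' ->.
    by under eq_fun do rewrite row_mxEl; exact: measurable_cst.
  under eq_fun do rewrite row_mxEr.
  exact: (@measurable_wrt_comp R _ _ (stopped_sigma F (tn n)) _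
    (fun x : 'M[R]_(d, m2) => x a k') sG (msigbar j n) (@coord_continuous R d m2 a k')).
have [C0 [C00 drift]] := drift_bound N0 lambda2_gt0 b_W1 lambda1_gt0 l0_ge1 phi_ge0 phi_incr b_diss.
have l12 : lambda2 < lambda1 by lra.
(* Then p < j + 1 <= 2 (j + 1) = q. *)
pose j := Num.truncn p.
have pj : p <= (2 * j.+1)%:R.
  apply: (le_trans (ltW (truncnS_gt p))); rewrite ler_nat; exact: leq_pmull.
have [C [C_ge0 HC]] := @weighted_moment_bound _ _ _ P _ fF _ _ _ _ mw cw Hw _ be _ _ _ _
  step_gt0 (em_step_le1 b delta_gt0 delta_lt1) (em_step_drift_sqr b delta_gt0 delta_lt1)
  step_meas be_meas tn0 tnS mX mG GL XE j _ _ _ L0 l12 (ltW lambda2_gt0) C00 drift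
  (em_step_lower_bound N0 lambda2_gt0 b_W1 l_ge0 K_gt0 b_poly delta_gt0).
have fin k : (\int[P]_om (hsnorm (X k 0 om) `^ p)%:E < +oo)%E.
  under eq_integral do rewrite X0E.
  have FB0 : FB 0 `<=` measurable by case: FB_filtration => _ + _; apply.
  rewrite (iid_product_moment PW p k i FB0 X0_meas X0_iid).
  by move: fin0; rewrite unlock; under eq_integral do rewrite X0E.
have [C' [C'0 HC']] := @moment_of_weighted_moment R _ _ P (F 0) _ _ X j p C (sF 0 (lexx _))
  (FT 0 (lexx _)) (fun k a => mX k 0 a (lexx _))
  (fun k t a t0 => sub_measurableW (sF t t0) (FT t t0) (mX k t a t0)) HC p_gt0 pj fin.
(* Adding 1 makes the constant positive; the initial moment is nonnegative, so the uniform bound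
   [C'] implies the stated one. *)
exists (C' + 1); split; first by rewrite ltr_wpDl.
move=> t t0; apply: (@le_trans _ _ C'%:E).
  by rewrite unlock; exact: HC'.
apply: (@le_trans _ _ (C' + 1)%:E); first by rewrite lee_fin lerDl.
by rewrite leeDr// unlock integral_ge0// => om _; rewrite lee_fin powR_ge0.
Qed.
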